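(* Let $n\ge 1$ and let $\varrho_1,\varrho_2$ be two proximate orders for positive orders $\rho_1>0$ and $\rho_2>0$ respectively, satisfying $r^{\varrho_1(r)}=O(r^{\varrho_2(r)})$ as $r\to\infty$. (i) Suppose that $P=\sum_{\alpha\in\mathbb{N}^n}a_\alpha(z)\partial_z^\alpha$ belongs to $\boldsymbol{D}_{\varrho_1\to\varrho_2}$. For every entire function $f\in A_{\varrho_1}$, the series $Pf:=\sum_{\alpha\in\mathbb{N}^n}a_\alpha(z)\partial_z^\alpha f$ converges in $A_{\varrho_2}$, so that $Pf\in A_{\varrho_2}$. Moreover, $f\mapsto Pf$ defines a continuous homomorphism $P:A_{\varrho_1}\to A_{\varrho_2}$. (ii) Let $F:A_{\varrho_1}\to A_{\varrho_2}$ be a continuous homomorphism. Then there is a unique $P\in\boldsymbol{D}_{\varrho_1\to\varrho_2}$ such that $Ff=Pf$ holds for every $f\in A_{\varrho_1}$, where $Pf$ is defined by the series in (i).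
   Context: $\mathbb{N}=\{0,1,2,\dots\}$. For $\alpha\in\mathbb{N}^n$: $|\alpha|=\alpha_1+\dots+\alpha_n$, $\alpha!=\alpha_1!\cdots\alpha_n!$, $\partial_z^\alpha=\partial^{|\alpha|}/\partial z_1^{\alpha_1}\cdots\partial z_n^{\alpha_n}$. For $z\in\mathbb{C}^n$, $|z|=\sqrt{|z_1|^2+\dots+|z_n|^2}$. $\mathcal{O}(\mathbb{C}^n)$ is the space of entire functions. ''Continuous homomorphism'' means continuous $\mathbb{C}$-linear map. Proximate order: a differentiable function $\varrho(r)\ge 0$ defined for $r\ge 0$ is a proximate order for the order $\rho\ge 0$ if $\lim_{r\to+\infty}\varrho(r)=\rho$ and $\lim_{r\to+\infty}\varrho'(r)\,r\ln r=0$. Normalization: if $\varrho$ is a proximate order for a positive order $\rho>0$, a normalization of $\varrho$ is a proximate order $\hat\varrho$ such that there is $r_1>0$ with $\hat\varrho(r)=\varrho(r)$ for all $r\ge r_1$, and $r\mapsto r^{\hat\varrho(r)}$ is strictly increasing on $r>0$ and maps $(0,\infty)$ onto $(0,\infty)$. Such a normalization always exists. Given $\hat\varrho$, let $r=\varphi(t)$ $(t>0)$ be the inverse function of $t=r^{\hat\varrho(r)}$ $(r>0)$, and set $G_{\hat\varrho,q}:=\varphi(q)^q/(e\rho)^{q/\rho}$ for $q\in\mathbb{N}$ (with $G_{\hat\varrho,0}=1$). Spaces: for a proximate order $\varrho$ for a positive order and $\sigma>0$, $A_{\varrho,\sigma}$ is the Banach space of $f\in\mathcal{O}(\mathbb{C}^n)$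 with $\|f\|_{\varrho,\sigma}:=\sup_{z\in\mathbb{C}^n}|f(z)|\exp(-\sigma|z|^{\varrho(|z|)})<\infty$. $A_\varrho:=\varinjlim_{\sigma>0}A_{\varrho,\sigma}$ (the union over $\sigma>0$ with the locally convex inductive limit topology). Operators: fix a normalization $\hat\varrho_1$ of $\varrho_1$. $\boldsymbol{D}_{\varrho_1\to\varrho_2}$ is the set of all formal differential operators $P=\sum_{\alpha\in\mathbb{N}^n}a_\alpha(z)\partial_z^\alpha$ (identified with the multisequence $(a_\alpha)_{\alpha\in\mathbb{N}^n}$ of coefficients), with $(a_\alpha)_{\alpha}\subset A_{\varrho_2}$ satisfying $$\forall\lambda>0,\ \exists\sigma>0,\ \exists C>0,\ \forall\alpha\in\mathbb{N}^n,\quad \|a_\alpha\|_{\varrho_2,\sigma}\le C\,\frac{G_{\hat\varrho_1,|\alpha|}}{\alpha!}\lambda^{|\alpha|}.$$ This set does not depend on the choice of the normalization $\hat\varrho_1$. Convergence of a series indexed by $\mathbb{N}^n$ means convergence of the net of its finite partial sums. *)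

(* Defs.v *)
From HB Require Import structures.
From mathcomp Require Import all_boot all_order all_algebra finmap.
From mathcomp Require Import complex.
From mathcomp Require Import all_classical all_reals all_analysis.
From mathcomp Require Import showcase.summability.

Set Implicit Arguments.
Unset Strict Implicit.
Unset Printing Implicit Defensive.

Import Order.TTheory GRing.Theory Num.Theory.
Import numFieldNormedType.Exports.

Local Open Scope classical_set_scope.
Local Open Scope ring_scope.

(* R[i] as a numFieldType, so that it carries the usual topology and is a
   normed module over itself. *)
Definition Cplx (R : realType) : numFieldType := R[i].

Definition cmod (R : realType) (x : Cplx R) : R := complex.Re `|x|.

(* The norm of the matrix library is the sup norm; weights use this one. *)
Definition eucl (R : realType) (n : nat) (z : 'rV[Cplx R]_n) : R :=
  Num.sqrt (\sum_i cmod (z ord0 i) ^+ 2).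

(* Lets the notation =O_+oo of landau be used. *)
Canonical pinfty_filter_on (R : realType) := FilterType (pinfty_nbhs R) _.

Definition multi_index (n : nat) := {ffun 'I_n -> nat}.

Definition mi_abs (n : nat) (al : multi_index n) : nat :=
  (\sum_i al i)%N.

Definition mi_fact (n : nat) (al : multi_index n) : nat :=
  (\prod_i (al i)`!)%N.

(* Complex differentiability at every point. *)
Definition entire (R : realType) (n : nat) (f : 'rV[Cplx R]_n -> Cplx R) :=
  forall z, differentiable f z.

Definition mi_derive (R : realType) (n : nat) (al : multi_index n)
    (f : 'rV[Cplx R]_n -> Cplx R) : 'rV[Cplx R]_n -> Cplx R :=
  foldr (fun i => iter (al i) (fun g => 'D_(delta_mx ord0 i) g))
    f (enum 'I_n).

(* Only the values of rho on [0, +oo[ matter; differentiability at 0 is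
   one-sided. *)
Definition proximate_order (R : realType) (rho : R -> R) (r0 : R) :=
  [/\ 0 <= r0,
      forall r, 0 <= r -> 0 <= rho r,
      (forall r, 0 < r -> derivable rho r 1) /\
        cvg (h^-1 * (rho h - rho 0) @[h --> 0^'+]),
      rho r @[r --> +oo] --> r0 &
      derive1 rho r * (r * ln r) @[r --> +oo] --> (0 : R)].

Definition normalization (R : realType) (rho : R -> R) (r0 : R)
    (rhoh : R -> R) :=
  [/\ proximate_order rhoh r0,
      exists2 r1, 0 < r1 & forall r, r1 <= r -> rhoh r = rho r,
      forall r s, 0 < r -> r < s -> r `^ rhoh r < s `^ rhoh s &
      (fun r => r `^ rhoh r) @` [set r | 0 < r] = [set t | 0 < t]].

(* The inverse of r |-> r `^ rhoh r on the positive reals. *)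
Definition phi_inv (R : realType) (rhoh : R -> R) : R -> R :=
  'pinv_(fun=> 0) [set r : R | 0 < r] (fun r => r `^ rhoh r).

(* At q = 0 this is 1, whatever phi_inv rhoh 0 is. *)
Definition Gseq (R : realType) (rhoh : R -> R) (r0 : R) (q : nat) : R :=
  phi_inv rhoh q%:R ^+ q / (expR 1 * r0) `^ (q%:R / r0).

Section weighted_norm.
Context (R : realType) (n : nat) (rho : R -> R).
Local Notation C := (Cplx R).
Implicit Types f g : 'rV[C]_n -> C.

Definition wnorm (sigma : R) f : \bar R :=
  ereal_sup (range (fun z : 'rV[C]_n =>
    (cmod (f z) * expR (- (sigma * eucl z `^ rho (eucl z))))%:E)).

Lemma cmodE (x : C) : `|x| = (cmod x)%:C%C.
Proof. by rewrite /cmod normc_def. Qed.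

Lemma cmod_ge0 (x : C) : 0 <= cmod x.
Proof. by rewrite /cmod normc_def sqrtr_ge0. Qed.

Lemma cmodM (x y : C) : cmod (x * y) = cmod x * cmod y.
Proof. by apply: complexI; rewrite rmorphM /= -!cmodE normrM. Qed.

Lemma ler_cmodD (x y : C) : cmod (x + y) <= cmod x + cmod y.
Proof. by rewrite -lecR rmorphD /= -!cmodE ler_normD. Qed.

Lemma wnorm_leP sigma f (M : R) : (wnorm sigma f <= M%:E)%E <->
  forall z, cmod (f z) * expR (- (sigma * eucl z `^ rho (eucl z))) <= M.
Proof.
split=> [fM z|fM].
  rewrite -lee_fin (le_trans _ fM)//; apply: ereal_sup_ubound.
  by exists z.
by apply: ge_ereal_sup => _ [z _ <-]; rewrite lee_fin.
Qed.

Lemma wnorm_ge0 sigma f : (0 <= wnorm sigma f)%E.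
Proof.
apply: le_trans (ereal_sup_ubound _); last by exists 0.
by rewrite lee_fin mulr_ge0 ?cmod_ge0 ?expR_ge0.
Qed.

Lemma wnorm_lt_leP sigma f (M : R) : (wnorm sigma f < M%:E)%E ->
  exists2 K, K < M & (wnorm sigma f <= K%:E)%E.
Proof.
move=> fM; exists (fine (wnorm sigma f)).
  by rewrite -lte_fin fineK// ge0_fin_numE ?wnorm_ge0// (lt_trans fM)// ltry.
by rewrite fineK// ge0_fin_numE ?wnorm_ge0// (lt_trans fM)// ltry.
Qed.

Lemma wnorm_ltyP sigma f : (wnorm sigma f < +oo)%E ->
  exists K, (wnorm sigma f <= K%:E)%E.
Proof.
by move=> fy; exists (fine (wnorm sigma f)); rewrite fineK// ge0_fin_numE ?wnorm_ge0.
Qed.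

Lemma wnormZ_le sigma c f (K : R) : (wnorm sigma f <= K%:E)%E ->
  (wnorm sigma (c *: f) <= (cmod c * K)%:E)%E.
Proof.
move=> /wnorm_leP fK; apply/wnorm_leP => z.
by rewrite /= cmodM -mulrA ler_wpM2l ?cmod_ge0.
Qed.

Lemma wnormD_le sigma f g (K L : R) :
  (wnorm sigma f <= K%:E)%E -> (wnorm sigma g <= L%:E)%E ->
  (wnorm sigma (f + g)%R <= (K + L)%:E)%E.
Proof.
move=> /wnorm_leP fK /wnorm_leP gL; apply/wnorm_leP => z.
rewrite (le_trans _ (lerD (fK z) (gL z)))// -mulrDl.
by rewrite ler_wpM2r ?expR_ge0// ler_cmodD.
Qed.

Lemma wnorm_le_sigma sigma tau f (K : R) : sigma <= tau ->
  (wnorm sigma f <= K%:E)%E -> (wnorm tau f <= K%:E)%E.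
Proof.
move=> st /wnorm_leP fK; apply/wnorm_leP => z; apply: le_trans (fK z).
by rewrite ler_wpM2l ?cmod_ge0// ler_expR lerN2 ler_wpM2r// powR_ge0.
Qed.

(* The union over sigma > 0 of the spaces A_(rho, sigma). *)
Definition growth : {pred 'rV[C]_n -> C} := mem [set f |
  entire f /\ exists2 sigma, 0 < sigma & (wnorm sigma f < +oo)%E].

Lemma growth_submod_closed : submod_closed growth.
Proof.
split.
  apply/mem_set; split; first by move=> z; exact: differentiable_cst.
  exists 1 => //; apply: (@le_lt_trans _ _ 0%:E); last exact: ltry.
  by apply/wnorm_leP => z; rewrite /cmod normr0 mul0r.
move=> c f g /set_mem[df [s s0 /wnorm_ltyP[K fK]]].
move=> /set_mem[dg [t t0 /wnorm_ltyP[L gL]]]; apply/mem_set; split.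
  move=> z; apply: differentiableD; last exact: dg.
  apply: differentiableZ; exact: df.
exists (Num.max s t); first by rewrite lt_max s0.
apply: (@le_lt_trans _ _ (cmod c * K + L)%:E); last exact: ltry.
apply: wnormD_le.
  by apply/wnormZ_le/(wnorm_le_sigma _ fK); rewrite le_max lexx.
by apply/(wnorm_le_sigma _ gL); rewrite le_max lexx orbT.
Qed.

HB.instance Definition _ := GRing.isSubmodClosed.Build _ _ growth
  growth_submod_closed.

End weighted_norm.

(* The space A_rho. *)
Record Aspace (R : realType) (n : nat) (rho : R -> R) := MkAspace {
  Afun :> 'rV[Cplx R]_n -> Cplx R ;
  AfunP : Afun \in @growth R n rho }.

Section inductive_limit_topology.
Context (R : realType) (n : nat) (rho : R -> R).
Local Notation C := (Cplx R).
Local Notation A := (@Aspace R n rho).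

HB.instance Definition _ := [isSub for @Afun R n rho].
HB.instance Definition _ := [Choice of A by <:].
HB.instance Definition _ := [SubChoice_isSubLmodule of A by <:].

Definition abs_convex (U : set A) := forall f g (s t : C),
  U f -> U g -> `|s| + `|t| <= 1 -> U (s *: f + t *: g).

(* The locally convex inductive limit topology, i.e. the finest locally convex
   topology for which all the inclusions of the A_(rho, sigma) are continuous:
   a base at 0 is formed by the absolutely convex sets whose trace on every
   A_(rho, sigma) contains a ball centered at 0. *)
Definition lim_base (U : set A) := abs_convex U /\
  forall sigma : R, 0 < sigma -> exists2 eps : R, 0 < eps &
    forall f : A, (wnorm rho sigma f < eps%:E)%E -> U f.

Definition lim_nbhs (f : A) : set_system A :=
  filter_from lim_base (fun U => [set g | U (g - f)]).

HB.instance Definition _ := hasNbhs.Build A lim_nbhs.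

Lemma lim_base0 U : lim_base U -> U 0.
Proof.
move=> [_ /(_ 1 ltr01)[e e0]]; apply.
apply: le_lt_trans (_ : 0%:E < _)%E; last by rewrite lte_fin.
by apply/wnorm_leP => z; rewrite /cmod normr0 mul0r.
Qed.

Lemma lim_baseI U V : lim_base U -> lim_base V -> lim_base (U `&` V).
Proof.
move=> [aU bU] [aV bV]; split.
  by move=> f g s t [Uf Vf] [Ug Vg] st; split; [exact: aU|exact: aV].
move=> s s0; have [e e0 He] := bU s s0; have [d d0 Hd] := bV s s0.
exists (Num.min e d); first by rewrite lt_min e0.
move=> f fe; split; [apply: He|apply: Hd]; apply: lt_le_trans fe _;
  by rewrite lee_fin ge_min lexx ?orbT.
Qed.

Lemma lim_baseZ U (c : C) : lim_base U -> lim_base [set f | U (c *: f)].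
Proof.
move=> [aU bU]; split.
  move=> f g s t Uf Ug st /=.
  by rewrite scalerDr !scalerA ![c * _]mulrC -!scalerA; exact: aU.
move=> s s0; have [e e0 He] := bU s s0.
have c1 : 0 < cmod c + 1 by rewrite ltr_wpDl ?cmod_ge0.
exists (e / (cmod c + 1)); first by rewrite divr_gt0.
move=> f /wnorm_lt_leP[K Ke fK]; apply: He.
apply: le_lt_trans (wnormZ_le c fK) _; rewrite lte_fin.
have K0 : 0 <= K by rewrite -lee_fin (le_trans (wnorm_ge0 rho s f)).
apply: (@le_lt_trans _ _ ((cmod c + 1) * K)).
  by rewrite ler_wpM2r// lerDl.
by rewrite mulrC -ltr_pdivlMr.
Qed.

(* Every element of A_rho is absorbed. *)
Lemma lim_base_absorb U (f : A) : lim_base U ->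
  exists2 d : R, 0 < d & U (d%:C%C *: f).
Proof.
move=> [_ bU]; have /set_mem[_ [s s0 /wnorm_ltyP[K fK]]] := AfunP f.
have [e e0 He] := bU s s0.
have K0 : 0 <= K by rewrite -lee_fin (le_trans (wnorm_ge0 rho s f)).
have d0 : 0 < e / (K + 1) by rewrite divr_gt0// ltr_wpDl.
exists (e / (K + 1)) => //; apply: He.
apply: le_lt_trans (wnormZ_le _ fK) _; rewrite lte_fin.
rewrite /cmod ger0_norm ?lecR ?ltW//= mulrAC ltr_pdivrMr ?ltr_wpDl//.
by rewrite ltr_pM2l// ltrDl.
Qed.

Lemma lim_nbhs_filter (f : A) : ProperFilter (nbhs f).
Proof.
apply: filter_from_proper; last first.
  by move=> U bU; exists f; rewrite /= subrr; exact: lim_base0.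
apply: filter_from_filter.
  by exists setT; split=> // s s0; exists 1.
move=> U V bU bV; exists (U `&` V); first exact: lim_baseI.
by move=> g [].
Qed.

Lemma lim_nbhs_singleton (f : A) (V : set A) : nbhs f V -> V f.
Proof. by move=> [U bU]; apply; rewrite /= subrr; exact: lim_base0. Qed.

Lemma normr2V : `|2^-1 : C| + `|2^-1 : C| <= 1.
Proof. by rewrite gtr0_norm ?invr_gt0// -[_^-1]mul1r -splitr. Qed.

Lemma lim_base_half U (f g : A) : lim_base U ->
  U (2 *: f) -> U (2 *: g) -> U (f + g).
Proof.
move=> [aU _] Uf Ug; have := aU _ _ _ _ Uf Ug normr2V.
by rewrite !scalerA mulVf// !scale1r.
Qed.

Lemma lim_nbhs_nbhs (f : A) (V : set A) : nbhs f V -> nbhs f (nbhs^~ V).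
Proof.
move=> [U bU UV]; exists [set h | U (2 *: h)]; first exact: lim_baseZ.
move=> g /= Ug; exists [set h | U (2 *: h)]; first exact: lim_baseZ.
move=> h /= Uh; apply: UV => /=.
rewrite -(subrK g h) -addrA; exact: lim_base_half.
Qed.

HB.instance Definition _ := Nbhs_isNbhsTopological.Build A
  lim_nbhs_filter lim_nbhs_singleton lim_nbhs_nbhs.

Lemma lim_add_continuous : continuous (fun x : A * A => x.1 + x.2).
Proof.
move=> [f g] V [U bU UV]; have bU2 := lim_baseZ 2 bU.
exists ([set h | U (2 *: (h - f))], [set h | U (2 *: (h - g))]).
  by split; exists [set h | U (2 *: h)].
move=> [h k] [/= Uh Uk]; apply: UV => /=.
rewrite opprD addrACA; exact: lim_base_half.
Qed.

Lemma lim_scale_continuous : continuous (fun z : C^o * A => z.1 *: z.2).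
Proof.
move=> [s f] V [U bU UV]; have [d d0 Ud] := lim_base_absorb f bU.
have dC0 : 0 < d%:C%C :> C by rewrite ltcR.
pose M : C := `|s| + 1; have M0 : 0 < M by rewrite ltr_wpDl.
exists (ball s 1 `&` ball s (d%:C%C / 2 : C), [set g | U ((2 * M) *: (g - f))]).
  split; last by exists [set h | U ((2 * M) *: h)] => //; exact: lim_baseZ.
  by apply: filterI; apply: nbhsx_ballx => //; rewrite divr_gt0.
move=> [t g] [/= [st1 std] Ug]; apply: UV => /=.
have -> : t *: g - s *: f = (t / (2 * M)) *: ((2 * M) *: (g - f)) +
                            ((t - s) / d%:C%C) *: (d%:C%C *: f).
  rewrite !scalerA !divfK ?gt_eqF ?mulr_gt0//.
  by rewrite scalerBr scalerBl addrA subrK.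
have [aU _] := bU; apply: aU => //.
have tM : `|t| <= M.
  rewrite -(subrK s t) addrC (le_trans (ler_normD _ _))// lerD2l.
  by rewrite distrC ltW.
rewrite [leRHS](splitr 1); apply: lerD.
  have M2 : 0 < 2 * M by rewrite mulr_gt0.
  by rewrite normrM normfV (gtr0_norm M2) ler_pdivrMr// mul1r mulKf.
by rewrite normrM normfV (gtr0_norm dC0) ler_pdivrMr// mul1r mulrC distrC ltW.
Qed.

Lemma lim_locally_convex :
  exists2 B : set_system A, (forall b, b \in B -> convex_set b) & basis B.
Proof.
exists [set V | open V /\ convex_set (V : set (convex_lmodType A))].
  by move=> b /set_mem[].
split=> [V []//|f V [U bU UV]].
pose W : set A := [set g | nbhs g [set h | U (h - f)]].
exists W; last first.
  by move=> g /= /lim_nbhs_singleton; exact: UV.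
split; last by exists U.
split; first by rewrite openE => g /lim_nbhs_nbhs.
move=> g h l /set_mem[U1 bU1 gU1] /set_mem[U2 bU2 hU2]; apply/mem_set.
exists (U1 `&` U2); first exact: lim_baseI.
move=> k [/= U1k U2k].
set x := (conv l g h : A) in U1k U2k *.
have [aU _] := bU.
have Ug : U (g + (k - x) - f) by apply: gU1; rewrite /= addrC addKr.
have Uh : U (h + (k - x) - f) by apply: hU2; rewrite /= addrC addKr.
have l1 : `|l%:num| + `|1 - l%:num| <= 1 :> C.
  rewrite [X in X + _]ger0_norm// [X in _ + X]ger0_norm ?subr_ge0//.
  by rewrite addrC subrK.
suff <- : l%:num *: (g + (k - x) - f) + (1 - l%:num) *: (h + (k - x) - f) =
    k - f :> A by exact: aU.
have E (d : A) : l%:num *: (g + d) + (1 - l%:num) *: (h + d) = x + d.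
  rewrite !scalerDr addrACA -scalerDl [l%:num + _]addrC subrK scale1r.
  by [].
by rewrite -(addrA g) -(addrA h) E addrCA addrA subrK.
Qed.

(* This factory only provides the uniform structure. *)
HB.instance Definition _ := PreTopologicalLmod_isTvs.Build C A
  lim_add_continuous lim_scale_continuous lim_locally_convex.
HB.instance Definition _ :=
  PreTopologicalNmodule_isTopologicalNmodule.Build A lim_add_continuous.
HB.instance Definition _ :=
  TopologicalNmodule_isTopologicalLmodule.Build C A lim_scale_continuous.
HB.instance Definition _ := Uniform_isTvs.Build C A lim_locally_convex.

End inductive_limit_topology.

(* The set of operators from rho1 to rho2, as multisequences of coefficients;
   rhoh1 is the chosen normalization of rho1 and r1 its order. *)
Definition op_class (R : realType) (n : nat) (rhoh1 : R -> R) (r1 : R)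
    (rho2 : R -> R) : set (multi_index n -> Aspace n rho2) :=
  [set a | forall lam : R, 0 < lam ->
    exists2 sigma : R, 0 < sigma & exists2 M : R, 0 < M &
    forall al : multi_index n,
      (wnorm rho2 sigma (a al) <=
       (M * (Gseq rhoh1 r1 (mi_abs al) / (mi_fact al)%:R)
          * lam ^+ mi_abs al)%:E)%E].

(* All the terms a_al * d^al f belong to A_rho2 and the net of the finite
   partial sums of the series converges to g in A_rho2. *)
Definition op_series (R : realType) (n : nat) (rho1 rho2 : R -> R)
    (a : multi_index n -> Aspace n rho2) (f : Aspace n rho1)
    (g : Aspace n rho2) :=
  exists2 t : multi_index n -> Aspace n rho2,
    forall al z, t al z = a al z * mi_derive al f z &
    partial_sum t @ totally --> g.

(* Main.v *)
Require Import Defs.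
From HB Require Import structures.
From mathcomp Require Import all_boot all_order all_algebra finmap.
From mathcomp Require Import complex.
From mathcomp Require Import all_classical all_reals all_analysis.
From mathcomp Require Import showcase.summability.
From mathcomp Require Import ring lra.

(** Write [w_i r = r ^ rho_i r] for the weights and [phi] for the inverse of the
    normalized first weight, and let [q = |al|].

    The growth of a weight is polynomial: its logarithmic derivative tends to
    the order ([weight_growth]). Hence [w_i (a + b)] is controlled by [w_i a] and
    [w_i b] ([weight_subadd]), and for every [e > 0] there is [sigma] with
    [r ^ q <= K (e phi q) ^ q exp (sigma w_1 r)] ([monomial_weight]). Since the
    constants [lam] and [sigma] of the statement are arbitrary, geometric factors
    are harmless and crude constants suffice.

    Operators from coefficients. The Cauchy estimate on a polydisc of radius
    comparable to [phi q], where [w_1] is about [q], bounds [d^al f] by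
    [al! (kap / phi q) ^ q exp (sigma' w_1)] ([mi_derive_bound]). Multiplied by
    the bound on [a_al], the powers of [phi q] cancel and a geometric series
    remains, which converges in the norm of some [A_(rho2, tau)]
    ([op_series_exists]).

    Coefficients from operators. A continuous linear [F] maps each
    [A_(rho1, sigma)] boundedly into some [A_(rho2, tau)] ([continuous_bounded]).
    Applying [F f = P f] to [f x = (x - z) ^ al] and evaluating at [z] forces
    [al! a_al z = F ((_ - z) ^ al) z], which gives uniqueness ([coef_unique]).
    Conversely, the coefficients so defined satisfy the required bounds because
    [monomial_weight] controls the norm of [(_ - z) ^ al], and they represent [F]
    because the Taylor series of [f] at [z] converges to [f] in [A_rho1]
    ([taylor_series]): [F] may be applied to it term by term, and the result
    evaluated at [z].

    All the complex analysis comes from one estimate, [|f' w| <= 2 M / s] when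
    [|f| <= M] on the disc of radius [s] at [w] ([cauchy1]), for functions that
    are just complex differentiable at each point. It follows from Goursat's
    theorem in logarithmic coordinates. Applied to [f] and to its translates,
    it yields a second order Taylor bound ([quadratic1]), from which Weierstrass'
    theorem ([weierstrass]), the smoothness of entire functions of several
    variables ([entireb_partial], [partialC]), the Cauchy estimates for all
    derivatives ([cauchy_mi]) and the identity theorem ([flat_eq0]) are deduced
    without any integral in several variables. *)

Set Implicit Arguments.
Unset Strict Implicit.
Unset Printing Implicit Defensive.

Import Order.TTheory GRing.Theory Num.Theory.
Import numFieldNormedType.Exports.

Local Open Scope classical_set_scope.
Local Open Scope ring_scope.

(** * Goursat's theorem for real differential forms *)

Section green_goursat.
Context (R : realType).
Implicit Types (f : R -> R) (a b c d x y e : R).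

Definition rint a b f : R := \int[lebesgue_measure]_(x in `[a, b]) f x.

Lemma cont_integrable f a b : continuous f ->
  lebesgue_measure.-integrable `[a, b] (EFin \o f).
Proof.
move=> cf; apply: continuous_compact_integrable; first exact: segment_compact.
exact: continuous_subspaceT.
Qed.

Lemma rint_split f a b c : continuous f -> a <= b -> b <= c ->
  rint a c f = rint a b f + rint b c f.
Proof.
move=> cf ab bc; have cfi u v := cont_integrable u v cf.
rewrite /rint -[X in _ + X]Rintegral_itv_obnd_cbnd; last first.
  by apply: integrableS (cfi b c) => //; apply: subset_itvr; rewrite /= ?bnd_simp.
rewrite -(@Rintegral_itvB _ f (BLeft a) (BRight c) b) ?bnd_simp//.
by rewrite addrC subrK.
Qed.

Lemma rintD f g a b : continuous f -> continuous g ->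
  rint a b (fun x => f x + g x) = rint a b f + rint a b g.
Proof. by move=> cf cg; apply: RintegralD => //; apply: cont_integrable. Qed.

Lemma rintB f g a b : continuous f -> continuous g ->
  rint a b (fun x => f x - g x) = rint a b f - rint a b g.
Proof. by move=> cf cg; apply: RintegralB => //; apply: cont_integrable. Qed.

Lemma rint_cst a b k : a <= b -> rint a b (cst k) = k * (b - a).
Proof.
move=> ab; rewrite /rint Rintegral_cst//= lebesgue_measure_itv/= lte_fin.
by move: ab; rewrite le_eqVlt => /orP[/eqP->|->]//; rewrite ltxx subrr.
Qed.

Lemma rint_near f a b k e : continuous f -> a <= b ->
  (forall x, a <= x <= b -> `|f x - k| <= e) ->
  `|rint a b f - k * (b - a)| <= e * (b - a).
Proof.
move=> cf ab fk; rewrite -!rint_cst//.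
have ck (l : R) : continuous (cst l : R -> R) by move=> x; apply: cvg_cst.
have cD : continuous (fun x => f x - k).
  by move=> x; apply: continuousB; [exact: cf|exact: ck].
rewrite -(rintB _ _ cf (ck k)); have fi := cont_integrable a b cD.
apply: (@le_trans _ _ (rint a b (fun x => `|f x - k|))).
  exact: (le_normr_Rintegral _ fi).
apply: le_Rintegral => //.
- apply: (@cont_integrable (fun x => `|f x - k|)) => x.
  by apply: cvg_norm; exact: cD.
- exact: cont_integrable (ck e).
Qed.

Lemma half_pow_small (C e : R) : 0 < e -> exists k, C / 2 ^+ k < e.
Proof.
move=> e0; exists (Num.truncn (`|C| / e)).+1.
set k := _.+1; rewrite ltr_pdivrMr ?exprn_gt0//.
apply: le_lt_trans (ler_norm _) _; rewrite -ltr_pdivrMl// mulrC.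
apply: lt_trans (truncnS_gt _) _.
by rewrite -natrX ltr_nat ltn_expl.
Qed.

Lemma nested_halves (u : nat -> R) (L : R) : 0 <= L ->
  (forall k, u k <= u k.+1 <= u k + L / 2 ^+ k.+1) ->
  exists x, forall k, u k <= x <= u k + L / 2 ^+ k.
Proof.
move=> L0 uP; have halve k : L / 2 ^+ k = L / 2 ^+ k.+1 + L / 2 ^+ k.+1.
  by rewrite exprS; field; rewrite expf_neq0.
have u_nd : {homo u : m n / (m <= n)%N >-> m <= n}.
  by apply: homo_leq => [//|? ? ?|k]; [exact: le_trans|case/andP: (uP k)].
have v_ni k m : u (k + m)%N + L / 2 ^+ (k + m) <= u k + L / 2 ^+ k.
  elim: m => [|m IH]; first by rewrite addn0.
  apply: le_trans IH; rewrite addnS (halve (k + m)%N) addrA lerD2r.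
  by case/andP: (uP (k + m)%N).
have Lp k : 0 <= L / 2 ^+ k by rewrite divr_ge0.
have ub j k : u j <= u k + L / 2 ^+ k.
  have [jk|kj] := leqP j k.
    by apply: le_trans (u_nd _ _ jk) _; rewrite lerDl.
  have := v_ni k (j - k)%N; rewrite subnKC 1?ltnW//; apply: le_trans.
  by rewrite lerDl.
exists (sup (range u)) => k; apply/andP; split.
  apply: ub_le_sup; last by exists k.
  by exists (u 0 + L / 2 ^+ 0) => _ [j _ <-].
by apply: ge_sup; [exists (u 0%N), 0%N|move=> _ [j _ <-]].
Qed.

Variables P Q : R -> R -> R.
Hypothesis cP : forall y, continuous (P ^~ y).
Hypothesis cQ : forall x, continuous (Q x).

(** The form [P dx + Q dy] is closed in a pointwise sense: one number [B] is
    both [P_y] and [Q_x], and nothing is asked of the derivatives as functions. *)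
Definition closed_form := forall x y, exists A B D : R,
  forall e, 0 < e -> exists2 dl, 0 < dl & forall x' y',
    `|x' - x| < dl -> `|y' - y| < dl ->
    `|P x' y' - P x y - A * (x' - x) - B * (y' - y)| <=
        e * (`|x' - x| + `|y' - y|) /\
    `|Q x' y' - Q x y - B * (x' - x) - D * (y' - y)| <=
        e * (`|x' - x| + `|y' - y|).

Definition circ a b c d := rint a b (fun x => P x c - P x d) +
  rint c d (fun y => Q b y - Q a y).

Let cPB y y' : continuous (fun x => P x y - P x y').
Proof. by move=> x; apply: continuousB; exact: cP. Qed.

Let cQB x x' : continuous (fun y => Q x y - Q x' y).
Proof. by move=> y; apply: continuousB; exact: cQ. Qed.

Lemma circ_splitx a m b c d : a <= m -> m <= b ->
  circ a b c d = circ a m c d + circ m b c d.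
Proof.
move=> am mb; rewrite /circ (rint_split (@cPB c d) am mb).
rewrite (_ : rint c d (fun y => Q b y - Q a y) =
  rint c d (fun y => Q m y - Q a y) + rint c d (fun y => Q b y - Q m y)).
  by rewrite addrACA.
rewrite -rintD//; congr rint; apply/funext => y; ring.
Qed.

Lemma circ_splity a b c m d : c <= m -> m <= d ->
  circ a b c d = circ a b c m + circ a b m d.
Proof.
move=> am mb; rewrite /circ (rint_split (@cQB b a) am mb).
rewrite (_ : rint a b (fun x => P x c - P x d) =
  rint a b (fun x => P x c - P x m) + rint a b (fun x => P x m - P x d)).
  by rewrite addrACA.
rewrite -rintD//; congr rint; apply/funext => y; ring.
Qed.

(** The affine parts of [P] and [Q] at a point contribute opposite multiples of
    the area, because [P_y = Q_x]; only the remainders are left. *)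
Lemma circ_local x y e : closed_form -> 0 < e ->
  exists2 dl, 0 < dl & forall a c X Y, 0 <= X < dl -> 0 <= Y < dl ->
    a <= x <= a + X -> c <= y <= c + Y ->
    `|circ a (a + X) c (c + Y)| <= e * (X + Y) ^+ 2.
Proof.
move=> /(_ x y)[A [B [D cl]]] e0; have e2 : 0 < e / 2 by rewrite divr_gt0.
have [dl dl0 PQ] := cl _ e2; exists dl => // a c X Y /andP[X0 Xd] /andP[Y0 Yd].
move=> /andP[ax xa] /andP[cy yc].
have PQ' u v : a <= u <= a + X -> c <= v <= c + Y ->
    `|P u v - P x y - A * (u - x) - B * (v - y)| <= e / 2 * (X + Y) /\
    `|Q u v - Q x y - B * (u - x) - D * (v - y)| <= e / 2 * (X + Y).
  move=> /andP[au ua] /andP[cv vc].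
  have ux : `|u - x| <= X by clear -au ua ax xa; rewrite ler_norml; lra.
  have vy : `|v - y| <= Y by clear -cv vc cy yc; rewrite ler_norml; lra.
  have [pp qq] := PQ u v (le_lt_trans ux Xd) (le_lt_trans vy Yd).
  have hl : e / 2 * (`|u - x| + `|v - y|) <= e / 2 * (X + Y).
    by apply: ler_wpM2l; [exact: ltW|exact: lerD].
  by split; [apply: le_trans pp hl|apply: le_trans qq hl].
have aX : a <= a + X by rewrite lerDl.
have cY : c <= c + Y by rewrite lerDl.
have aa : a <= a <= a + X by rewrite lexx.
have ba : a <= a + X <= a + X by rewrite aX lexx.
have cc : c <= c <= c + Y by rewrite lexx.
have dc : c <= c + Y <= c + Y by rewrite cY lexx.
have sum2 (t1 t2 : R) : `|t1| <= e / 2 * (X + Y) -> `|t2| <= e / 2 * (X + Y) ->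
    `|t1 - t2| <= e * (X + Y).
  move=> h1 h2; apply: le_trans (ler_normB _ _) _.
  by rewrite [e in leRHS](splitr e) mulrDl; exact: lerD.
have J1 : `|rint a (a + X) (fun x' => P x' c - P x' (c + Y))
     - (- B * Y) * ((a + X) - a)| <= e * (X + Y) * ((a + X) - a).
  apply: rint_near => // u au.
  have [p1 _] := PQ' u c au cc; have [p2 _] := PQ' u (c + Y) au dc.
  by have := sum2 _ _ p1 p2; congr (`|_| <= _); ring.
have J2 : `|rint c (c + Y) (fun v => Q (a + X) v - Q a v)
     - (B * X) * ((c + Y) - c)| <= e * (X + Y) * ((c + Y) - c).
  apply: rint_near => // v cv.
  have [_ p1] := PQ' (a + X) v ba cv; have [_ p2] := PQ' a v aa cv.
  by have := sum2 _ _ p1 p2; congr (`|_| <= _); ring.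
have := lerD J1 J2; rewrite /circ.
set I1 := rint _ _ _; set I2 := rint _ _ _.
rewrite -mulrDr => /(le_trans (ler_normD _ _)) J12.
have -> : I1 + I2 = I1 - - B * Y * (a + X - a) + (I2 - B * X * (c + Y - c)).
  by ring.
by apply: le_trans J12 _; rewrite [leLHS](_ : _ = e * (X + Y) ^+ 2)//; ring.
Qed.

(** Goursat's bisection argument: a rectangle with nonzero circulation
    contains a quarter carrying at least a fourth of it, and so on down to a
    point, where differentiability makes the circulation negligible compared
    with the area. *)
Theorem green_goursat a b c d : closed_form -> a <= b -> c <= d ->
  circ a b c d = 0.
Proof.
move=> cl ab cd; apply/eqP/negPn/negP => J0.
pose X := b - a; pose Y := d - c; set E := `|circ a b c d|.
have E0 : 0 < E by rewrite normr_gt0.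
have X0 : 0 <= X by rewrite subr_ge0.
have Y0 : 0 <= Y by rewrite subr_ge0.
pose J k (p : R * R) := circ p.1 (p.1 + X / 2 ^+ k) p.2 (p.2 + Y / 2 ^+ k).
have halve (L : R) k : L / 2 ^+ k = L / 2 ^+ k.+1 + L / 2 ^+ k.+1.
  by rewrite exprS; field; rewrite expf_neq0.
pose next k (p p' : R * R) := [/\ p.1 <= p'.1 <= p.1 + X / 2 ^+ k.+1,
  p.2 <= p'.2 <= p.2 + Y / 2 ^+ k.+1 & `|J k p| / 4 <= `|J k.+1 p'|].
have nextP k p : exists p', next k p p'.
  set Xk := X / 2 ^+ k.+1; set Yk := Y / 2 ^+ k.+1.
  have Xk0 : 0 <= Xk by rewrite divr_ge0.
  have Yk0 : 0 <= Yk by rewrite divr_ge0.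
  have Jsp : J k p = J k.+1 p + J k.+1 (p.1 + Xk, p.2) +
     (J k.+1 (p.1, p.2 + Yk) + J k.+1 (p.1 + Xk, p.2 + Yk)).
    rewrite /J/= (halve X) (halve Y) -/Xk -/Yk !addrA.
    rewrite (@circ_splity _ _ _ (p.2 + Yk)) ?lerDl//.
    have h1 : p.1 <= p.1 + Xk by rewrite lerDl.
    have h2 : p.1 + Xk <= p.1 + Xk + Xk by rewrite lerDl.
    by rewrite !(circ_splitx _ _ h1 h2) !addrA.
  apply: contrapT => /forallNP N.
  have sm p' : p.1 <= p'.1 <= p.1 + Xk -> p.2 <= p'.2 <= p.2 + Yk ->
      `|J k.+1 p'| < `|J k p| / 4.
    by move=> h1 h2; rewrite ltNge; apply/negP => h3; apply: (N p').
  have lo (t L : R) : 0 <= L -> t <= t <= t + L by move=> L0; rewrite lexx ler_wpDr.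
  have hi (t L : R) : 0 <= L -> t <= t + L <= t + L by move=> L0; rewrite lexx andbT ler_wpDr.
  have := sm p (lo _ _ Xk0) (lo _ _ Yk0).
  have := sm (p.1 + Xk, p.2) (hi _ _ Xk0) (lo _ _ Yk0).
  have := sm (p.1, p.2 + Yk) (lo _ _ Xk0) (hi _ _ Yk0).
  have := sm (p.1 + Xk, p.2 + Yk) (hi _ _ Xk0) (hi _ _ Yk0).
  have := ler_normD (J k.+1 p + J k.+1 (p.1 + Xk, p.2))
     (J k.+1 (p.1, p.2 + Yk) + J k.+1 (p.1 + Xk, p.2 + Yk)).
  rewrite -Jsp.
  have := ler_normD (J k.+1 p) (J k.+1 (p.1 + Xk, p.2)).
  have := ler_normD (J k.+1 (p.1, p.2 + Yk)) (J k.+1 (p.1 + Xk, p.2 + Yk)).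
  clear; lra.
pose s := fix s k := if k is k'.+1 then xget (0, 0) (next k' (s k')) else (a, c).
have sP k : next k (s k) (s k.+1) by rewrite /=; apply: (@xgetPex _ _ (next k (s k))); exact: nextP.
have JE k : E / 4 ^+ k <= `|J k (s k)|.
  elim: k => [|k IH].
    by rewrite !expr0 divr1 /J /= !expr0 !divr1 /X /Y !(addrC _ (_ - _)) !subrK.
  have [_ _] := sP k; apply: le_trans.
  by rewrite exprSr invfM mulrA ler_pM2r.
have [x xP] := @nested_halves (fun k => (s k).1) X X0 (fun k => let: And3 h _ _ := sP k in h).
have [y yP] := @nested_halves (fun k => (s k).2) Y Y0 (fun k => let: And3 _ h _ := sP k in h).
pose e := E / 2 / (1 + (X + Y) ^+ 2).
have p0 : 0 < 1 + (X + Y) ^+ 2 by rewrite ltr_pwDl// sqr_ge0.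
have e0 : 0 < e by rewrite !divr_gt0.
have [dl dl0 loc] := circ_local x y cl e0.
have [k kP] := half_pow_small (X + Y) dl0.
have tk : 0 < 2 ^+ k :> R by rewrite exprn_gt0.
have Xk : 0 <= X / 2 ^+ k < dl.
  by rewrite divr_ge0 ?(ltW tk)//=; apply: le_lt_trans kP; rewrite ler_pM2r ?invr_gt0// lerDl.
have Yk : 0 <= Y / 2 ^+ k < dl.
  by rewrite divr_ge0 ?(ltW tk)//=; apply: le_lt_trans kP; rewrite ler_pM2r ?invr_gt0// lerDr.
have := loc (s k).1 (s k).2 _ _ Xk Yk (xP k) (yP k).
apply/negP; rewrite -ltNge; apply: lt_le_trans (JE k).
rewrite -mulrDl exprMn exprVn -exprM mulnC exprM (_ : 2 ^+ 2 = 4 :> R); last by ring.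
rewrite mulrA ltr_pM2r ?invr_gt0 ?exprn_gt0//.
rewrite /e mulrAC ltr_pdivrMr//.
have Et : 0 <= E * (X + Y) ^+ 2 by rewrite mulr_ge0 ?sqr_ge0 ?ltW.
by clear -E0 Et; lra.
Qed.

End green_goursat.

(** * Moduli and derivatives over the complex numbers *)

Section complex_basics.
Context (R : realType).
Local Notation C := (Cplx R).
Implicit Types (x y z h : C) (e d M : R).

Lemma cmod_ltE x e : (`|x| < e%:C%C) = (cmod x < e).
Proof. by rewrite cmodE ltcR. Qed.

Lemma cmod0 : cmod (0 : C) = 0.
Proof. by rewrite /cmod normr0. Qed.

Lemma cmod1 : cmod (1 : C) = 1.
Proof. by rewrite /cmod normr1. Qed.

Lemma cmodN x : cmod (- x) = cmod x.
Proof. by rewrite /cmod normrN. Qed.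

Lemma cmod_dist x y : cmod (x - y) = cmod (y - x).
Proof. by rewrite /cmod distrC. Qed.

Lemma cmod_eq0 x : (cmod x == 0) = (x == 0).
Proof.
by rewrite -[RHS]normr_eq0 cmodE; apply/eqP/eqP => [->//|/complexI].
Qed.

Lemma cmod_gt0 x : (0 < cmod x) = (x != 0).
Proof. by rewrite lt_neqAle cmod_ge0 andbT eq_sym cmod_eq0. Qed.

Lemma cmodV x : cmod x^-1 = (cmod x)^-1.
Proof. by apply: complexI; rewrite fmorphV /= -!cmodE normfV. Qed.

Lemma cmodX x n : cmod (x ^+ n) = cmod x ^+ n.
Proof.
by elim: n => [|n IH]; rewrite ?cmod1// !exprS cmodM IH.
Qed.

Lemma cmod_prod (I : finType) (F : I -> C) :
  cmod (\prod_i F i) = \prod_i cmod (F i).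
Proof.
apply: (big_ind2 (fun x e => cmod x = e)) => [|x1 e1 x2 e2 <- <-|//].
  exact: cmod1.
exact: cmodM.
Qed.

Lemma cmod_real e : cmod (e%:C%C : C) = `|e|.
Proof. by rewrite /cmod normc_def /= expr0n /= addr0 sqrtr_sqr. Qed.

Lemma cmod_nat n : cmod (n%:R : C) = n%:R.
Proof.
by rewrite -[n%:R : C](rmorph_nat (real_complex R)) /= cmod_real ger0_norm.
Qed.

Lemma cmodB_le x y : cmod (x - y) <= cmod x + cmod y.
Proof. by rewrite -(cmodN y) ler_cmodD. Qed.

Lemma cmod_sum (I : Type) (r : seq I) (P : pred I) (F : I -> C) :
  cmod (\sum_(i <- r | P i) F i) <= \sum_(i <- r | P i) cmod (F i).
Proof.
apply: (big_ind2 (fun x e => cmod x <= e)) => [|x1 e1 x2 e2 h1 h2|//].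
  by rewrite cmod0.
by apply: le_trans (ler_cmodD _ _) _; exact: lerD.
Qed.

Lemma cmod_triangle y x z : cmod (x - z) <= cmod (x - y) + cmod (y - z).
Proof. by apply: le_trans (ler_cmodD _ _); rewrite addrA subrK. Qed.

Lemma ReB x y : complex.Re (x - y) = complex.Re x - complex.Re y.
Proof. by case: x y => [a b] [c d]. Qed.

Lemma ImB x y : complex.Im (x - y) = complex.Im x - complex.Im y.
Proof. by case: x y => [a b] [c d]. Qed.

Lemma Re_le x : `|complex.Re x| <= cmod x.
Proof. by rewrite -lecR -cmodE; exact: normc_ge_Re. Qed.

Lemma Im_le x : `|complex.Im x| <= cmod x.
Proof.
rewrite /cmod normc_def/= -sqrtr_sqr ler_sqrt ?addr_ge0 ?sqr_ge0//.
by rewrite lerDr sqr_ge0.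
Qed.

Lemma cmod_le_ReIm x : cmod x <= `|complex.Re x| + `|complex.Im x|.
Proof.
rewrite /cmod normc_def/= -[leRHS]ger0_norm ?addr_ge0// -sqrtr_sqr.
rewrite ler_sqrt ?sqr_ge0// sqrrD !real_normK ?num_real//.
by rewrite addrAC lerDl mulrn_wge0// mulr_ge0.
Qed.

Lemma cplx_gt0 (e : C) : 0 < e -> exists2 r : R, 0 < r & e = r%:C%C.
Proof.
case: e => a b; rewrite ltcE/= => /andP[/eqP-> a0].
by exists a.
Qed.

Lemma cplx_cvgP (T : Type) (F : set_system T) (FF : Filter F) (f : T -> C) l :
  f @ F --> l <-> forall e, 0 < e -> \forall t \near F, cmod (l - f t) <= e.
Proof.
split=> [/cvgrPdist_le fl e e0|fl].
  have /fl : 0 < e%:C%C :> C by rewrite ltcR.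
  by apply: filterS => t; rewrite cmodE lecR.
apply/cvgrPdist_le => e /cplx_gt0[r r0 ->].
by apply: filterS (fl _ r0) => t; rewrite cmodE lecR.
Qed.

Lemma cplx_nbhs0 (P : set C) : nbhs (0 : C) P <->
  exists2 d, 0 < d & forall h, cmod h < d -> P h.
Proof.
split=> [/nbhs_ballP[e /= /cplx_gt0[r r0 ->] sP]|[d d0 sP]].
  exists r => // h hr; apply: sP; rewrite -ball_normE /= sub0r normrN.
  by rewrite cmod_ltE.
apply/nbhs_ballP; exists (d%:C%C); first by rewrite /= ltcR.
by move=> h; rewrite -ball_normE /= sub0r normrN cmod_ltE; exact: sP.
Qed.

Lemma scaleCE (a b : C) : a *: (b : C) = a * b.
Proof. by []. Qed.

Section directional.
Context (V : normedModType C).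
Implicit Types (f : V -> C) (a v : V) (l : C).

(** The derivative along [v] in terms of the real modulus; clearing the
    denominator of the difference quotient avoids excluding [h = 0]. *)
Definition has_deriv f a v l := forall e, 0 < e -> exists2 d, 0 < d &
  forall h, cmod h < d ->
    cmod (f (h *: v + a) - f a - h * l) <= e * cmod h.

Lemma has_derivP f a v l : has_deriv f a v l <-> is_derive a v f l.
Proof.
have key h : h != 0 -> forall e : R,
    (cmod (l - h^-1 *: (f (h *: v + a) - f a)) <= e) =
    (cmod (f (h *: v + a) - f a - h * l) <= e * cmod h).
  move=> h0 e; rewrite -ler_pdivrMr ?cmod_gt0// -cmodV -cmodM cmod_dist.
  by congr (cmod _ <= _); rewrite scaleCE; field.
split=> [fl|[df fl] e e0].
  have dl : h^-1 *: (f (h *: v + a) - f a) @[h --> 0^'] --> l.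
    apply/cplx_cvgP => e e0; apply/(cplx_nbhs0 [set h | h != 0 -> _]).
    have [d d0 hd] := fl _ e0; exists d => // h hd0 h0.
    by rewrite key//; exact: hd.
  by split; [apply/cvg_ex; exists l|exact: cvg_lim dl].
have /cplx_cvgP/(_ _ e0) : h^-1 *: (f (h *: v + a) - f a) @[h --> 0^'] --> l.
  by rewrite -fl; exact: df.
move=> /(cplx_nbhs0 [set h | h != 0 -> _])[d d0 hd]; exists d => // h hd0.
have [->|h0] := eqVneq h 0.
  by rewrite scale0r add0r subrr mul0r subrr cmod0 mulr0.
by rewrite -key//; exact: hd.
Qed.

End directional.

Definition cexp z : C :=
  Complex (expR (complex.Re z) * cos (complex.Im z))
          (expR (complex.Re z) * sin (complex.Im z)).

Lemma cexpD x y : cexp (x + y) = cexp x * cexp y.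
Proof.
case: x y => [a b] [c d]; rewrite /cexp /= expRD cosD sinD.
by apply/eqP; rewrite eq_complex /=; apply/andP; split; apply/eqP; ring.
Qed.

Lemma cexp0 : cexp 0 = 1.
Proof. by rewrite /cexp /= expR0 cos0 sin0 mul1r mulr0. Qed.

Lemma cexpNK z : cexp z * cexp (- z) = 1.
Proof. by rewrite -cexpD subrr cexp0. Qed.

Lemma cexp_neq0 z : cexp z != 0.
Proof.
by apply/eqP => z0; move: (cexpNK z); rewrite z0 mul0r => /esym/eqP; rewrite oner_eq0.
Qed.

Lemma cexpN z : cexp (- z) = (cexp z)^-1.
Proof. by rewrite -[RHS]mulr1 -(cexpNK z) mulKf// cexp_neq0. Qed.

Lemma cmod_cexp z : cmod (cexp z) = expR (complex.Re z).
Proof.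
rewrite /cmod normc_def/= !exprMn -mulrDr cos2Dsin2 mulr1 sqrtr_sqr.
by rewrite ger0_norm// expR_ge0.
Qed.

Lemma cexp_per z : cexp (z + Complex 0 (pi *+ 2)) = cexp z.
Proof.
rewrite cexpD [cexp (Complex _ _)]/cexp /= expR0 cos2pi mul1r sin2pi mulr0.
by rewrite [Complex _ _](_ : _ = 1) ?mulr1.
Qed.

Lemma real_derive0 (f : R -> R) l : is_derive (0 : R) (1 : R) f l ->
  forall e, 0 < e -> exists2 d, 0 < d & forall x : R, `|x| < d ->
    `|f x - f 0 - x * l| <= e * `|x|.
Proof.
move=> [df fl] e e0.
have /cvgrPdist_le/(_ _ e0) : h^-1 *: (f (h *: 1 + 0) - f 0) @[h --> 0^'] --> l.
  by rewrite -fl; exact: df.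
move=> /nbhs_ballP[d /= d0 hd]; exists d => // x xd.
have [->|x0] := eqVneq x 0.
  by rewrite subrr mul0r subrr normr0 mulr0.
have := hd x; rewrite -ball_normE /= sub0r normrN => /(_ xd x0).
rewrite addr0 [x *: 1]mulr1 => lx.
rewrite (_ : _ - _ = - (l - x^-1 * (f x - f 0)) * x); last by field.
by rewrite normrM normrN ler_pM2r ?normr_gt0.
Qed.

(** The real and imaginary parts of [exp z - 1 - z] are combinations of the
    first order remainders of the real [exp], [cos] and [sin] at [0]. *)
Lemma cexp_derive0 : has_deriv cexp 0 1 1.
Proof.
move=> e e0.
(* The remainders of [exp], [cos] and [sin] below add up to [9 e' |h|]. *)
have [e' [e'0 e'1 e'e]] : exists e', [/\ 0 < e', e' <= 1 & 9 * e' <= e].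
  exists (Num.min 1 (e / 9)); rewrite lt_min ltr01 divr_gt0// ge_min lexx.
  by split=> //; rewrite mulrC -ler_pdivlMr// ge_min lexx orbT.
have [d1 d10 h1] := real_derive0 (is_derive_expR 0) e'0.
have [d2 d20 h2] := real_derive0 (is_derive_cos 0) e'0.
have [d3 d30 h3] := real_derive0 (is_derive_sin 0) e'0.
pose d := Num.min (Num.min d1 d2) (Num.min d3 e').
exists d; first by rewrite !lt_min d10 d20 d30 e'0.
case=> x y hd.
have xm : `|x| <= cmod (Complex x y) := Re_le (Complex x y).
have ym : `|y| <= cmod (Complex x y) := Im_le (Complex x y).
have := le_lt_trans xm hd; rewrite !lt_min => /andP[/andP[x1 _] /andP[_ xe]].
have := le_lt_trans ym hd; rewrite !lt_min => /andP[/andP[_ y2] /andP[y3 ye]].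
move: (h1 x x1) (h2 y y2) (h3 y y3) => {h1 h2 h3}.
rewrite expR0 cos0 sin0 oppr0 mulr0 !addr0 !subr0 !mulr1 => h1 h2 h3.
have xn := normr_ge0 x; have yn := normr_ge0 y.
have E1 : `|expR x - 1| <= 2 * `|x|.
  rewrite (_ : _ - 1 = (expR x - 1 - x) + x); last by rewrite subrK.
  apply: le_trans (ler_normD _ _) _; rewrite mulr_natl mulr2n lerD2r.
  by apply: le_trans h1 _; rewrite ler_piMl.
have E3 : `|expR x| <= 3.
  rewrite -[expR x](subrK 1); apply: le_trans (ler_normD _ _) _; rewrite normr1.
  rewrite (_ : 3 = 2 + 1 :> R) ?lerD2r; last by ring.
  apply: le_trans E1 _.
  by rewrite ler_piMr//; apply: le_trans (ltW xe) e'1.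
apply: le_trans (cmod_le_ReIm _) _.
set m := cmod _ in xm ym *.
have m0 : 0 <= m by exact: cmod_ge0.
rewrite scaleCE !mulr1 cexp0 !ReB !ImB /= subr0.
have -> : expR x * cos y - 1 - x = (expR x - 1 - x) + expR x * (cos y - 1).
  by ring.
have -> : expR x * sin y - y = expR x * (sin y - y) + (expR x - 1) * y.
  by ring.
have A1 : `|expR x - 1 - x + expR x * (cos y - 1)| <= e' * m + 3 * (e' * m).
  apply: le_trans (ler_normD _ _) _; apply: lerD.
    by apply: le_trans h1 _; rewrite ler_pM2l.
  rewrite normrM; apply: ler_pM => //.
  by apply: le_trans h2 _; rewrite ler_pM2l.
have A2 : `|expR x * (sin y - y) + (expR x - 1) * y| <= 3 * (e' * m) + 2 * e' * m.
  apply: le_trans (ler_normD _ _) _; rewrite !normrM; apply: lerD.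
    apply: ler_pM => //.
    by apply: le_trans h3 _; rewrite ler_pM2l.
  apply: ler_pM => //; apply: le_trans E1 _.
  by rewrite ler_pM2l//; exact: ltW.
apply: le_trans (lerD A1 A2) _.
rewrite [leLHS](_ : _ = 9 * e' * m); last by ring.
by rewrite ler_wpM2r.
Qed.

Lemma cexp_derive z : is_derive z 1 cexp (cexp z).
Proof.
apply/has_derivP => e e0.
have ez : 0 < e / cmod (cexp z) by rewrite divr_gt0// cmod_gt0 cexp_neq0.
have [d d0 hd] := cexp_derive0 ez; exists d => // h /hd.
rewrite addr0 cexp0 scaleCE !mulr1 mulrAC ler_pdivlMr ?cmod_gt0 ?cexp_neq0//.
by rewrite -cmodM; congr (cmod _ <= _); rewrite cexpD; ring.
Qed.

End complex_basics.

(** * The Cauchy estimate in one variable *)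

Section cauchy_one_variable.
Context (R : realType).
Local Notation C := (Cplx R).

Lemma local_lipschitz_continuous (f : R -> R) x (K dl : R) : 0 < dl ->
  (forall x', `|x' - x| < dl -> `|f x' - f x| <= K * `|x' - x|) ->
  {for x, continuous f}.
Proof.
move=> dl0 fK; have K1 : 0 < `|K| + 1 by rewrite ltr_wpDl.
apply/cvgrPdist_le => e e0; have eK : 0 < e / (`|K| + 1) by rewrite divr_gt0.
apply/nbhs_ballP; exists (Num.min dl (e / (`|K| + 1))).
  by rewrite /= lt_min dl0.
move=> x'; rewrite /ball /= lt_min distrC => /andP[xd xe].
rewrite distrC; apply: le_trans (fK _ xd) _.
apply: (@le_trans _ _ ((`|K| + 1) * `|x' - x|)).
  by rewrite ler_wpM2r//; apply: le_trans (ler_norm K) _; rewrite lerDl.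
by rewrite mulrC -ler_pdivlMr// ltW.
Qed.

Lemma closed_form_continuous (P Q : R -> R -> R) : closed_form P Q ->
  (forall y, continuous (P ^~ y)) /\ (forall x, continuous (Q x)).
Proof.
move=> cl; split=> u v.
  have [A [B [D /(_ 1 ltr01)[dl dl0 h]]]] := cl v u.
  apply: (@local_lipschitz_continuous _ _ (1 + `|A|) _ dl0) => v' vd.
  have [+ _] := h v' u vd ltac:(by rewrite subrr normr0).
  rewrite subrr normr0 mulr0 subr0 addr0 mulrDl -normrM => h1.
  rewrite -[X in `|X|](subrK (A * (v' - v))).
  by apply: le_trans (ler_normD _ _) _; rewrite lerD2r.
have [A [B [D /(_ 1 ltr01)[dl dl0 h]]]] := cl u v.
apply: (@local_lipschitz_continuous _ _ (1 + `|D|) _ dl0) => v' vd.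
have [_ +] := h u v' ltac:(by rewrite subrr normr0) vd.
rewrite subrr normr0 mulr0 subr0 add0r mulrDl -normrM => h1.
rewrite -[X in `|X|](subrK (D * (v' - v))).
by apply: le_trans (ler_normD _ _) _; rewrite lerD2r.
Qed.

Lemma derivable_closed_form (g : C -> C) : (forall u, derivable g u 1) ->
  closed_form (fun x y => complex.Im (g (Complex x y)))
              (fun x y => complex.Re (g (Complex x y))).
Proof.
move=> dg x y; have /has_derivP := derivableP (dg (Complex x y)).
set l := 'D_1 g _ => gl.
exists (complex.Im l), (complex.Re l), (- complex.Im l) => e e0.
have [d d0 hd] := gl _ e0; exists (d / 2); first by rewrite divr_gt0.
move=> x' y' xd yd; pose h : C := Complex (x' - x) (y' - y).
have hle : cmod h <= `|x' - x| + `|y' - y| by exact: cmod_le_ReIm.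
have hlt : cmod h < d by rewrite (le_lt_trans hle)// (splitr d) ltrD.
have ghE : h *: 1 + Complex x y = Complex x' y' :> C.
  by rewrite scaleCE mulr1; apply/eqP; rewrite eq_complex /= !subrK !eqxx.
have := hd h hlt; rewrite ghE => gle.
have {}gle : cmod (g (Complex x' y') - g (Complex x y) - h * l) <=
  e * (`|x' - x| + `|y' - y|) by apply: le_trans gle _; rewrite ler_pM2l.
move: (le_trans (Re_le _) gle) (le_trans (Im_le _) gle).
rewrite !ReB !ImB; case: (l) => a b /= h1 h2; split.
  by move: h2; congr (`|_| <= _); ring.
by move: h1; congr (`|_| <= _); ring.
Qed.

(** The integral of an entire function with period [2 pi i] over a vertical
    period segment does not depend on its abscissa, as the two horizontal
    sides of the rectangle between two such segments cancel. *)
Lemma periodic_integral (g : C -> C) (x0 x1 : R) :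
  (forall u, derivable g u 1) ->
  (forall u, g (u + Complex 0 (pi *+ 2)) = g u) -> x0 <= x1 ->
  rint 0 (pi *+ 2) (fun y => complex.Re (g (Complex x0 y))) =
  rint 0 (pi *+ 2) (fun y => complex.Re (g (Complex x1 y))).
Proof.
move=> dg per x01; have cl := derivable_closed_form dg; have [cP cQ] := closed_form_continuous cl.
have pi20 : 0 <= pi *+ 2 :> R by rewrite mulrn_wge0// pi_ge0.
have := green_goursat cP cQ cl x01 pi20; rewrite /circ.
rewrite [X in rint x0 x1 X](_ : _ = cst 0); last first.
  apply/funext => x /=.
  apply/eqP; rewrite /cst subr_eq0; apply/eqP; congr complex.Im.
  rewrite -[LHS]per; congr g.
  by apply/eqP; rewrite eq_complex /= addr0 add0r !eqxx.
rewrite rint_cst// mul0r add0r rintB; [|exact: cQ..].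
by move/eqP; rewrite subr_eq0 => /eqP.
Qed.

(** In the coordinate [u = ln (z - w)] the function
    [g u = (f (w + exp u) - f w) exp (- u)] is entire with period [2 pi i]. The
    mean of [g] over a period is at most [2 M / s] on the line [Re u = ln s], and
    it tends to [f' w] as [Re u] tends to [- oo]; but it is constant. *)
Lemma cauchy_Re (f : C -> C) (w : C) (s M : R) : (forall u, derivable f u 1) ->
  0 < s -> (forall z, cmod (z - w) <= s -> cmod (f z) <= M) ->
  `|complex.Re ('D_1 f w)| <= 2 * M / s.
Proof.
move=> df s0 fM; set l := 'D_1 f w.
pose g (u : C) : C := (f (w + cexp u) - f w) * cexp (- u).
have dce u : differentiable (@cexp R) u.
  by apply/derivable1_diffP; case: (cexp_derive u).
have dg u : derivable g u 1.
  apply/derivable1_diffP; apply: differentiableM.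
    apply: differentiableB; last exact: differentiable_cst.
    apply: (@differentiable_comp _ _ _ _ (fun u => w + cexp u) f).
      by apply: differentiableD; [exact: differentiable_cst|exact: dce].
    by apply/derivable1_diffP; exact: df.
  apply: (@differentiable_comp _ _ _ _ (fun u => - u) (@cexp R)); last exact: dce.
  exact: differentiableN.
have per u : g (u + Complex 0 (pi *+ 2)) = g u.
  by rewrite /g !cexpN cexp_per.
pose I x := rint 0 (pi *+ 2) (fun y => complex.Re (g (Complex x y))).
have [_ cQ] := closed_form_continuous (derivable_closed_form dg).
have pi20 : 0 < pi *+ 2 :> R by rewrite mulrn_wgt0// pi_gt0.
have IM : `|I (ln s)| <= 2 * M / s * (pi *+ 2).
  have := @rint_near _ (fun y => complex.Re (g (Complex (ln s) y))) 0 (pi *+ 2) 0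
     (2 * M / s) (cQ _) (ltW pi20).
  rewrite mul0r !subr0; apply=> y _; rewrite subr0.
  apply: le_trans (Re_le _) _; rewrite cmodM cexpN cmodV cmod_cexp/= lnK ?posrE//.
  rewrite ler_pM2r ?invr_gt0// mulr_natl mulr2n.
  apply: le_trans (cmodB_le _ _) _; apply: lerD; apply: fM.
    by rewrite addrAC subrr add0r cmod_cexp/= lnK ?posrE.
  by rewrite subrr cmod0 ltW.
have Il e : 0 < e -> `|I (ln s) - complex.Re l * (pi *+ 2)| <= e * (pi *+ 2).
  move=> e0; have /has_derivP/(_ _ e0)[d d0 hd] := derivableP (df w).
  pose x := Num.min (ln s) (ln (d / 2)).
  have -> : I (ln s) = I x by apply/esym/periodic_integral; rewrite // ge_min lexx.
  have := @rint_near _ (fun y => complex.Re (g (Complex x y))) 0 (pi *+ 2)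
     (complex.Re l) e (cQ _) (ltW pi20).
  rewrite !subr0; apply=> y _; rewrite -ReB; apply: le_trans (Re_le _) _.
  set h := cexp (Complex x y); have h0 : h != 0 by exact: cexp_neq0.
  have hd' : cmod h < d.
    rewrite cmod_cexp/= (@le_lt_trans _ _ (d / 2))//; last by rewrite ltr_pdivrMr// ltr_pMr// ltr1n.
    by rewrite -[leRHS]lnK ?posrE ?divr_gt0// ler_expR ge_min lexx orbT.
  have := hd h hd'; rewrite scaleCE mulr1 -/l (addrC h w) -ler_pdivrMr ?cmod_gt0//.
  rewrite -cmodV -cmodM; congr (cmod _ <= _).
  by rewrite /g cexpN -/h; field.
have : `|complex.Re l| * (pi *+ 2) <= 2 * M / s * (pi *+ 2).
  apply/ler_addgt0Pr => e e0.
  have e0' : 0 < e / (pi *+ 2) by rewrite divr_gt0.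
  have := Il _ e0'; rewrite divfK ?gt_eqF// => Ie.
  rewrite -[X in _ * X](gtr0_norm pi20) -normrM.
  rewrite -[X in `|X|](subKr (I (ln s))).
  by apply: le_trans (ler_normB _ _) _; exact: lerD.
by rewrite ler_pM2r.
Qed.

(** Multiplying [f] by a unimodular constant makes its derivative at [w]
    real, so that the bound on real parts is enough. *)
Lemma cauchy1 (f : C -> C) (w : C) (s M : R) : (forall u, derivable f u 1) ->
  0 < s -> (forall z, cmod (z - w) <= s -> cmod (f z) <= M) ->
  cmod ('D_1 f w) <= 2 * M / s.
Proof.
move=> df s0 fM; set l := 'D_1 f w; have [l0|l0] := eqVneq l 0.
  rewrite l0 cmod0 divr_ge0 ?mulr_ge0 ?(ltW s0)//.
  by apply: le_trans (fM w _); rewrite ?cmod_ge0// subrr cmod0 ltW.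
have l0' : 0 < cmod l by rewrite cmod_gt0.
pose c : C := (cmod l)%:C%C / l.
have c1 : cmod c = 1 by rewrite cmodM cmodV cmod_real ger0_norm ?cmod_ge0// divff// gt_eqF.
have D : 'D_1 (c *: f) w = c *: l by exact: deriveZ (df w).
have dcf u : derivable (c *: f) u 1 by exact: derivableZ (df u).
have cfM z : cmod (z - w) <= s -> cmod ((c *: f) z) <= M.
  by move=> zs; rewrite [(c *: f) z]scaleCE cmodM c1 mul1r; exact: fM.
have := cauchy_Re dcf s0 cfM.
by rewrite D scaleCE /c divfK//= ger0_norm ?cmod_ge0.
Qed.

End cauchy_one_variable.

(** * Mean value inequality and second order Taylor bound *)

Section complex_mean_value.
Context (R : realType).
Local Notation C := (Cplx R).

Lemma cauchy_seq_cvg (u : nat -> R) :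
  (forall e, 0 < e -> exists N, forall j k, (N <= j)%N -> (N <= k)%N ->
     `|u j - u k| <= e) -> cvg (u @ \oo).
Proof.
move=> uC; apply/cauchy_cvgP/cauchy_ballP => e e0.
have e20 : 0 < e / 2 by rewrite divr_gt0.
have [N hN] := uC _ e20.
pose A := u @` [set k | (N <= k)%N].
exists (A, A); first by split; exists N => // k kN; exists k.
move=> [_ _] [[j jN <-] [k kN <-]]; rewrite /ball /=; apply: le_lt_trans (hN _ _ jN kN) _.
by rewrite ltr_pdivrMr// ltr_pMr// ltr1n.
Qed.

Lemma cplx_complete (u : nat -> C) :
  (forall e, 0 < e -> exists N, forall j k, (N <= j)%N -> (N <= k)%N ->
     cmod (u j - u k) <= e) -> exists l : C,
  forall e, 0 < e -> exists N, forall k, (N <= k)%N -> cmod (u k - l) <= e.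
Proof.
move=> uC.
have cR : cvg ((fun k => complex.Re (u k)) @ \oo).
  apply: cauchy_seq_cvg => e /uC[N hN]; exists N => j k jN kN.
  by rewrite -ReB; apply: le_trans (Re_le _) _; exact: hN.
have cI : cvg ((fun k => complex.Im (u k)) @ \oo).
  apply: cauchy_seq_cvg => e /uC[N hN]; exists N => j k jN kN.
  by rewrite -ImB; apply: le_trans (Im_le _) _; exact: hN.
exists (Complex (lim ((fun k => complex.Re (u k)) @ \oo))
                (lim ((fun k => complex.Im (u k)) @ \oo))) => e e0.
have e2 : 0 < e / 2 by rewrite divr_gt0.
have /cvgrPdist_le/(_ _ e2)[N1 _ h1] := cR.
have /cvgrPdist_le/(_ _ e2)[N2 _ h2] := cI.
exists (maxn N1 N2) => k; rewrite geq_max => /andP[k1 k2].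
apply: le_trans (cmod_le_ReIm _) _; rewrite ReB ImB (splitr e).
by apply: lerD; rewrite distrC; [exact: h1|exact: h2].
Qed.

Lemma Re_derive (phi : C -> C) (t : R) (c l : C) :
  is_derive (t%:C%C : C) (1 : C) phi l ->
  is_derive t (1 : R) (fun t : R => complex.Re (c * phi t%:C%C)) (complex.Re (c * l)).
Proof.
move=> /has_derivP pl.
suff dl : h^-1 *: (complex.Re (c * phi (h *: 1 + t)%:C%C) -
    complex.Re (c * phi t%:C%C)) @[h --> 0^'] --> complex.Re (c * l).
  by split; [apply/cvg_ex; exists (complex.Re (c * l))|exact: cvg_lim dl].
apply/cvgrPdist_le => e e0.
have c0 : 0 < cmod c + 1 by rewrite ltr_wpDl ?cmod_ge0.
have ec : 0 < e / (cmod c + 1) by rewrite divr_gt0.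
have [d d0 hd] := pl _ ec.
apply/nbhs_ballP; exists d => // h; rewrite /ball /= sub0r normrN => hlt h0.
have hC : cmod (h%:C%C : C) = `|h| by exact: cmod_real.
have := hd (h%:C%C); rewrite hC => /(_ hlt).
rewrite scaleCE mulr1 [h *: 1]mulr1 -rmorphD /= => hle.
rewrite -ReB -mulrBr.
have E : h * (complex.Re (c * l) - h^-1 * complex.Re
    (c * (phi (h + t)%:C%C - phi t%:C%C))) =
  - complex.Re (c * (phi (h + t)%:C%C - phi t%:C%C - h%:C%C * l)).
  case: (phi _) (phi _) (c) (l) => [a b] [a' b'] [c1 c2] [l1 l2] /=.
  by field.
rewrite -(ler_pM2l (x := `|h|)) ?normr_gt0// -normrM [_ *: _]/(_ * _) E normrN.
apply: le_trans (Re_le _) _; rewrite cmodM.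
apply: (@le_trans _ _ ((cmod c + 1) * (e / (cmod c + 1) * `|h|))).
  by apply: ler_pM => //; rewrite ?cmod_ge0// lerDl.
by rewrite mulrA mulrCA divff ?gt_eqF// mulr1 mulrC.
Qed.

(** Mean value inequality: the increment is rotated onto the positive reals,
    where the real mean value theorem applies. *)
Lemma mean_value_major (phi : C -> C) (b b' : R -> R) (T : R) :
  (forall x, derivable phi x 1) -> (forall t, is_derive t (1 : R) b (b' t)) ->
  0 <= T ->
  (forall t, 0 <= t <= T -> cmod ('D_1 phi (t%:C%C : C)) <= b' t) ->
  cmod (phi T%:C%C - phi 0) <= b T - b 0.
Proof.
move=> dphi db T0 le_b'; set D := phi _ - phi 0.
have [c c1 cD] : exists2 c : C, cmod c <= 1 & c * D = (cmod D)%:C%C.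
  have [->|D0] := eqVneq D 0; first by exists 0; rewrite ?mul0r cmod0.
  exists ((cmod D)%:C%C / D); last by rewrite divfK.
  by rewrite cmodM cmodV cmod_real ger0_norm ?cmod_ge0// divff// gt_eqF// cmod_gt0.
pose h t := complex.Re (c * phi t%:C%C) - b t.
have dh t : is_derive t (1 : R) h (complex.Re (c * 'D_1 phi (t%:C%C : C)) - b' t).
  by apply: is_deriveB; apply: Re_derive; exact: derivableP.
have hc : {within `[0, T], continuous h}.
  apply: continuous_subspaceT => t; apply: differentiable_continuous.
  by apply/derivable1_diffP; case: (dh t).
have := @ler0_derive1_nincr R h 0 T _ _ hc 0 T (lexx 0) T0 (lexx T).
have hE : h T <= h 0 -> cmod D <= b T - b 0.
  rewrite /h lerBlDr => hT; have : complex.Re (c * D) = cmod D by rewrite cD.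
  by rewrite mulrBr ReB => <-; rewrite lerBlDr (le_trans hT)// addrAC -addrA addrC.
move=> H; apply/hE/H => [t _|t]; first by case: (dh t).
rewrite in_itv /= => /andP[t0 tT]; rewrite derive1E derive_val subr_le0.
apply: le_trans (ler_norm _) _; apply: le_trans (Re_le _) _.
apply: le_trans (le_b' t _); last by rewrite !ltW.
by rewrite cmodM ler_piMl ?cmod_ge0.
Qed.

Lemma derive_shiftC (phi : C -> C) (a : C) : (forall x, derivable phi x 1) ->
  forall x : C, is_derive x (1 : C) (fun x => phi (x + a)) ('D_1 phi (x + a)).
Proof.
move=> dphi x; apply/has_derivP => e /(proj2 (has_derivP _ _ _ _) (derivableP (dphi (x + a)))).
by case=> d d0 hd; exists d => // h /hd; rewrite addrA.
Qed.

(** Second order Taylor bound: the Cauchy estimate applied to [phi] makes it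
    Lipschitz, and applied to [phi (_ + t) - phi _] it makes the derivative
    Lipschitz. *)
Lemma quadratic1 (phi : C -> C) (S M : R) : (forall x, derivable phi x 1) ->
  0 < S -> (forall x, cmod x <= 1 + 2 * S -> cmod (phi x) <= M) ->
  cmod (phi 1 - phi 0 - 'D_1 phi 0) <= 4 * M / S ^+ 2.
Proof.
move=> dphi S0 phiM.
have M0 : 0 <= M.
  by apply: le_trans (phiM 0 _); rewrite ?cmod_ge0// cmod0 addr_ge0// mulr_ge0// ltW.
have idE (K : R) t : is_derive t (1 : R) (fun t => K * t) K.
  by apply: is_derive_eq; rewrite [_ *: _]mulr1.
have lip x (t : R) : cmod x <= S -> 0 <= t <= 1 ->
    cmod (phi (t%:C%C + x) - phi x) <= 2 * M / S.
  move=> xS /andP[t0 t1].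
  have dsh := derive_shiftC x dphi.
  have := @mean_value_major (fun y => phi (y + x)) _ _ t _ (idE (2 * M / S)) t0.
  rewrite add0r mulr0 subr0 => H; apply: le_trans (H _ _) _.
  - by move=> y; case: (dsh y).
  - move=> t' /andP[t'0 t't]; have -> := @derive_val _ _ _ _ _ _ _ (dsh t'%:C%C).
    apply: cauchy1 => // z zS; apply: phiM.
    rewrite -[z](subrK (t'%:C%C + x)); apply: le_trans (ler_cmodD _ _) _.
    have : cmod (t'%:C%C + x) <= 1 + S.
      apply: le_trans (ler_cmodD _ _) _; apply: lerD => //.
      by rewrite cmod_real ger0_norm// (le_trans t't).
    by move=> h; apply: le_trans (lerD zS h) _; rewrite addrCA mulrDl mul1r.
  by rewrite ler_piMr// divr_ge0 ?mulr_ge0// ltW.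
have dlip (t : R) : 0 <= t <= 1 ->
    cmod ('D_1 phi (t%:C%C : C) - 'D_1 phi 0) <= 4 * M / S ^+ 2.
  move=> t01; have dsh := derive_shiftC (t%:C%C) dphi.
  have D0 : is_derive (0 : C) (1 : C) (fun x => phi (x + t%:C%C) - phi x)
     ('D_1 phi (t%:C%C : C) - 'D_1 phi 0).
    have D1 := dsh 0; rewrite [X in 'D_1 phi X](add0r (t%:C%C : C)) in D1.
    exact: (is_deriveB D1 (derivableP (dphi 0))).
  rewrite -(@derive_val _ _ _ _ _ _ _ D0).
  rewrite (_ : 4 * M / _ = 2 * (2 * M / S) / S); last by field; rewrite gt_eqF.
  apply: (cauchy1 _ S0) => [u|z]; last first.
    by rewrite subr0 => zS; rewrite (addrC z); exact: lip.
  have [D2 _] := dsh u; exact: derivableB D2 (dphi u).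
set D0 := 'D_1 phi 0 in dlip *.
have dlin (x : C) : is_derive x (1 : C) (fun x => x * D0) D0.
  apply/has_derivP => e e0; exists 1 => // h _.
  rewrite scaleCE mulr1 mulrDl addrK subrr cmod0.
  by rewrite mulr_ge0 ?cmod_ge0 ?(ltW e0).
have dPhi (x : C) : is_derive x (1 : C) (fun x => phi x - x * D0) ('D_1 phi x - D0).
  exact: is_deriveB (derivableP (dphi x)) (dlin x).
have dPhi' (x : C) : derivable (fun x => phi x - x * D0) x 1 by have [] := dPhi x.
have := mean_value_major dPhi' (idE (4 * M / S ^+ 2)) ler01.
rewrite mul1r mul0r subr0 mulr1 mulr0 subr0 addrAC; apply.
move=> t t01; have -> := @derive_val _ _ _ _ _ _ _ (dPhi (t%:C%C)).
exact: dlip.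
Qed.

End complex_mean_value.

(** * Entire functions of several variables and Weierstrass' theorem *)

Section several_variables.
Context (R : realType) (n : nat).
Local Notation C := (Cplx R).
Local Notation V := ('rV[C]_n).
Implicit Types (f g : V -> C) (z v x : V) (s M e : R) (i : 'I_n).

Definition polydisc z s : set V := [set x | forall i, cmod (x ord0 i - z ord0 i) <= s].

Definition locally_bounded f := forall z s, exists M, forall x,
  polydisc z s x -> cmod (f x) <= M.

(** Entire functions on [C^n] are bounded on polydiscs by compactness; carrying
    the bound along avoids topology, as it is explicit for the functions of
    interest. *)
Definition entireb f := entire f /\ locally_bounded f.

Lemma entireD f g : entire f -> entire g -> entire (f + g).
Proof. by move=> df dg z; apply: differentiableD. Qed.

Lemma entireB f g : entire f -> entire g -> entire (f - g).
Proof. by move=> df dg z; apply: differentiableB. Qed.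

Lemma entireM f g : entire f -> entire g -> entire (fun x => f x * g x).
Proof. by move=> df dg z; apply: differentiableM. Qed.

Lemma entire_cst (c : C) : entire (fun _ : V => c).
Proof. by move=> z; exact: differentiable_cst. Qed.

Lemma entire_coord i : entire (fun x : V => x ord0 i).
Proof. by move=> z; exact: differentiable_coord. Qed.

Lemma entire_shift f v : entire f -> entire (fun x => f (v + x)).
Proof.
move=> df z; apply: (@differentiable_comp _ _ _ _ (fun x => v + x) f).
  by apply: differentiableD; [exact: differentiable_cst|exact: ex_diff].
exact: df.
Qed.

Lemma entire_sum (I : Type) (r : seq I) (F : I -> V -> C) :
  (forall j, entire (F j)) -> entire (fun x => \sum_(j <- r) F j x).
Proof.
move=> dF; elim: r => [|j r IH].
  by under [X in entire X]eq_fun do rewrite big_nil; exact: entire_cst.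
by under [X in entire X]eq_fun do rewrite big_cons; exact: entireD.
Qed.

Lemma entire_derive f z v : entire f -> is_derive z v f ('D_v f z).
Proof. by move=> df; apply/derivableP/diff_derivable. Qed.

Lemma line_derive f z v (x : C) : entire f ->
  is_derive x (1 : C) (fun x : C => f (x *: v + z)) ('D_v f (x *: v + z)).
Proof.
move=> df; have /has_derivP fd := entire_derive (x *: v + z) v df.
apply/has_derivP => e /fd[d d0 hd]; exists d => // h /hd.
by rewrite scaleCE mulr1 scalerDl addrA.
Qed.

Lemma line_derivable f z v : entire f ->
  forall x : C, derivable (fun x : C => f (x *: v + z)) x 1.
Proof. by move=> df x; have [] := line_derive z v x df. Qed.

Lemma line_deriveE f z v : entire f ->
  'D_1 (fun x : C => f (x *: v + z)) 0 = 'D_v f z.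
Proof.
move=> df; have D := line_derive z v 0 df.
by rewrite (@derive_val _ _ _ _ _ _ _ D) scale0r add0r.
Qed.

Lemma cauchy_line f z v s M : entire f -> 0 < s ->
  (forall x : C, cmod x <= s -> cmod (f (x *: v + z)) <= M) ->
  cmod ('D_v f z) <= 2 * M / s.
Proof.
move=> df s0 fM; rewrite -line_deriveE//; apply: (cauchy1 _ s0).
  exact: line_derivable.
by move=> x; rewrite subr0; exact: fM.
Qed.

Lemma quadratic_line f z v s M : entire f -> 0 < s ->
  (forall x : C, cmod x <= 1 + 2 * s -> cmod (f (x *: v + z)) <= M) ->
  cmod (f (v + z) - f z - 'D_v f z) <= 4 * M / s ^+ 2.
Proof.
move=> df s0 fM; have := quadratic1 (@line_derivable f z v df) s0 fM.
by rewrite line_deriveE// scale1r scale0r add0r.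
Qed.

Local Notation ebase := (delta_mx (ord0 : 'I_1)).

Lemma derive_coord f z v : entire f ->
  'D_v f z = \sum_i v ord0 i * 'D_(ebase i) f z.
Proof.
move=> df; rewrite deriveE//.
rewrite {1}(row_sum_delta v) linear_sum; apply: eq_bigr => i _.
by rewrite linearZ /= deriveE.
Qed.

Lemma polydisc_line z i (x : C) s : cmod x <= s -> 0 <= s ->
  polydisc z s (x *: (ebase i) + z).
Proof.
move=> xs s0 j; rewrite !mxE addrK /=.
by case: (_ == _); rewrite ?mulr1 ?mulr0 ?cmod0.
Qed.

Lemma cauchy_partial f z i s M : entire f -> 0 < s ->
  (forall x, polydisc z s x -> cmod (f x) <= M) ->
  cmod ('D_(ebase i) f z) <= 2 * M / s.
Proof.
move=> df s0 fM; apply: cauchy_line => // x xs; apply: fM.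
by apply: polydisc_line => //; exact: ltW.
Qed.

Lemma mx_norm_coord (h : V) i : `|h ord0 i| <= `|h|.
Proof.
rewrite [leRHS]/Num.norm /= mx_normE -[leLHS]nngE num_le.
exact: (le_bigmax _ (fun j : 'I_1 * 'I_n => `|h j.1 j.2|%:nng) (ord0, i)).
Qed.

Lemma quadratic_differentiable f z (s K : R) : 0 < s -> 0 <= K ->
  (forall (h : V) m, 0 < m -> m <= s -> (forall i, cmod (h ord0 i) <= m) ->
     cmod (f (h + z)) <= K * m ^+ 2) ->
  f z = 0 -> differentiable f z.
Proof.
move=> s0 K0 fK fz; have K1 : 0 < K + 1 by rewrite ltr_wpDl.
have oE : f \o shift z = cst (f z) + (\0 : {linear V -> C}) +o_ (0 : V) id.
  apply/eqaddoP => e /cplx_gt0[r r0 ->].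
  pose d := Num.min s (r / (K + 1)).
  have d0 : 0 < d by rewrite lt_min s0 divr_gt0.
  apply/nbhs_ballP; exists (d%:C%C); first by rewrite /= ltcR.
  move=> h; rewrite -ball_normE /= sub0r normrN => hd.
  have [->|h0] := eqVneq h 0.
    by rewrite /= !fctE /= add0r fz !addr0 subrr !normr0 mulr0.
  have /cplx_gt0[m m0 mE] : 0 < `|h| by rewrite normr_gt0.
  rewrite mE ltcR lt_min in hd; case/andP: hd => ms mr.
  rewrite mE /= !fctE /= fz !addr0 subr0 cmodE -rmorphM lecR.
  apply: le_trans (fK h m m0 (ltW ms) _) _.
    by move=> i; have := mx_norm_coord h i; rewrite mE cmodE lecR.
  rewrite expr2 mulrA ler_pM2r//.
  apply: le_trans (_ : (K + 1) * m <= _); first by rewrite ler_pM2r// lerDl.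
  by rewrite mulrC -ler_pdivlMr// ltW.
have D0 : 'd f z = (\0 : {linear V -> C}) :> (V -> C).
  by apply: diff_unique => //; exact: cst_continuous.
apply/diff_locallyP; split; last by rewrite D0.
by rewrite D0; exact: cst_continuous.
Qed.

Definition locally_uniform (F : nat -> V -> C) f := forall z s e, 0 < e ->
  exists N, forall k, (N <= k)%N -> forall x, polydisc z s x ->
  cmod (F k x - f x) <= e.

Lemma polydisc_center z s : 0 <= s -> polydisc z s z.
Proof. by move=> s0 i; rewrite subrr cmod0. Qed.

(** The derivatives of the approximants converge by the Cauchy estimate, and
    the second order Taylor bound is uniform along the sequence, so that it
    passes to the limit. *)
Theorem weierstrass (F : nat -> V -> C) g :
  (forall k, entireb (F k)) -> locally_uniform F g -> entireb g.
Proof.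
move=> eF Fg.
have lbg : locally_bounded g.
  move=> z s; have [N hN] := Fg z s 1 ltr01; have [_ /(_ z s)[M hM]] := eF N.
  exists (M + 1) => x xs; rewrite -[g x](subKr (F N x)).
  by apply: le_trans (cmodB_le _ _) _; apply: lerD; [exact: hM|exact: hN].
split=> // z.
pose u i k := 'D_(ebase i) (F k) z.
have ul i : exists l : C, forall e, 0 < e -> exists N, forall k, (N <= k)%N ->
    cmod (u i k - l) <= e.
  apply: cplx_complete => e e0; have e4 : 0 < e / 4 by rewrite divr_gt0.
  have [N hN] := Fg z 1 _ e4; exists N => j k jN kN.
  have eD : entire (F j - F k) by apply: entireB; [case: (eF j)|case: (eF k)].
  have -> : u i j - u i k = 'D_(ebase i) (F j - F k) z.
    have [[dj _] [dk _]] := (eF j, eF k).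
    have D := is_deriveB (entire_derive z (ebase i) dj) (entire_derive z (ebase i) dk).
    by rewrite (@derive_val _ _ _ _ _ _ _ D).
  have -> : e = 2 * (e / 2) / 1 by field.
  apply: cauchy_partial => // x xz.
  have -> : (F j - F k) x = (F j x - g x) - (F k x - g x).
    by rewrite opprB addrA subrK.
  apply: le_trans (cmodB_le _ _) _.
  rewrite [e / 2](_ : _ = e / 4 + e / 4); last by field.
  by apply: lerD; exact: hN.
pose l i := projT1 (cid (ul i)).
have lP i e : 0 < e -> exists N, forall k, (N <= k)%N -> cmod (u i k - l i) <= e.
  exact: (projT2 (cid (ul i))).
have [M gM] := lbg z 1.
have M0 : 0 <= M by apply: le_trans (gM z _); rewrite ?cmod_ge0//; exact: polydisc_center.
pose A (h : V) := \sum_i h ord0 i * l i.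
have quad (h : V) m : 0 < m -> m <= 2^-1 -> (forall i, cmod (h ord0 i) <= m) ->
    cmod (g (h + z) - g z - A h) <= 64 * (M + 1) * m ^+ 2.
  move=> m0 m2 hm; apply/ler_addgt0Pr => e e0.
  pose e' := Num.min 1 (e / (n%:R + 2)).
  have n2 : 0 < n%:R + 2 :> R by rewrite ltr_wpDl.
  have e'0 : 0 < e' by rewrite lt_min ltr01 divr_gt0.
  have [N hN] := Fg z 1 _ e'0.
  pose N' i := projT1 (cid (lP i _ e'0)).
  pose k := maxn N (\max_i N' i).
  have Fk : forall x, polydisc z 1 x -> cmod (F k x - g x) <= e'.
    by apply: hN; rewrite leq_maxl.
  have uk i : cmod (u i k - l i) <= e'.
    apply: (projT2 (cid (lP i _ e'0))).
    by apply: leq_trans (leq_maxr _ _); exact: (leq_bigmax i).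
  have [dk _] := eF k.
  have m1 : m <= 1 by apply: le_trans m2 _; rewrite invf_le1// ler1n.
  have hz1 : polydisc z 1 (h + z).
    by move=> i; rewrite !mxE addrK; apply: le_trans (hm i) _.
  have zz1 : polydisc z 1 z by exact: polydisc_center.
  have Q : cmod (F k (h + z) - F k z - 'D_h (F k) z) <= 64 * (M + 1) * m ^+ 2.
    (* The radius [s = 1 / (4 m)] is such that [(1 + 2 s) m = m + 1 / 2 <= 1]. *)
    rewrite (_ : 64 * _ * _ = 4 * (M + 1) / (4 * m)^-1 ^+ 2); last first.
      by field; rewrite gt_eqF.
    apply: quadratic_line => //; first by rewrite invr_gt0 mulr_gt0.
    move=> x xm; have px : polydisc z 1 (x *: h + z).
      move=> i; rewrite !mxE addrK cmodM.
      apply: (@le_trans _ _ ((1 + 2 * (4 * m)^-1) * m)).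
        by apply: ler_pM => //; rewrite cmod_ge0.
      rewrite [leLHS](_ : _ = m + 2^-1); last by field; rewrite gt_eqF.
      by rewrite [leRHS](splitr 1) mul1r lerD2r.
    rewrite -[F k _](subrK (g (x *: h + z))).
    apply: le_trans (ler_cmodD _ _) _; rewrite addrC; apply: lerD; first exact: gM.
    by apply: le_trans (Fk _ px) _; rewrite ge_min lexx.
  have E : g (h + z) - g z - A h = (F k (h + z) - F k z - 'D_h (F k) z)
     + ((F k z - g z) - (F k (h + z) - g (h + z)) + \sum_i h ord0 i * (u i k - l i)).
    have -> : \sum_i h ord0 i * (u i k - l i) = 'D_h (F k) z - A h.
      by rewrite derive_coord// -sumrB; apply: eq_bigr => i _; rewrite mulrBr.
    ring.
  rewrite E; apply: le_trans (ler_cmodD _ _) _; apply: lerD => //.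
  apply: le_trans (ler_cmodD _ _) _.
  apply: (@le_trans _ _ ((e' + e') + n%:R * e')).
    apply: lerD.
      by apply: le_trans (cmodB_le _ _) _; apply: lerD; exact: Fk.
    apply: le_trans (cmod_sum _ _ _) _.
    apply: le_trans (_ : \sum_(i < n) e' <= _); last first.
      by rewrite sumr_const card_ord mulr_natl.
    apply: ler_sum => i _; rewrite cmodM -[leRHS]mul1r.
    by apply: ler_pM; rewrite ?cmod_ge0//; apply: le_trans (hm i) _.
  rewrite [leLHS](_ : _ = e' * (n%:R + 2)); last by ring.
  rewrite -ler_pdivlMr//.
  by rewrite ge_min lexx orbT.
have eA : entire A.
  apply: entire_sum => i.
  by apply: entireM; [exact: entire_coord|exact: entire_cst].
pose r x := g x - g z - A (x - z).
have -> : g = (fun x => r x + (g z + A (- z + x))).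
  by apply/funext => x; rewrite /r (addrC (- z)); ring.
have eAz : entire (fun x => g z + A (- z + x)).
  by apply: entireD; [exact: entire_cst|exact: entire_shift].
apply: differentiableD; last exact: eAz.
have h2 : 0 < 2^-1 :> R by [].
apply: (@quadratic_differentiable r z 2^-1 (64 * (M + 1))) => //.
- by rewrite mulr_ge0// addr_ge0.
- by move=> h m m0 m2 hm; rewrite /r addrK; exact: quad.
- rewrite /r !subrr /A big1 ?subr0// => i _; by rewrite mxE mul0r.
Qed.

End several_variables.

Notation ebase := (delta_mx (ord0 : 'I_1)).
(** * Iterated derivatives and their Cauchy estimates *)

Section partial_derivatives.
Context (R : realType) (n : nat).
Local Notation C := (Cplx R).
Local Notation V := ('rV[C]_n).
Implicit Types (f g : V -> C) (z v x : V) (s M e : R) (i j : 'I_n).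

Definition partial i f : V -> C := 'D_(ebase i) f.

Lemma mi_deriveE (al : multi_index n) f :
  mi_derive al f = foldr (fun i => iter (al i) (partial i)) f (enum 'I_n).
Proof. by []. Qed.

Lemma polydisc_trans z x y s r : polydisc z s x -> polydisc x r y ->
  polydisc z (s + r) y.
Proof.
move=> zx xy i; rewrite (addrC s); apply: le_trans (lerD (xy i) (zx i)).
exact: cmod_triangle.
Qed.

Lemma locally_uniform_derive (F : nat -> V -> C) g i :
  (forall k, entireb (F k)) -> entireb g -> locally_uniform F g ->
  locally_uniform (fun k => partial i (F k)) (partial i g).
Proof.
move=> eF [eg _] Fg z s e e0; have e2 : 0 < e / 2 by rewrite divr_gt0.
have [N hN] := Fg z (s + 1) _ e2; exists N => k kN x xs.
have [ek _] := eF k.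
rewrite /partial.
have <- : 'D_(ebase i) (F k - g) x = 'D_(ebase i) (F k) x - 'D_(ebase i) g x.
  have := is_deriveB (entire_derive x (ebase i) ek) (entire_derive x (ebase i) eg).
  by move=> /(@derive_val _ _ _ _ _ _ _)->.
have -> : e = 2 * (e / 2) / 1 by field.
apply: (cauchy_partial i (entireB ek eg) ltr01) => y xy.
by apply: (hN k kN y); exact: polydisc_trans xs xy.
Qed.

Lemma shift_derive f v z w : entire f ->
  is_derive z w (fun x => f (v + x)) ('D_w f (v + z)).
Proof.
move=> df; have /has_derivP fd := entire_derive (v + z) w df.
by apply/has_derivP => e /fd[d d0 hd]; exists d => // h /hd; rewrite addrCA.
Qed.

Definition diff_quot f i (k : nat) x : C :=
  k.+1%:R * (f (k.+1%:R^-1 *: ebase i + x) - f x).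

Lemma entireb_diff_quot f i k : entireb f -> entireb (diff_quot f i k).
Proof.
move=> [ef bf]; split.
  apply: entireM; first exact: entire_cst.
  by apply: entireB => //; exact: entire_shift.
move=> z s; have [M hM] := bf z (`|s| + 1); exists (k.+1%:R * (M + M)).
move=> x xs; rewrite /diff_quot cmodM cmod_nat ler_pM2l ?ltr0n//.
apply: le_trans (cmodB_le _ _) _; have ss : s <= `|s| by exact: ler_norm.
apply: lerD; apply: hM; last first.
  by move=> i'; apply: le_trans (xs i') _; apply: le_trans ss _; rewrite lerDl.
apply: (@polydisc_trans _ x).
  by move=> i'; apply: le_trans (xs i') _.
apply: polydisc_line => //; rewrite cmodV cmod_nat invf_le1 ?ltr0n//.
by rewrite ler1n.
Qed.

(** The second order Taylor bound gives the rate [64 M t] for the step [t] and a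
    bound [M] of [f] on a unit neighborhood. *)
Lemma diff_quot_cvg f i : entireb f -> locally_uniform (diff_quot f i) (partial i f).
Proof.
move=> [ef bf] z s e e0; have [M hM] := bf z (s + 1).
have [M' M'0 fM'] : exists2 M', 0 < M' & forall x, polydisc z (s + 1) x -> cmod (f x) <= M'.
  exists (`|M| + 1) => [|x /hM xM]; first by rewrite ltr_wpDl.
  by apply: le_trans xM _; apply: le_trans (ler_norm _) _; rewrite lerDl.
exists (maxn 1 (Num.truncn (64 * M' / e))) => k; rewrite geq_max => /andP[k1 ke] x xs.
pose t : R := k.+1%:R^-1.
have k0 : 0 < k.+1%:R :> R by rewrite ltr0n.
have t0 : 0 < t by rewrite invr_gt0.
have t2 : t <= 2^-1 by rewrite lef_pV2 ?posrE// ler_nat ltnS.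
have tC : (k.+1%:R^-1 : C) = t%:C%C by rewrite fmorphV /= rmorph_nat.
have := @quadratic_line _ _ f x (t%:C%C *: ebase i) (4 * t)^-1 M' ef.
rewrite invr_gt0 mulr_gt0// => /(_ isT) Q.
have {Q} : cmod (f (t%:C%C *: ebase i + x) - f x - t%:C%C * partial i f x) <=
    4 * M' / (4 * t)^-1 ^+ 2.
  have -> : t%:C%C * partial i f x = 'D_(t%:C%C *: ebase i) f x.
    by rewrite /partial !deriveE// linearZ.
  apply: Q => y yb; rewrite scalerA; apply: fM'; apply: (polydisc_trans xs).
  apply: polydisc_line => //; rewrite cmodM cmod_real (gtr0_norm t0).
  apply: (@le_trans _ _ ((1 + 2 * (4 * t)^-1) * t)); first by rewrite ler_pM2r.
  rewrite [leLHS](_ : _ = t + 2^-1); last by field; rewrite gt_eqF.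
  by rewrite [leRHS](splitr 1) mul1r lerD2r.
rewrite [leRHS](_ : _ = t * (64 * M' * t)); last by field; rewrite gt_eqF.
move=> Q; rewrite -(ler_pM2l t0).
apply: (le_trans _ (le_trans Q _)); last first.
  rewrite ler_pM2l// /t ler_pdivrMr// [leRHS]mulrC -ler_pdivrMr//.
  have kb : (Num.truncn (64 * M' / e)).+1%:R <= k.+1%:R :> R by rewrite ler_nat ltnS.
  exact: ltW (lt_le_trans (truncnS_gt _) kb).
rewrite -[t in t * _](gtr0_norm t0) -cmod_real -cmodM /diff_quot -tC.
by rewrite mulrBr mulrA mulVf ?mul1r// pnatr_eq0.
Qed.

(** Partial derivatives are locally uniform limits of difference quotients,
    which are entire, so that Weierstrass' theorem applies. *)
Lemma entireb_partial f i : entireb f -> entireb (partial i f).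
Proof.
move=> ef; apply: weierstrass (diff_quot_cvg i ef) => k.
exact: entireb_diff_quot.
Qed.

Lemma locally_uniform_unique (F : nat -> V -> C) f g :
  locally_uniform F f -> locally_uniform F g -> f = g.
Proof.
move=> Ff Fg; apply/funext => x; apply/eqP; rewrite -subr_eq0 -cmod_eq0.
rewrite eq_le cmod_ge0 andbT; apply/ler_addgt0Pr => e e0; rewrite add0r.
have e2 : 0 < e / 2 by rewrite divr_gt0.
have [N1 h1] := Ff x 0 _ e2; have [N2 h2] := Fg x 0 _ e2.
apply: le_trans (cmod_triangle (F (maxn N1 N2) x) _ _) _.
rewrite [leRHS](splitr e); apply: lerD.
  by rewrite cmod_dist; apply: h1; rewrite ?leq_maxl//; exact: polydisc_center.
by apply: h2; rewrite ?leq_maxr//; exact: polydisc_center.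
Qed.

(** Both sides are the limit of the [j]-derivatives of the difference quotients
    of [f] along the axis [i]. *)
Lemma partialC f i j : entireb f -> partial i (partial j f) = partial j (partial i f).
Proof.
move=> ef; have [df _] := ef.
have qE : diff_quot (partial j f) i = (fun k => partial j (diff_quot f i k)).
  apply/funext => k; apply/funext => x.
  have D := is_deriveB (shift_derive (k.+1%:R^-1 *: ebase i) x (ebase j) df)
                       (entire_derive x (ebase j) df).
  have D' := is_deriveZ (k.+1%:R) D.
  exact: esym (@derive_val _ _ _ _ _ _ _ D').
have L1 := diff_quot_cvg i (entireb_partial j ef).
have L2 : locally_uniform (fun k => partial j (diff_quot f i k)) (partial j (partial i f)).
  apply: locally_uniform_derive (diff_quot_cvg i ef) => [k|].
    exact: entireb_diff_quot.
  exact: entireb_partial.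
rewrite -qE in L2; exact: (locally_uniform_unique L1 L2).
Qed.

Lemma entireb_iter f i k : entireb f -> entireb (iter k (partial i) f).
Proof. by move=> ef; elim: k => //= k IH; exact: entireb_partial. Qed.

Local Notation foldd al f r :=
  (foldr (fun i => iter (al i) (partial i)) f r).

Lemma entireb_foldd (al : 'I_n -> nat) f r : entireb f -> entireb (foldd al f r).
Proof. by move=> ef; elim: r => //= i r IH; exact: entireb_iter. Qed.

Lemma entireb_mi (al : multi_index n) f : entireb f -> entireb (mi_derive al f).
Proof. by rewrite mi_deriveE; exact: entireb_foldd. Qed.

(** Spreading the [k] derivations over [k] concentric discs of radii [j s / k]. *)
Lemma cauchy_iter f i k z s M : entireb f -> 0 < s ->
  (forall x : C, cmod x <= s -> cmod (f (x *: ebase i + z)) <= M) ->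
  cmod (iter k (partial i) f z) <= (2 * k%:R / s) ^+ k * M.
Proof.
move=> ef s0 fM; case: k => [|k].
  by have := fM 0; rewrite expr0 mul1r scale0r add0r cmod0 ltW//; apply.
set k1 := k.+1; have k0 : 0 < k1%:R :> R by rewrite ltr0n.
pose d := s / k1%:R; have d0 : 0 < d by rewrite divr_gt0.
have dE : 2 * k1%:R / s = 2 / d by rewrite /d invf_div mulrA.
have M0 : 0 <= M by apply: le_trans (fM 0 _); rewrite ?cmod_ge0// cmod0 ltW.
suff H l (x : C) : cmod x <= s - l%:R * d ->
    cmod (iter l (partial i) f (x *: ebase i + z)) <= (2 / d) ^+ l * M.
  have := H k1 0; rewrite dE scale0r add0r; apply.
  by rewrite cmod0 /d mulrC divfK ?gt_eqF// subrr.
elim: l x => [|l IH] x xs.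
  by rewrite expr0 mul1r; apply: fM; move: xs; rewrite mul0r subr0.
rewrite exprS -mulrA mulrAC; apply: cauchy_line => //.
  by have [] := entireb_iter i l ef.
move=> y yd; rewrite addrA -scalerDl; apply: IH.
apply: le_trans (ler_cmodD _ _) _; apply: le_trans (lerD yd xs) _.
by rewrite [leLHS](_ : _ = s - l%:R * d)// -natr1; ring.
Qed.

(** Turns the [k ^ k] coming from [k] concentric discs into a factorial, at the
    price of a geometric factor. *)
Lemma expnn_le k : k%:R ^+ k <= expR 1 ^+ k * k`!%:R :> R.
Proof.
elim: k => [|k IH]; first by rewrite !expr0 fact0 mulr1.
rewrite exprSr factS natrM mulrCA mulrC; apply: ler_wpM2l => //.
have [->|k0] := posnP k.
  rewrite expr0 fact0 mulr1 expr1; apply: le_trans (expR_ge1Dx 1).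
  by rewrite lerDl.
have k0' : 0 < k%:R :> R by rewrite ltr0n.
have -> : k.+1%:R ^+ k = (1 + k%:R^-1) ^+ k * k%:R ^+ k :> R.
  by rewrite -exprMn mulrDl mul1r mulVf ?gt_eqF// natr1.
rewrite exprS -mulrA; apply: ler_pM IH; rewrite ?exprn_ge0// ?addr_ge0 ?invr_ge0//.
apply: (@le_trans _ _ (expR (k%:R^-1) ^+ k)).
  by rewrite lerXn2r ?nnegrE ?addr_ge0 ?expR_ge0// expR_ge1Dx.
by rewrite -expRM_natl mulfV ?gt_eqF.
Qed.

(** The derivations along one axis move the point along this axis only, so that
    the one-variable estimates multiply without shrinking the polydisc. *)
Lemma cauchy_mi f (al : multi_index n) z s M : entireb f -> 0 < s ->
  (forall x, polydisc z s x -> cmod (f x) <= M) ->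
  cmod (mi_derive al f z) <= (mi_fact al)%:R * (2 * expR 1 / s) ^+ mi_abs al * M.
Proof.
move=> ef s0 fM.
have M0 : 0 <= M.
  by apply: le_trans (fM z _); [exact: cmod_ge0|apply: polydisc_center; exact: ltW].
suff H (r : seq 'I_n) x : uniq r -> (forall i, i \in r -> x ord0 i = z ord0 i) ->
    polydisc z s x -> cmod (foldd al f r x) <=
    (\prod_(i <- r) ((2 * (al i)%:R / s) ^+ al i)) * M.
  apply: le_trans (H _ z (enum_uniq _) _ _) _ => //.
    by apply: polydisc_center; exact: ltW.
  rewrite ler_wpM2r// big_enum /= /mi_fact natr_prod /mi_abs.
  rewrite -prodrXr -big_split /=; apply: ler_prod => i _.
  rewrite exprn_ge0 ?divr_ge0 ?mulr_ge0 ?(ltW s0)//=.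
  rewrite !(mulrAC _ _ s^-1) !exprMn [leRHS]mulrCA.
  rewrite ler_wpM2l ?mulr_ge0 ?exprn_ge0 ?invr_ge0 ?(ltW s0)//.
  by rewrite [leRHS]mulrC; exact: expnn_le.
elim: r x => [x _ _ xs|i r IH x /= /andP[ir ur] xz xs].
  by rewrite big_nil mul1r; exact: fM.
rewrite big_cons -mulrA; apply: cauchy_iter => //; first exact: entireb_foldd.
move=> y ys; apply: IH => // j; rewrite !mxE/=.
  move=> jr; have -> : (j == i) = false by apply: contraNF ir => /eqP <-.
  by rewrite mulr0 add0r xz// inE jr orbT.
case: eqP => [->|_]; last by rewrite mulr0 add0r; exact: xs.
by rewrite mulr1 xz ?mem_head// addrK.
Qed.

Definition mi_inc (al : multi_index n) i k : multi_index n :=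
  [ffun j => if j == i then (al j + k)%N else al j].

Lemma eq_foldd (al be : 'I_n -> nat) f r : {in r, al =1 be} ->
  foldd al f r = foldd be f r.
Proof.
elim: r => //= i r IH ab; rewrite IH => [|j jr]; last by apply: ab; rewrite inE jr orbT.
by rewrite ab ?mem_head.
Qed.

Lemma partial_iterC f i j k : entireb f ->
  partial i (iter k (partial j) f) =
  iter k (partial j) (partial i f).
Proof.
move=> ef; elim: k => [//|k IH].
have E := partialC i j (entireb_iter j k ef).
rewrite /= E.
exact: (congr1 (partial j) IH).
Qed.

(** [mi_derive] applies the axes in a fixed order; commutation moves the extra
    derivation to its place. *)
Lemma partial_mi (al : multi_index n) f i : entireb f ->
  partial i (mi_derive al f) = mi_derive (mi_inc al i 1) f.
Proof.
move=> ef; rewrite !mi_deriveE.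
have : i \in enum 'I_n by rewrite mem_enum.
elim: (enum 'I_n) (enum_uniq 'I_n) => //= j r IH /andP[jr ur].
rewrite inE => /orP[/eqP ij|ir]; last first.
  have ji : (j == i) = false by apply: contraNF jr => /eqP->.
  rewrite partial_iterC ?IH//; last exact: entireb_foldd.
  by rewrite {2}/mi_inc ffunE ji.
rewrite -{1}ij in jr *; rewrite {2}/mi_inc ffunE ij eqxx addn1 /=.
congr (partial _ (iter _ _ _)); apply: eq_foldd => k kr.
by rewrite ffunE; case: eqP kr => // ->; rewrite -ij (negPf jr).
Qed.

Lemma iter_partial_mi (al : multi_index n) f i k : entireb f ->
  iter k (partial i) (mi_derive al f) = mi_derive (mi_inc al i k) f.
Proof.
move=> ef; elim: k => [|k IH] /=.
  by congr mi_derive; apply/ffunP => j; rewrite ffunE addn0 if_same.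
rewrite IH partial_mi//; congr mi_derive; apply/ffunP => j; rewrite !ffunE.
by case: eqP => //; rewrite addn1 addnS.
Qed.

End partial_derivatives.

Lemma pow_derive (K : numFieldType) (y : K) k :
  is_derive y (1 : K) (fun y : K => y ^+ k) (k%:R * y ^+ k.-1).
Proof.
have := derivableP (@exprn_derivable K k y 1).
by rewrite exp_derive scaler1 [_ *: _]/(_ * _).
Qed.

(** * The identity theorem *)

Section identity_theorem.
Context (R : realType) (n : nat).
Local Notation C := (Cplx R).
Local Notation V := ('rV[C]_n).
Implicit Types (f g : V -> C) (z v x : V) (s M e : R) (i j : 'I_n).

(** Taylor's remainder on a segment: since all derivatives vanish at [z], a bound
    on the one of order [k] is integrated [l] times by the mean value
    inequality. *)
Lemma iter_segment_bound g i z (t : C) k (B : R) : entireb g ->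
  (forall l, iter l (partial i) g z = 0) ->
  (forall y : R, 0 <= y <= 1 ->
     cmod (iter k (partial i) g ((y%:C%C * t) *: ebase i + z)) <= B) ->
  forall l, (l <= k)%N -> forall y : R, 0 <= y <= 1 ->
  cmod (iter (k - l) (partial i) g ((y%:C%C * t) *: ebase i + z)) <=
    B * cmod t ^+ l * (y ^+ l / l`!%:R).
Proof.
move=> eg g0 gB; elim=> [_ y y01|l IH lk y y01].
  by rewrite subn0 !expr0 fact0 divr1 !mulr1; exact: gB.
set m := (k - l.+1)%N; have kl : (k - l = m.+1)%N by rewrite /m -subSn ?subSS.
have [eh _] := entireb_iter i m eg; set h := iter m _ g in eh *.
pose b (y : R) := (B * cmod t ^+ l.+1 / l.+1`!%:R) * y ^+ l.+1.
pose b' (y : R) := B * cmod t ^+ l.+1 * (y ^+ l / l`!%:R).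
have db (y' : R) : is_derive y' (1 : R) b (b' y').
  have D := is_deriveZ (B * cmod t ^+ l.+1 / l.+1`!%:R) (pow_derive y' l.+1).
  rewrite [b' y'](_ : _ = (B * cmod t ^+ l.+1 / l.+1`!%:R) *: (l.+1%:R * y' ^+ l)).
    exact: D.
  have E (X Y p q : R) : p != 0 -> q != 0 ->
      X * (Y / q) = X / (p * q) * (p * Y) by move=> p0 q0; field; rewrite p0 q0.
  rewrite /b' [RHS]/(_ * _) factS natrM; apply: E; rewrite ?pnatr_eq0//.
  by rewrite -lt0n fact_gt0.
have /andP[y0 y1] := y01.
have := @mean_value_major _ (fun x : C => h (x *: (t *: ebase i) + z)) b b' y
  (@line_derivable _ _ h z (t *: ebase i) eh) db y0.
rewrite /= scale0r add0r [h z]g0 subr0 /b expr0n mulr0 subr0 scalerA => H.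
rewrite [leRHS](_ : _ = B * cmod t ^+ l.+1 / (l.+1)`!%:R * y ^+ l.+1); last by ring.
apply: H => y' /andP[y'0 y'y].
have -> := @derive_val _ _ _ _ _ _ _ (line_derive z (t *: ebase i) y'%:C%C eh).
have -> : 'D_(t *: ebase i) h (y'%:C%C *: (t *: ebase i) + z) =
    t * iter (k - l) (partial i) g ((y'%:C%C * t) *: ebase i + z).
  by rewrite kl /= -/h /partial scalerA !deriveE// linearZ.
rewrite cmodM /b' [leRHS](_ : _ = cmod t * (B * cmod t ^+ l * (y' ^+ l / l`!%:R))).
  2: by rewrite exprS; ring.
rewrite ler_wpM2l ?cmod_ge0//.
apply: IH; first exact: ltnW.
by rewrite y'0 (le_trans y'y y1).
Qed.

(** Taylor's remainder of order [k] is bounded by a constant times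
    [(2 e |t| / s) ^ k], where the radius [s] of the disc in the Cauchy estimate
    is arbitrary: a large one gives [2 ^- k]. *)
Lemma flat_line g i z : entireb g -> (forall l, iter l (partial i) g z = 0) ->
  forall t : C, g (t *: ebase i + z) = 0.
Proof.
move=> eg g0 t; have K0 : 0 < expR 1 :> R by exact: expR_gt0.
pose s := 4 * expR 1 * cmod t + 1.
have t0 := cmod_ge0 t.
have s0 : 0 < s by rewrite /s ltr_wpDl// !mulr_ge0// ltW.
have [_ /(_ z (s + cmod t))[M hM]] := eg.
have bound k : cmod (g (t *: ebase i + z)) <= M / 2 ^+ k.
  pose B := (2 * k%:R / s) ^+ k * M.
  have gB (y : R) : 0 <= y <= 1 ->
     cmod (iter k (partial i) g ((y%:C%C * t) *: ebase i + z)) <= B.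
    move=> /andP[y0 y1]; apply: (cauchy_iter k eg s0) => x xs.
    apply: hM; rewrite addrA -scalerDl; apply: polydisc_line; last first.
      by rewrite addr_ge0// ltW.
    apply: le_trans (ler_cmodD _ _) _; apply: lerD => //.
    by rewrite cmodM cmod_real ger0_norm// ler_piMl.
  have M0 : 0 <= M.
    apply: le_trans (hM z _); first exact: cmod_ge0.
    by apply: polydisc_center; rewrite addr_ge0// ltW.
  have := iter_segment_bound eg g0 gB (leqnn k) (y := 1).
  rewrite lexx ler01 subnn /= mul1r expr1n => /(_ isT); move/le_trans; apply.
  have kf : 0 < k`!%:R :> R by rewrite ltr0n fact_gt0.
  rewrite /B mul1r ler_pdivrMr//.
  apply: (@le_trans _ _ ((2 / s) ^+ k * (expR 1 ^+ k * k`!%:R) * M * cmod t ^+ k)).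
    rewrite (_ : 2 * k%:R / s = 2 / s * k%:R); last by ring.
    rewrite exprMn; apply: ler_wpM2r; first exact: exprn_ge0.
    apply: ler_wpM2r => //; apply: ler_wpM2l; first by rewrite exprn_ge0// divr_ge0// ltW.
    exact: expnn_le.
  rewrite [leLHS](_ : _ = (2 / s * expR 1 * cmod t) ^+ k * M * k`!%:R); last first.
    by rewrite !exprMn; ring.
  rewrite ler_wpM2r ?(ltW kf)// [leRHS]mulrC ler_wpM2r// -exprVn.
  apply: lerXn2r; rewrite ?nnegrE ?mulr_ge0 ?invr_ge0 ?(ltW s0) ?(ltW K0)//.
  rewrite -(ler_pM2r s0) [leLHS](_ : _ = 2 * expR 1 * cmod t); last first.
    by field; rewrite gt_eqF.
  rewrite /s mulrDr mulr1 [X in X + _](_ : _ = 2 * expR 1 * cmod t) ?lerDl//.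
  by field.
apply/eqP; rewrite -cmod_eq0 eq_le cmod_ge0 andbT.
apply/ler_addgt0Pr => e e0; rewrite add0r.
by have [k hk] := half_pow_small M e0; apply: le_trans (bound k) (ltW hk).
Qed.

(** Flatness at a point propagates along lines parallel to the axes. *)
Theorem flat_eq0 g z : entireb g ->
  (forall al : multi_index n, mi_derive al g z = 0) -> forall x, g x = 0.
Proof.
move=> eg g0 x; suff H (r : seq 'I_n) (y : V) :
    (forall i, i \notin r -> y ord0 i = z ord0 i) ->
    forall al : multi_index n, mi_derive al g y = 0.
  have := H (enum 'I_n) x _ [ffun=> 0%N].
  have -> : mi_derive [ffun=> 0%N] g = g.
    rewrite mi_deriveE; elim: (enum _) => //= i r IH.
    by rewrite ffunE.
  by apply=> i; rewrite mem_enum.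
elim: r y => [|i r IH] y yz al.
  by have -> : y = z by apply/rowP => i; exact: yz.
pose y' := y - (y ord0 i - z ord0 i) *: ebase i.
rewrite (_ : y = (y ord0 i - z ord0 i) *: ebase i + y'); last first.
  by rewrite /y' addrC subrK.
apply: flat_line => [|l]; first exact: entireb_mi.
rewrite iter_partial_mi//; apply: IH => j jr; rewrite !mxE /=.
have [->|ji] := eqVneq j i; first by rewrite mulr1 subKr.
by rewrite mulr0 subr0 yz// inE negb_or ji.
Qed.

Definition mono z (a : multi_index n) x : C :=
  \prod_i (x ord0 i - z ord0 i) ^+ a i.

Lemma entire_prod (I : Type) (r : seq I) (F : I -> V -> C) :
  (forall k : I, entire (F k)) -> entire (fun x => \prod_(k <- r) F k x).
Proof.
move=> dF; elim: r => [|j r IH].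
  by under [X in entire X]eq_fun do rewrite big_nil; exact: entire_cst.
by under [X in entire X]eq_fun do rewrite big_cons; exact: entireM.
Qed.

Lemma entireX f k : entire f -> entire (fun x => f x ^+ k).
Proof.
move=> ef; elim: k => [|k IH].
  by under [X in entire X]eq_fun do rewrite expr0; exact: entire_cst.
by under [X in entire X]eq_fun do rewrite exprS; exact: entireM.
Qed.

Lemma entire_mono z a : entire (mono z a).
Proof.
apply: entire_prod => i; apply: entireX.
by apply: entireB; [exact: entire_coord|exact: entire_cst].
Qed.

Definition mi_dec (a : multi_index n) i k : multi_index n :=
  [ffun j => if j == i then (a j - k)%N else a j].

Lemma partial_mono (c : C) z a i :
  partial i (c *: mono z a) = (c * (a i)%:R) *: mono z (mi_dec a i 1).
Proof.
apply/funext => x; rewrite /partial; apply: (@derive_val _ _ _ _ _ _ _ _).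
pose A := \prod_(j | j != i) (x ord0 j - z ord0 j) ^+ a j.
pose y := x ord0 i - z ord0 i.
have mE (h : C) : mono z a (h *: ebase i + x) = (h + y) ^+ a i * A.
  rewrite /mono (bigD1 i)//= !mxE !eqxx /= mulr1 /y addrA; congr (_ * _).
  by apply: eq_bigr => j ji; rewrite !mxE (negPf ji) mulr0 add0r.
have mE' : mono z (mi_dec a i 1) x = y ^+ (a i).-1 * A.
  rewrite /mono (bigD1 i)//= ffunE eqxx subn1; congr (_ * _).
  by apply: eq_bigr => j ji; rewrite ffunE (negPf ji).
have mE0 : mono z a x = y ^+ a i * A.
  by have := mE 0; rewrite scale0r !add0r.
have cA : 0 < cmod (c * A) + 1 by rewrite ltr_wpDl ?cmod_ge0.
apply/has_derivP => e e0; have eA : 0 < e / (cmod (c * A) + 1) by rewrite divr_gt0.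
have /has_derivP/(_ _ eA)[d d0 hd] := pow_derive y (a i).
exists d => // h /hd; rewrite scaleCE mulr1 => hle.
have -> : (c *: mono z a) (h *: ebase i + x) - (c *: mono z a) x
    - h * ((c * (a i)%:R) *: mono z (mi_dec a i 1)) x =
    ((h + y) ^+ a i - y ^+ a i - h * ((a i)%:R * y ^+ (a i).-1)) * (c * A).
  have E b w (k : C) : (k *: mono z b) w = k * mono z b w by [].
  rewrite !E mE mE0 mE'; ring.
rewrite cmodM; apply: le_trans (ler_wpM2r (cmod_ge0 _) hle) _.
rewrite mulrAC ler_wpM2r ?cmod_ge0// mulrAC ler_pdivrMr//.
by rewrite ler_pM2l// lerDl.
Qed.

Lemma iter_partial_mono (c : C) z a i k :
  iter k (partial i) (c *: mono z a) = (c * (a i ^_ k)%:R) *: mono z (mi_dec a i k).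
Proof.
elim: k => [|k IH].
  rewrite ffactn0 mulr1 /=; congr (_ *: mono z _).
  by apply/ffunP => j; rewrite ffunE subn0 if_same.
rewrite iterS IH partial_mono -mulrA -natrM.
rewrite {1}/mi_dec ffunE eqxx ffactnSr.
congr (_ *: mono z _); apply/ffunP => j; rewrite !ffunE.
by case: eqP => //; rewrite subn1 subnS.
Qed.

Lemma foldd_mono (be : 'I_n -> nat) z a (r : seq 'I_n) : uniq r ->
  foldr (fun i => iter (be i) (partial i)) (mono z a) r =
  (\prod_(i <- r) (a i ^_ be i)%:R) *:
    mono z [ffun j => if j \in r then (a j - be j)%N else a j].
Proof.
elim: r => [_|i r IH /= /andP[ir ur]].
  rewrite big_nil scale1r /=; congr (mono z _).
  by apply/ffunP => j; rewrite ffunE.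
rewrite IH// iter_partial_mono big_cons ffunE (negPf ir) mulrC.
congr (_ *: mono z _); apply/ffunP => j; rewrite !ffunE inE.
by have [->|] := eqVneq j i; rewrite ?(negPf ir).
Qed.

Lemma mi_derive_mono (be a : multi_index n) z :
  mi_derive be (mono z a) z = if be == a then (mi_fact a)%:R else 0.
Proof.
rewrite mi_deriveE foldd_mono ?enum_uniq//.
have E (k : C) (m : V -> C) : (k *: m) z = k * m z by [].
rewrite E {E}.
have -> : \prod_(i <- enum 'I_n) (a i ^_ be i)%:R = \prod_(i < n) (a i ^_ be i)%:R :> C.
  by rewrite big_enum.
have [->|/eqP ba] := eqVneq be a.
  rewrite /mono [X in _ * X]big1 ?mulr1 => [|i _]; last first.
    by rewrite ffunE mem_enum subnn expr0.
  by rewrite /mi_fact natr_prod; apply: eq_bigr => i _; rewrite ffactnn.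
have [i bai] : exists i, be i != a i.
  apply: contrapT => /forallNP N; apply: ba; apply/ffunP => i.
  by apply/eqP/negPn/negP; exact: N.
have [ab|ba'] := ltnP (a i) (be i).
  by rewrite (bigD1 i)//= ffact_small// mul0r mul0r.
rewrite /mono [X in _ * X](bigD1 i)//= ffunE mem_enum subrr expr0n.
have -> : (a i - be i == 0)%N = false.
  by rewrite subn_eq0 leqNgt ltn_neqAle bai ba'.
by rewrite mul0r mulr0.
Qed.

Lemma mono_le z (a : multi_index n) x (r : R) :
  (forall i, cmod (x ord0 i - z ord0 i) <= r) -> cmod (mono z a x) <= r ^+ mi_abs a.
Proof.
move=> xr; rewrite /mono cmod_prod /mi_abs -prodrXr; apply: ler_prod => i _.
by rewrite cmod_ge0 cmodX lerXn2r ?nnegrE ?cmod_ge0// (le_trans (cmod_ge0 _) (xr i)).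
Qed.

End identity_theorem.

(** * Growth of the weights *)

Section growth.
Context (R : realType).
Implicit Types (rho rhoh : R -> R) (r s x e : R).

Lemma log_slope (L : R -> R) (c R0 : R) : 0 < R0 ->
  (forall r, R0 <= r -> derivable L r 1) ->
  (forall r, R0 <= r -> c <= r * derive1 L r) ->
  forall r s, R0 <= r -> r <= s -> c * (ln s - ln r) <= L s - L r.
Proof.
move=> R00 dL cL r s Rr rs.
have dln x : R0 <= x -> is_derive x (1 : R) (@ln R) x^-1.
  by move=> Rx; apply: is_derive1_ln; exact: lt_le_trans Rx.
pose h x := L x - c * ln x.
have dh x : R0 <= x -> is_derive x (1 : R) h (derive1 L x - c * x^-1).
  move=> Rx; have D1 := derivableP (dL x Rx).
  have D2 := is_deriveZ c (dln x Rx).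
  by rewrite derive1E; exact: is_deriveB D1 D2.
have hr : h r <= h s.
  have hc : {within `[R0, s], continuous h}.
    apply: derivable_within_continuous => x.
    by rewrite in_itv/= => /andP[Rx _]; have [] := dh x Rx.
  apply: (@ger0_derive1_ndecr R h R0 s _ _ hc) => // x; rewrite ?in_itv/=.
  - by move=> /andP[/ltW Rx _]; have [] := dh x Rx.
  - move=> /andP[/ltW Rx _]; have D := dh x Rx.
    rewrite derive1E (@derive_val _ _ _ _ _ _ _ D) subr_ge0.
    by rewrite ler_pdivrMr 1?mulrC ?cL// (lt_le_trans R00 Rx).
by move: hr; rewrite /h; lra.
Qed.

Definition weight rho r := r `^ rho r.

Lemma weight_ge0 rho r : 0 <= weight rho r.
Proof. exact: powR_ge0. Qed.

Lemma weightE rho r : 0 < r -> weight rho r = expR (rho r * ln r).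
Proof. by move=> r0; rewrite /weight /powR gt_eqF. Qed.

(** The logarithmic derivative [r w' / w = rho' r ln r + rho] of the weight
    [w r = r ^ rho r] tends to the order, so that [w] eventually grows at
    polynomial rates. *)
Lemma weight_growth rho (r0 : R) : proximate_order rho r0 -> 0 < r0 ->
  exists2 R0, 1 <= R0 & forall r s, R0 <= r -> r <= s ->
    weight rho r * expR (r0 / 2 * (ln s - ln r)) <= weight rho s /\
    weight rho s <= weight rho r * expR (2 * r0 * (ln s - ln r)).
Proof.
move=> [_ rho_ge0 [drho _] rhoc rho'c] r0_gt0.
have r04 : 0 < r0 / 4 by rewrite divr_gt0.
move/cvgrPdist_le/(_ _ r04): rhoc => [A1 [_ hA1]].
move/cvgrPdist_le/(_ _ r04): rho'c => [A2 [_ hA2]].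
pose R0 := `|A1| + `|A2| + 1.
have R01 : 1 <= R0 by rewrite lerDr addr_ge0.
have RA1 r : R0 <= r -> A1 < r.
  apply: lt_le_trans; apply: le_lt_trans (ler_norm _) _.
  by rewrite /R0 -addrA ltrDl ltr_wpDl.
have RA2 r : R0 <= r -> A2 < r.
  apply: lt_le_trans; apply: le_lt_trans (ler_norm _) _.
  by rewrite /R0 addrAC addrC ltrDl ltr_wpDl.
have Rpos r : R0 <= r -> 0 < r by apply: lt_le_trans; exact: lt_le_trans R01.
pose L r := rho r * ln r.
have dL r : R0 <= r -> is_derive r (1 : R) L (derive1 rho r * ln r + rho r / r).
  move=> Rr; have D1 := derivableP (drho r (Rpos r Rr)).
  have D2 := is_derive1_ln (Rpos r Rr).
  rewrite [X in is_derive _ _ _ X](_ : _ = rho r *: r^-1 + ln r *: 'D_1 rho r).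
    exact: is_deriveM D1 D2.
  by rewrite derive1E addrC; congr (_ + _); exact: mulrC.
have LE r : R0 <= r -> r * derive1 L r = derive1 rho r * (r * ln r) + rho r.
  move=> Rr; have D := dL r Rr; rewrite derive1E (@derive_val _ _ _ _ _ _ _ D).
  by field; rewrite gt_eqF// Rpos.
have bnd r : R0 <= r -> r0 / 2 <= r * derive1 L r <= 2 * r0.
  move=> Rr; rewrite LE//; have := hA1 r (RA1 r Rr); have := hA2 r (RA2 r Rr).
  rewrite sub0r normrN !ler_norml => /andP[h1 h2] /andP[h3 h4].
  by clear -h1 h2 h3 h4 r0_gt0; apply/andP; split; lra.
have R00 : 0 < R0 by exact: Rpos.
have up r s : R0 <= r -> r <= s -> L s - L r <= 2 * r0 * (ln s - ln r).
  move=> Rr rs; have := @log_slope (fun x => - L x) (- (2 * r0)) R0 R00 _ _ r s Rr rs.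
  rewrite mulNr -opprD lerN2; apply => x Rx.
    by apply: derivableN; have [] := dL x Rx.
  have D := is_deriveN (dL x Rx); rewrite derive1E (@derive_val _ _ _ _ _ _ _ D).
  have /andP[_] := bnd x Rx; have D' := dL x Rx.
  by rewrite derive1E (@derive_val _ _ _ _ _ _ _ D') mulrN lerN2.
have lo r s : R0 <= r -> r <= s -> r0 / 2 * (ln s - ln r) <= L s - L r.
  apply: log_slope => // x Rx; first by have [] := dL x Rx.
  by have /andP[] := bnd x Rx.
exists R0 => // r s Rr rs; have Rs := le_trans Rr rs.
rewrite !weightE ?Rpos// -!expRD !ler_expR -/(L r) -/(L s).
by rewrite -lerBrDl lo// -lerBlDl up.
Qed.

(** On [[0, 1]] the weight is at most [1] as the exponent is nonnegative; beyond,
    [rho] is continuous. *)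
Lemma weight_bounded rho (r0 : R) : proximate_order rho r0 -> forall T,
  exists2 B, 0 <= B & forall r, 0 <= r -> r <= T -> weight rho r <= B.
Proof.
move=> [_ rho_ge0 [drho _] _ _] T.
have w01 r : 0 <= r -> r <= 1 -> weight rho r <= 1.
  move=> rge r1; move: rge; rewrite le_eqVlt => /orP[/eqP<-|rgt].
    have [e0|/powR0] := eqVneq (rho 0) 0; first by rewrite /weight e0 powRr0.
    by rewrite /weight => ->.
  rewrite weightE// -expR0 ler_expR mulr_ge0_le0 ?ln_le0//.
  by rewrite rho_ge0// ltW.
have [T1|T1] := leP T 1.
  by exists 1 => // r r0' rT; apply: w01 => //; exact: le_trans T1.
have rhoc : {within `[1, T], continuous rho}.
  apply: derivable_within_continuous => x; rewrite in_itv/= => /andP[x1 _].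
  by apply: drho; exact: lt_le_trans x1.
have [c _ cmax] := EVT_max (ltW T1) rhoc.
exists (Num.max 1 (expR (rho c * ln T))); first by rewrite le_max ler01.
move=> r rge rT; rewrite le_max; have [r1|r1] := leP r 1.
  by rewrite w01.
have r1' : 0 < r by exact: lt_trans r1.
rewrite weightE// ler_expR orbC ler_pM ?rho_ge0 ?ln_ge0 ?(ltW r1)//.
  by apply: cmax; rewrite in_itv/= (ltW r1).
by rewrite ler_ln// posrE// (lt_trans _ T1).
Qed.

(** The weight need not be monotone near the origin: the additive constant
    absorbs its oscillation there. *)
Lemma weight_subadd rho (r0 : R) : proximate_order rho r0 -> 0 < r0 ->
  exists2 D, 1 <= D & forall x a b, 0 <= x -> x <= a + b -> 0 <= a -> 0 <= b ->
    weight rho x <= D * (weight rho a + weight rho b + 1).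
Proof.
move=> po r00; have [R0 R01 wg] := weight_growth po r00.
have [B B0 wB] := weight_bounded po (R0 + R0).
pose K := expR (2 * r0 * ln 2); have K0 : 0 <= K by exact: expR_ge0.
have K1 : 1 <= K by rewrite -expR0 ler_expR !mulr_ge0 ?ln_ge0 ?(ltW r00)// ler1n.
exists (B + K) => [|x a b x0 xab a0 b0]; first by rewrite ler_wpDl.
wlog ab : a b a0 b0 xab / a <= b.
  move=> W; have [|/ltW] := leP a b; first exact: W.
  by move=> ba; rewrite (addrC (weight rho a)); apply: W => //; rewrite addrC.
have R00 : 0 < R0 by exact: lt_le_trans R01.
have wa := weight_ge0 rho a; have wb := weight_ge0 rho b.
have small : x <= R0 + R0 -> weight rho x <= (B + K) * (weight rho a + weight rho b + 1).
  move=> xR; apply: (@le_trans _ _ B); first exact: wB.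
  rewrite mulrDl -[leLHS]addr0 lerD ?mulr_ge0 ?addr_ge0//.
  by rewrite ler_peMr// lerDr addr_ge0.
have big : weight rho x <= weight rho b * K ->
    weight rho x <= (B + K) * (weight rho a + weight rho b + 1).
  move=> h; apply: le_trans h _; rewrite mulrC; apply: ler_pM => //.
    by rewrite lerDr.
  by rewrite -addrA addrCA lerDl addr_ge0.
have [xR|Rx] := leP x (R0 + R0); first exact: small.
have [bR|Rb] := leP b R0.
  by apply: small; apply: le_trans xab _; rewrite lerD// (le_trans ab).
have bp : 0 < b by exact: lt_trans Rb.
have xR : R0 <= x by apply: le_trans (ltW Rx); rewrite lerDl ltW.
have xp : 0 < x by exact: lt_le_trans xR.
apply: big; have [xb|bx] := leP x b.
  have [h _] := wg x b xR xb; apply: (@le_trans _ _ (weight rho b)); last by rewrite ler_peMr.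
  apply: le_trans h; rewrite ler_peMr ?weight_ge0// -expR0 ler_expR mulr_ge0//.
    by rewrite divr_ge0// ltW.
  by rewrite subr_ge0 ler_ln ?posrE.
have [_ h] := wg b x (ltW Rb) (ltW bx); apply: le_trans h _.
rewrite ler_wpM2l// ler_expR ler_wpM2l ?mulr_ge0 ?(ltW r00)//.
rewrite -ln_div ?posrE// ler_ln ?posrE ?divr_gt0//.
rewrite ler_pdivrMr// mulr_natl mulr2n; apply: le_trans xab _.
by rewrite lerD2r.
Qed.

Section normalized.
Variables (rho rhoh : R -> R) (r0 : R).
Hypotheses (po : proximate_order rho r0) (r0_gt0 : 0 < r0).
Hypothesis no : normalization rho r0 rhoh.
Local Notation phi := (phi_inv rhoh).
Local Notation w := (weight rho).

Lemma phiP t : 0 < t -> 0 < phi t /\ weight rhoh (phi t) = t.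
Proof.
move=> t0; have [_ _ _ im] := no.
have tI : ((fun r => r `^ rhoh r) @` [set r | 0 < r]) t by rewrite im.
split; last by rewrite /weight; apply: (pinvK _ (mem_set tI)).
pose f r := r `^ rhoh r; pose A := [set r : R | 0 < r].
have fA : set_surj A (f @` A) f by [].
by apply: (surjpinv_image_sub (dflt := fun=> 0) fA); exists t.
Qed.

Lemma phi_large (S : R) : 0 < S -> forall t, weight rhoh S < t -> S < phi t.
Proof.
move=> S0 t St; have t0 : 0 < t by apply: le_lt_trans St; exact: weight_ge0.
have [p0 pE] := phiP t0; have [_ _ incr _] := no.
rewrite ltNge; apply/negP; rewrite le_eqVlt => /orP[/eqP pS|pS].
  by move: St; rewrite -pS pE ltxx.
by have := incr _ _ p0 pS; rewrite -/(weight rhoh _) -/(weight rhoh _) pE ltNge ltW.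
Qed.

(** [phi] inverts the weight of the normalization, which differs from [w] on a
    bounded set only. *)
Lemma weight_phi : exists2 B, 0 <= B & forall t, 0 < t -> w (phi t) <= t + B.
Proof.
have [_ [T T0 wT] _ _] := no; have [B B0 wB] := weight_bounded po T.
exists B => // t t0; have [p0 pE] := phiP t0.
have [pT|Tp] := leP (phi t) T.
  by apply: (le_trans (wB _ (ltW p0) pT)); rewrite lerDr ltW.
by rewrite -{2}pE {1}/weight -wT ?(ltW Tp)// lerDl.
Qed.

(** A monomial of degree [q] is compared with [exp (sigma w)] beyond the radius
    [eps * phi q], where [w] is already a fixed fraction of [q] and grows
    polynomially, whereas the monomial contributes [q ln (r / (eps * phi q))]. *)
Lemma monomial_weight e : 0 < e -> exists2 sigma, 0 < sigma & exists2 K, 1 <= K &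
  forall q r, 0 <= r -> r ^+ q <= K * (e * phi q%:R) ^+ q * expR (sigma * w r).
Proof.
wlog e1 : e / e <= 1.
  move=> W e0; have m0 : 0 < Num.min e 1 by rewrite lt_min e0 ltr01.
  have [|sigma s0 [K K1 h]] := W (Num.min e 1) _ m0; first by rewrite ge_min lexx orbT.
  exists sigma => //; exists K => // -[|q] r rge; first exact: (h 0%N).
  apply: le_trans (h _ _ rge) _; rewrite ler_pM2r ?expR_gt0//.
  have [p0 _] := phiP (ltr0Sn R q).
  rewrite ler_wpM2l ?(le_trans ler01)// lerXn2r ?nnegrE ?mulr_ge0 ?(ltW p0) ?(ltW m0) ?(ltW e0)//.
  by rewrite ler_pM2r// ge_min lexx.
move=> e0; have [R0 R01 wg] := weight_growth po r0_gt0.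
have [_ [T T0 wT] _ _] := no.
pose S := Num.max T R0 / e.
have mx0 : 0 < Num.max T R0 by rewrite lt_max T0.
have S0 : 0 < S by rewrite divr_gt0.
pose eta := r0 / 2; have eta0 : 0 < eta by rewrite divr_gt0.
pose c := expR (2 * r0 * ln e); have c0 : 0 < c by exact: expR_gt0.
(* With [s = phi q], [c q] bounds [w (e s)] from below, and
   [w r >= c q (r / (e s)) ^ eta >= c q eta ln (r / (e s))] for [r >= e s]. *)
pose sigma := (eta * c)^-1; have s0 : 0 < sigma by rewrite invr_gt0 mulr_gt0.
have large q r : weight rhoh S < q%:R -> 0 <= r ->
    r ^+ q <= (e * phi q%:R) ^+ q * expR (sigma * w r).
  move=> Sq rge; have q0 : 0 < q%:R :> R by apply: le_lt_trans Sq; exact: weight_ge0.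
  have [p0 pE] := phiP q0; have Sp := phi_large S0 Sq.
  set s := phi q%:R in p0 pE Sp *.
  have es : Num.max T R0 < e * s by rewrite mulrC -ltr_pdivrMr.
  move: (es); rewrite gt_max => /andP[Tes Res].
  have es0 : 0 < e * s by rewrite mulr_gt0.
  have ess : e * s <= s by rewrite ler_piMl// ltW.
  have ws : w s = q%:R by rewrite /weight -wT// (le_trans (ltW Tes)).
  have [res|esr] := leP r (e * s).
    apply: (@le_trans _ _ ((e * s) ^+ q)); first by rewrite lerXn2r ?nnegrE ?(ltW es0).
    by rewrite ler_peMr ?exprn_ge0 ?(ltW es0)// -expR0 ler_expR mulr_ge0 ?(ltW s0) ?weight_ge0.
  have r0' : 0 < r by exact: lt_trans esr.
  have [_ h1] := wg (e * s) s (ltW Res) ess.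
  have [h2 _] := wg (e * s) r (ltW Res) (ltW esr).
  have {h1} h1 : c * q%:R <= w (e * s).
    rewrite -ws; apply: le_trans (ler_wpM2l (ltW c0) h1) _.
    rewrite mulrCA -expRD lnM ?posrE// opprD addrCA subrr addr0 mulrN subrr expR0.
    by rewrite mulr1.
  have {h2} h2 : c * q%:R * expR (eta * (ln r - ln (e * s))) <= w r.
    by apply: le_trans h2; rewrite ler_pM2r ?expR_gt0.
  rewrite -[r in r ^+ _](lnK (x := r)) ?posrE// -{1}[e * s]lnK ?posrE//.
  rewrite -!expRM_natl -expRD ler_expR -lerBlDl -mulrBr.
  set d := ln r - ln (e * s) in h2 *.
  have d_le : eta * d <= expR (eta * d).
    by apply: le_trans (expR_ge1Dx _); rewrite lerDr.
  rewrite -(ler_pM2l (mulr_gt0 eta0 c0)) mulrA [leRHS]mulrA divff ?gt_eqF ?mulr_gt0// mul1r.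
  apply: le_trans h2.
  rewrite [leLHS](_ : _ = c * q%:R * (eta * d)); last by ring.
  by rewrite ler_pM2l// mulr_gt0.
(* Only the exponents [q < Q] remain, for which [r ^ q <= 1 + r ^ Q]. *)
pose Q := (Num.truncn (weight rhoh S)).+1.
have SQ : weight rhoh S < Q%:R by exact: truncnS_gt.
pose b q : R := (e * phi q%:R) ^+ q.
have b0 q : 0 < b q.
  rewrite /b; case: q => [|q]; first by rewrite expr0.
  by rewrite exprn_gt0// mulr_gt0//; have [] := phiP (ltr0Sn R q).
pose K := \sum_(j < Q.+1) (1 + b Q) * (1 + (b j)^-1).
have K_term j : 0 <= (1 + b Q) * (1 + (b j)^-1).
  by rewrite mulr_ge0 ?addr_ge0 ?invr_ge0 ?(ltW (b0 _)).
have Kj (j : 'I_Q.+1) : (1 + b Q) * (1 + (b j)^-1) <= K.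
  by rewrite /K (bigD1 j)//= lerDl sumr_ge0.
exists sigma => //; exists K => [|q r rge].
  apply: le_trans (Kj ord0); rewrite -[leLHS]mulr1.
  by apply: ler_pM => //; rewrite lerDl ?invr_ge0 ltW.
have K1 : 1 <= K.
  apply: le_trans (Kj ord0); rewrite -[leLHS]mulr1.
  by apply: ler_pM => //; rewrite lerDl ?invr_ge0 ltW.
have [qS|Sq] := leP q%:R (weight rhoh S); last first.
  apply: le_trans (large q r Sq rge) _; rewrite ler_pM2r ?expR_gt0//.
  by rewrite ler_peMl// ltW// b0.
have qQ : (q < Q)%N by rewrite -(ltr_nat R); exact: le_lt_trans SQ.
have e1w : 1 <= expR (sigma * w r).
  by rewrite -expR0 ler_expR mulr_ge0 ?weight_ge0// ltW.
have h1 : r ^+ q <= (1 + b Q) * expR (sigma * w r).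
  apply: (@le_trans _ _ (1 + r ^+ Q)).
    have [r1|r1] := leP r 1.
      by apply: le_trans (_ : 1 <= _); [exact: exprn_ile1|rewrite lerDl exprn_ge0].
    by apply: ler_wpDl => //; apply: ler_weXn2l; [exact: ltW|exact: ltnW].
  by rewrite mulrDl mul1r lerD// large.
apply: le_trans h1 _; rewrite ler_pM2r ?expR_gt0//.
have qQ' : (q < Q.+1)%N by rewrite ltnS ltnW.
apply: le_trans (_ : ((1 + b Q) * (1 + (b q)^-1)) * b q <= _); last first.
  by rewrite ler_pM2r// (Kj (Ordinal qQ')).
rewrite -mulrA ler_peMr ?addr_ge0 ?ltW//.
by rewrite mulrDl mul1r mulVf ?gt_eqF// ltrDr b0.
Qed.

End normalized.

End growth.

(** * The weighted spaces *)

Section weighted_spaces.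
Context (R : realType) (n : nat) (rho : R -> R).
Local Notation C := (Cplx R).
Local Notation V := ('rV[C]_n).
Local Notation A := (@Aspace R n rho).
Local Notation w z := (weight rho (eucl z)).
Implicit Types (f g : A) (z : V).

Lemma wnorm_boundP (sigma : R) (f : V -> C) (M : R) : (wnorm rho sigma f <= M%:E)%E <->
  forall z, cmod (f z) <= M * expR (sigma * w z).
Proof.
split=> [/wnorm_leP fM z|fM].
  have := fM z; rewrite -(ler_pM2r (expR_gt0 (sigma * w z))) -mulrA -expRD.
  by rewrite addNr expR0 mulr1.
apply/wnorm_leP => z; rewrite expRN ler_pdivrMr ?expR_gt0//; exact: fM.
Qed.

Lemma AfunD f g z : Afun (f + g) z = f z + g z. Proof. by []. Qed.
Lemma AfunZ (c : C) f z : Afun (c *: f) z = c * f z. Proof. by []. Qed.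

Lemma Afun_sum (I : Type) (r : seq I) (F : I -> A) z :
  Afun (\sum_(i <- r) F i) z = \sum_(i <- r) F i z.
Proof. by elim: r => [|i r IH]; rewrite ?big_nil// !big_cons AfunD IH. Qed.

Lemma partial_sumE (I : choiceType) (t : I -> A) (J : {fset I}) z :
  Afun (partial_sum t J) z = \sum_(i <- J) t i z.
Proof. by rewrite /partial_sum big_seq_fsetE Afun_sum. Qed.

Lemma Afun_inj f g : Afun f = Afun g -> f = g.
Proof. exact: val_inj. Qed.

Lemma Aspace_bound f : entire f /\ exists2 sigma, 0 < sigma & exists2 K, 0 <= K &
  (wnorm rho sigma f <= K%:E)%E.
Proof.
have /set_mem[ef [sigma s0 /wnorm_ltyP[K fK]]] := AfunP f; split=> //.
exists sigma => //; exists K => //.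
by rewrite -lee_fin (le_trans (wnorm_ge0 rho sigma f)).
Qed.

Lemma Aspace_intro (f : V -> C) (sigma K : R) : entire f -> 0 < sigma ->
  (wnorm rho sigma f <= K%:E)%E -> exists g : A, Afun g = f.
Proof.
move=> ef s0 fK; have fA : f \in @growth R n rho.
  by apply/mem_set; split=> //; exists sigma => //; apply: le_lt_trans fK _; exact: ltry.
by exists (MkAspace fA).
Qed.

(** Neighborhoods of zero given by weighted values at a sequence of points: the
    constant sequences give the continuity of evaluations, and the general ones
    serve to test boundedness. *)
Lemma eval_lim_base (z : nat -> V) (c : nat -> R) : (forall m, 0 <= c m) ->
  (forall sigma : R, 0 < sigma -> exists K, forall m, c m * expR (sigma * w (z m)) <= K) ->
  lim_base [set f : A | forall m, cmod (f (z m)) * c m <= 1].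
Proof.
move=> c0 cK; split=> [f g s t fU gU st m|sigma s0].
  rewrite AfunD !AfunZ.
  have st1 : cmod s + cmod t <= 1 by rewrite -lecR rmorphD /= -!cmodE.
  apply: le_trans st1.
  apply: (@le_trans _ _ ((cmod (s * f (z m)) + cmod (t * g (z m))) * c m)).
    by rewrite ler_wpM2r// ler_cmodD.
  rewrite mulrDl !cmodM -!mulrA; apply: lerD.
    by rewrite -[leRHS]mulr1 ler_wpM2l ?cmod_ge0//; exact: fU.
  by rewrite -[leRHS]mulr1 ler_wpM2l ?cmod_ge0//; exact: gU.
have [K hK] := cK _ s0.
have K1 : 0 < `|K| + 1 by rewrite ltr_wpDl.
exists (`|K| + 1)^-1; first by rewrite invr_gt0.
move=> f /ltW /wnorm_boundP fe m.
apply: le_trans (ler_wpM2r (c0 m) (fe (z m))) _.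
rewrite -mulrA [_ * c m]mulrC -ler_pdivlMl ?invr_gt0// invrK mulr1.
apply: le_trans (hK m) _; apply: le_trans (ler_norm K) _.
by rewrite lerDl.
Qed.

Lemma cvg_eval (T : Type) (F : set_system T) (FF : Filter F) (h : T -> A) g z :
  h @ F --> g -> (h t z @[t --> F] --> g z).
Proof.
move=> hg; apply/cplx_cvgP => e e0.
have e1 : 0 <= e^-1 by rewrite invr_ge0 ltW.
have bU : lim_base [set f : A | forall m : nat, cmod (f z) * e^-1 <= 1].
  apply: (@eval_lim_base (fun=> z) (fun=> e^-1)) => // sigma _.
  by exists (e^-1 * expR (sigma * w z)).
have nU : nbhs g [set g' : A | forall m : nat, cmod (Afun (g' - g) z) * e^-1 <= 1].
  by exists [set f : A | forall m : nat, cmod (f z) * e^-1 <= 1].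
apply: (@filterS _ F FF _ _ _ (hg _ nU)) => t /= /(_ 0%N) hz.
have {hz} : cmod (h t z - g z) * e^-1 <= 1 := hz.
by rewrite ler_pdivrMr// mul1r cmod_dist.
Qed.

Lemma cvg_unique_A (T : Type) (F : set_system T) (FF : ProperFilter F) (h : T -> A) f g :
  h @ F --> f -> h @ F --> g -> f = g.
Proof.
move=> hf hg; apply/Afun_inj/funext => z.
have F' : Filter F by exact: filter_filter.
apply/eqP; rewrite -subr_eq0 -cmod_eq0 eq_le cmod_ge0 andbT.
apply/ler_addgt0Pr => e e0; rewrite add0r; have e2 : 0 < e / 2 by rewrite divr_gt0.
have /cplx_cvgP/(_ _ e2) h1 := @cvg_eval _ F F' h f z hf.
have /cplx_cvgP/(_ _ e2) h2 := @cvg_eval _ F F' h g z hg.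
have [t [ht1 ht2]] := filter_ex (filterI h1 h2).
apply: le_trans (cmod_triangle (h t z) _ _) _; rewrite (splitr e).
by apply: lerD => //; rewrite cmod_dist.
Qed.

Lemma cvg_wnorm (T : Type) (F : set_system T) (FF : Filter F) (h : T -> A) g (sigma : R) :
  0 < sigma ->
  (forall e : R, 0 < e -> \forall t \near F, (wnorm rho sigma (h t - g)%R <= e%:E)%E) ->
  h @ F --> g.
Proof.
move=> s0 hg P [U [aU bU] UP]; have [e e0 He] := bU _ s0.
have e2 : 0 < e / 2 by rewrite divr_gt0.
apply: filterS (hg _ e2) => t ht; apply: UP; apply: He.
by apply: le_lt_trans ht _; rewrite lte_fin ltr_pdivrMr// ltr_pMr// ltr1n.
Qed.

End weighted_spaces.

(** * Continuous linear maps are the bounded ones *)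

Section bounded_operators.
Context (R : realType) (n : nat) (rho1 rho2 : R -> R).
Local Notation C := (Cplx R).
Local Notation V := ('rV[C]_n).
Local Notation A1 := (@Aspace R n rho1).
Local Notation A2 := (@Aspace R n rho2).

Lemma bounded_continuous (P : {linear A1 -> A2}) :
  (forall sigma : R, 0 < sigma -> exists2 tau, 0 < tau & exists2 K, 0 <= K &
     forall (f : A1) (M : R), 0 <= M -> (wnorm rho1 sigma f <= M%:E)%E ->
       (wnorm rho2 tau (P f) <= (K * M)%:E)%E) ->
  continuous P.
Proof.
move=> Pb f W [U [aU bU] UW]; exists [set g | U (P g)]; last first.
  by move=> g /= Ug; apply: UW => /=; rewrite -linearB.
split=> [g h s t Ug Uh st /=|sigma s0]; first by rewrite linearD !linearZ; exact: aU.
have [tau t0 [K K0 PK]] := Pb _ s0; have [e e0 He] := bU _ t0.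
have K1 : 0 < K + 1 by rewrite ltr_wpDl.
exists (e / (K + 1)); first by rewrite divr_gt0.
move=> g /ltW ge; apply: He.
have d0 : 0 <= e / (K + 1) by rewrite divr_ge0 ?ltW.
apply: le_lt_trans (PK _ _ d0 ge) _; rewrite lte_fin mulrA ltr_pdivrMr//.
by rewrite mulrC ltr_pM2l// ltrDl.
Qed.

(** If the image of the unit ball of some [A_sigma] were unbounded in every
    [A_m], with witnesses [z m], then the functionals [g (z m) exp (- m w)] would
    define a neighborhood of zero that does not absorb the image of that ball: they
    are uniformly bounded on the unit ball of each [A_tau], where the one of index
    [m] is at most [1] as soon as [m >= tau]. *)
Lemma continuous_bounded (F : {linear A1 -> A2}) : continuous F ->
  forall sigma : R, 0 < sigma -> exists2 tau, 0 < tau & exists2 K, 0 <= K &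
    forall (f : A1) (M : R), 0 < M -> (wnorm rho1 sigma f <= M%:E)%E ->
      (wnorm rho2 tau (F f) <= (K * M)%:E)%E.
Proof.
move=> cF sigma s0; apply: contrapT => N.
have bad (m : nat) : exists fz : A1 * V, (wnorm rho1 sigma fz.1 <= 1%:E)%E /\
    m.+1%:R * expR (m.+1%:R * weight rho2 (eucl fz.2)) < cmod (Afun (F fz.1) fz.2).
  apply: contrapT => Nm; apply: N; exists m.+1%:R => //; exists m.+1%:R => //.
  move=> f M M0 fM; apply/wnorm_boundP => z.
  have Mi : cmod (M^-1%:C%C : C) = M^-1 by rewrite cmod_real ger0_norm// invr_ge0 ltW.
  rewrite leNgt; apply/negP => bz; apply: Nm.
  exists (M^-1%:C%C *: f, z) => /=; split.
    have := wnormZ_le (M^-1%:C%C : C) fM.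
    by rewrite Mi mulVf// gt_eqF.
  rewrite linearZ AfunZ cmodM Mi -(ltr_pM2l M0) mulVKf ?gt_eqF//.
  by rewrite mulrA [M * _]mulrC.
pose f m := (projT1 (cid (bad m))).1; pose z m := (projT1 (cid (bad m))).2.
have fP m : (wnorm rho1 sigma (f m) <= 1%:E)%E by have [] := projT2 (cid (bad m)).
have zP m : m.+1%:R * expR (m.+1%:R * weight rho2 (eucl (z m))) < cmod (Afun (F (f m)) (z m)).
  by have [] := projT2 (cid (bad m)).
pose c m : R := expR (- (m.+1%:R * weight rho2 (eucl (z m)))).
have bU : lim_base [set g : A2 | forall m, cmod (g (z m)) * c m <= 1].
  apply: eval_lim_base => [m|tau t0]; first exact: expR_ge0.
  pose N0 := (Num.truncn tau).+1.
  pose K0 := \sum_(j < N0) expR (tau * weight rho2 (eucl (z j))).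
  exists (1 + K0) => m; rewrite /c -expRD.
  have K00 : 0 <= K0 by apply: sumr_ge0 => j _; exact: expR_ge0.
  have w0 := weight_ge0 rho2 (eucl (z m)).
  have [Nm|mN] := leqP N0 m.
    apply: (@le_trans _ _ 1); last by rewrite lerDl.
    have Nm1 : N0%:R <= m.+1%:R :> R by rewrite ler_nat ltnW.
    have tm : tau <= m.+1%:R := le_trans (ltW (truncnS_gt _)) Nm1.
    by rewrite -[leRHS]expR0 ler_expR [leLHS]addrC subr_le0; exact: ler_wpM2r.
  apply: (@le_trans _ _ K0); last by rewrite lerDr.
  rewrite /K0 (bigD1 (Ordinal mN))//= -[leLHS]addr0; apply: lerD.
    by rewrite ler_expR gerDr oppr_le0 mulr_ge0.
  by apply: sumr_ge0 => j _; exact: expR_ge0.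
have nF : nbhs (F 0) [set g | [set g : A2 | forall m, cmod (g (z m)) * c m <= 1] (g - F 0)].
  by exists [set g : A2 | forall m, cmod (g (z m)) * c m <= 1].
have [W [_ bW] WU] := cF 0 _ nF; have [e e0 He] := bW _ s0.
have e2 : 0 < e / 2 by rewrite divr_gt0.
pose m := Num.truncn (e / 2)^-1.
have Wf : W ((e / 2)%:C%C *: f m).
  apply: He; apply: le_lt_trans (wnormZ_le _ (fP m)) _.
  rewrite lte_fin mulr1 cmod_real gtr0_norm// ltr_pdivrMr// ltr_pMr//.
  by rewrite ltr1n.
have := WU ((e / 2)%:C%C *: f m); rewrite /= linear0 !subr0 => /(_ Wf m).
rewrite linearZ AfunZ cmodM cmod_real gtr0_norm//.
apply/negP; rewrite -ltNge.
apply: (@lt_trans _ _ (e / 2 * (m.+1%:R * expR (m.+1%:R * weight rho2 (eucl (z m)))) * c m)).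
  rewrite /c -[ltRHS]mulrA -[X in e / 2 * X]mulrA -expRD subrr expR0 mulr1.
  rewrite -ltr_pdivrMl// mulr1.
  exact: truncnS_gt.
by rewrite ltr_pM2r ?expR_gt0// ltr_pM2l.
Qed.

End bounded_operators.

(** * Euclidean norm and polydiscs *)

Section euclidean.
Context (R : realType) (n : nat).
Local Notation C := (Cplx R).
Local Notation V := ('rV[C]_n).

Lemma eucl_ge0 (z : V) : 0 <= eucl z.
Proof. exact: sqrtr_ge0. Qed.

Lemma coord_eucl (z : V) i : cmod (z ord0 i) <= eucl z.
Proof.
rewrite -[leLHS]ger0_norm ?cmod_ge0// -sqrtr_sqr /eucl ler_sqrt; last first.
  by apply: sumr_ge0 => j _; exact: sqr_ge0.
by rewrite (bigD1 i)//= lerDl sumr_ge0// => j _; exact: sqr_ge0.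
Qed.

Lemma eucl_polydisc (z x : V) (s : R) : 0 <= s -> polydisc z s x ->
  eucl x <= 2 * eucl z + 2 * n%:R * s.
Proof.
move=> s0 zx; have z0 := eucl_ge0 z.
have B0 : 0 <= 2 * eucl z + 2 * n%:R * s by rewrite addr_ge0 ?mulr_ge0.
rewrite -[leRHS]ger0_norm// -sqrtr_sqr /eucl ler_sqrt ?sqr_ge0// -/(eucl z).
have z2 : eucl z ^+ 2 = \sum_i cmod (z ord0 i) ^+ 2.
  by rewrite sqr_sqrtr// sumr_ge0// => i _; exact: sqr_ge0.
apply: (@le_trans _ _ (\sum_i (2 * cmod (z ord0 i) ^+ 2 + 2 * s ^+ 2))).
  apply: ler_sum => i _.
  have xi : cmod (x ord0 i) <= cmod (z ord0 i) + s.
    rewrite -[x ord0 i](subrK (z ord0 i)) addrC.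
    by apply: le_trans (ler_cmodD _ _) _; rewrite lerD2l.
  apply: (@le_trans _ _ ((cmod (z ord0 i) + s) ^+ 2)).
    by rewrite lerXn2r ?nnegrE ?addr_ge0 ?cmod_ge0.
  rewrite -subr_ge0 [leRHS](_ : _ = (cmod (z ord0 i) - s) ^+ 2); last by ring.
  exact: sqr_ge0.
rewrite big_split /= -mulr_sumr -z2 sumr_const card_ord -[_ *+ n]mulr_natl.
rewrite sqrrD -subr_ge0.
set N : R := n%:R; set e := eucl z in z0 *.
have N0 : 0 <= N by exact: ler0n.
have NN : N <= N * N by rewrite -natrM ler_nat; case: (n) => // m; rewrite leq_pmull.
have es : 0 <= e * s * N by rewrite !mulr_ge0.
have e2 : 0 <= e ^+ 2 by exact: sqr_ge0.
have s2 : 0 <= N * s ^+ 2 * (N - 1).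
  by rewrite mulrAC mulrBr mulr1 mulr_ge0 ?sqr_ge0// subr_ge0.
have s3 : 0 <= N * s ^+ 2 by rewrite mulr_ge0 ?sqr_ge0.
rewrite [leRHS](_ : _ = 2 * e ^+ 2 + 8 * (e * s * N) +
   4 * (N * s ^+ 2 * (N - 1)) + 2 * (N * s ^+ 2)); last by ring.
by rewrite !addr_ge0// mulr_ge0.
Qed.

End euclidean.

(** * Geometric series over multi-indices *)

Section geometric_series.
Context (R : realType) (n : nat).
Local Notation mi := (multi_index n).
Local Open Scope fset_scope.

Definition box (N : nat) : {fset mi} :=
  [fset ([ffun i => nat_of_ord (h i)] : mi) | h : {ffun 'I_n -> 'I_N} in predT].

Lemma boxP N (al : mi) : reflect (forall i, al i < N)%N (al \in box N).
Proof.
apply: (iffP idP) => [/imfsetP[h _ -> i]|alN]; first by rewrite ffunE.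
by apply/imfsetP; exists [ffun i => Ordinal (alN i)] => //; apply/ffunP => i; rewrite !ffunE.
Qed.

Lemma geom_half (N : nat) : \sum_(k < N) (2 ^- k : R) <= 2.
Proof.
suff -> : \sum_(k < N) (2 ^- k : R) = 2 - 2 * 2 ^- N.
  by rewrite lerBlDr lerDl mulr_ge0 ?invr_ge0 ?exprn_ge0.
elim: N => [|N IH]; first by rewrite big_ord0 expr0 invr1 mulr1 subrr.
by rewrite big_ord_recr /= IH exprS invfM; field; rewrite expf_neq0.
Qed.

Lemma sum_box (N : nat) :
  \sum_(al <- box N) (2 ^- mi_abs al : R) <= 2 ^+ n.
Proof.
rewrite big_imfset /=; last first.
  move=> h1 h2 _ _ /ffunP h12; apply/ffunP => i; apply: val_inj.
  by have := h12 i; rewrite !ffunE.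
rewrite big_enum /=.
rewrite (eq_bigr (fun h : {ffun 'I_n -> 'I_N} => \prod_i (2 ^- h i : R))).
  rewrite -(bigA_distr_bigA (fun (i : 'I_n) (k : 'I_N) => 2 ^- k : R)) /=.
  rewrite -[X in 2 ^+ X]card_ord -prodr_const; apply: ler_prod => i _.
  by rewrite geom_half sumr_ge0// => k _; rewrite invr_ge0 exprn_ge0.
move=> h _; rewrite /mi_abs -exprVn -prodrXr; apply: eq_bigr => i _.
by rewrite ffunE exprVn.
Qed.

Lemma fset_in_box (J : {fset mi}) : exists N, J `<=` box N.
Proof.
exists (\max_(al <- J) \max_i al i).+1; apply/fsubsetP => al alJ; apply/boxP => i.
rewrite ltnS; apply: leq_trans (leq_bigmax i) _.
by rewrite (big_fsetD1 al)//= leq_maxl.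
Qed.

Lemma sum_fset_le (J K : {fset mi}) (F : mi -> R) : (forall al, 0 <= F al) ->
  J `<=` K -> \sum_(al <- J) F al <= \sum_(al <- K) F al.
Proof.
move=> F0 JK; rewrite [leRHS](big_fsetID _ (mem J)) /=.
have -> : [fset x in K | x \in J] = J.
  apply/fsetP => al; rewrite !inE /=; apply/andb_idl; exact: (fsubsetP JK).
by rewrite lerDl sumr_ge0.
Qed.

Lemma sum_half (J : {fset mi}) : \sum_(al <- J) (2 ^- mi_abs al : R) <= 2 ^+ n.
Proof.
have [N JN] := fset_in_box J; apply: le_trans (sum_box N).
by apply: sum_fset_le => // al; rewrite invr_ge0 exprn_ge0.
Qed.

(** The second factor of [4 ^- q = 2 ^- q * 2 ^- q] makes the tail outside the
    box of side [N] small. *)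
Lemma sum_quarter_tail (J : {fset mi}) N : (forall al, al \in J -> al \notin box N) ->
  \sum_(al <- J) (4 ^- mi_abs al : R) <= 2 ^+ n / 2 ^+ N.
Proof.
move=> JN; apply: (@le_trans _ _ (\sum_(al <- J) (2 ^- mi_abs al) / 2 ^+ N)); last first.
  by rewrite -mulr_suml ler_wpM2r ?invr_ge0 ?exprn_ge0// sum_half.
rewrite big_seq [leRHS]big_seq; apply: ler_sum => al alJ.
rewrite (_ : 4 = 2 * 2 :> R) ?exprMn ?invfM; last by rewrite -natrM.
rewrite ler_wpM2l ?invr_ge0 ?exprn_ge0// lef_pV2 ?posrE ?exprn_gt0//.
apply: ler_weXn2l; first by rewrite ler1n.
have /boxP alN := JN _ alJ; rewrite leqNgt; apply/negP => alN'; apply: alN => i.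
by apply: leq_ltn_trans alN'; rewrite /mi_abs (bigD1 i)//= leq_addr.
Qed.

Lemma sum_quarter (J : {fset mi}) : \sum_(al <- J) (4 ^- mi_abs al : R) <= 2 ^+ n.
Proof.
apply: le_trans (sum_half J); apply: ler_sum => al _.
rewrite lef_pV2 ?posrE ?exprn_gt0// lerXn2r ?nnegrE//.
by rewrite ler_nat.
Qed.

End geometric_series.

(** * Summable series in the weighted spaces *)

Section summable_series.
Context (R : realType) (n : nat) (rho : R -> R) (r0 : R).
Local Notation C := (Cplx R).
Local Notation V := ('rV[C]_n).
Local Notation A := (@Aspace R n rho).
Local Notation mi := (multi_index n).
Local Notation w z := (weight rho (eucl z)).
Hypothesis po : proximate_order rho r0.

Lemma weight_polydisc (z : V) (s : R) : exists2 B, 0 <= B &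
  forall x, polydisc z s x -> w x <= B.
Proof.
have [B B0 wB] := weight_bounded po (2 * eucl z + 2 * n%:R * `|s|).
exists B => // x zx; apply: wB; first exact: eucl_ge0.
by apply: eucl_polydisc => // i; apply: le_trans (zx i) (ler_norm s).
Qed.

Lemma Aspace_entireb (f : A) : entireb f.
Proof.
have [ef [sigma s0 [K K0 /wnorm_boundP fK]]] := Aspace_bound f; split=> // z s.
have [B B0 wB] := weight_polydisc z s; exists (K * expR (sigma * B)) => x zx.
apply: le_trans (fK x) _; rewrite ler_wpM2l// ler_expR ler_pM2l//.
exact: wB.
Qed.

(** The sum is the pointwise limit of the partial sums over boxes; the tails are
    small in the norm of [A_sigma], and Weierstrass' theorem makes it entire. *)
Lemma summable_Aspace (t : mi -> A) (sigma M : R) : 0 < sigma -> 0 <= M ->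
  (forall al, (wnorm rho sigma (t al) <= (M * 4 ^- mi_abs al)%:E)%E) ->
  exists2 g : A, (wnorm rho sigma g <= (M * 2 ^+ n)%:E)%E &
    forall e : R, 0 < e -> exists N, forall J, (box n N `<=` J)%fset ->
      (wnorm rho sigma (Afun (partial_sum t J) - Afun g)%R <= e%:E)%E.
Proof.
move=> s0 M0 tM; pose E (z : V) := M * expR (sigma * w z).
have E0 z : 0 <= E z by rewrite mulr_ge0 ?expR_ge0.
have tE al z : cmod (t al z) <= E z * 4 ^- mi_abs al.
  by have /wnorm_boundP/(_ z) := tM al; rewrite mulrAC.
pose S (J : {fset mi}) z := \sum_(al <- J) t al z.
have SE (J : {fset mi}) z : cmod (S J z) <= E z * \sum_(al <- J) 4 ^- mi_abs al.
  by rewrite mulr_sumr; apply: le_trans (cmod_sum _ _ _) _; apply: ler_sum.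
have Stail (J : {fset mi}) N z : (box n N `<=` J)%fset ->
    cmod (S J z - S (box n N) z) <= E z * (2 ^+ n / 2 ^+ N).
  move=> NJ; have -> : S J z - S (box n N) z = S (J `\` box n N)%fset z.
    rewrite /S (big_fsetID _ (mem (box n N)) J) /=.
    have -> : [fset x in J | x \in box n N]%fset = box n N.
      apply/fsetP => al; rewrite !inE /=; apply/andb_idl; exact: (fsubsetP NJ).
    rewrite addrC addrK; apply: congr_big => //; congr enum_fset.
    by apply/fsetP => al; rewrite !inE /= andbC.
  apply: le_trans (SE _ _) _; rewrite ler_wpM2l//; apply: sum_quarter_tail => al.
  by rewrite inE => /andP[].
have boxS N N' : (N <= N')%N -> (box n N `<=` box n N')%fset.
  move=> NN; apply/fsubsetP => al /boxP alN; apply/boxP => i.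
  exact: leq_trans (alN i) NN.
have lim z : exists l : C, forall e, 0 < e -> exists N, forall k, (N <= k)%N ->
    cmod (S (box n k) z - l) <= e.
  apply: cplx_complete => e e0.
  have e2 : 0 < e / 2 by rewrite divr_gt0.
  have [N hN] := half_pow_small (E z * 2 ^+ n) e2; exists N => j k Nj Nk.
  apply: le_trans (cmod_triangle (S (box n N) z) _ _) _; rewrite (splitr e).
  rewrite -mulrA in hN.
  apply: lerD; first by apply: le_trans (Stail _ _ _ (boxS _ _ Nj)) (ltW hN).
  by rewrite cmod_dist; apply: le_trans (Stail _ _ _ (boxS _ _ Nk)) (ltW hN).
pose g z := projT1 (cid (lim z)).
have gP z e : 0 < e -> exists N, forall k, (N <= k)%N ->
    cmod (S (box n k) z - g z) <= e by exact: (projT2 (cid (lim z))).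
have gtail (J : {fset mi}) N z : (box n N `<=` J)%fset ->
    cmod (S J z - g z) <= 2 * (E z * (2 ^+ n / 2 ^+ N)).
  move=> NJ; apply/ler_addgt0Pr => e /(gP z)[N' hN'].
  apply: le_trans (cmod_triangle (S (box n (maxn N N')) z) _ _) _.
  apply: lerD; last by apply: hN'; exact: leq_maxr.
  apply: le_trans (cmod_triangle (S (box n N) z) _ _) _.
  rewrite mulr_natl mulr2n; apply: lerD; first exact: Stail.
  by rewrite cmod_dist; apply: Stail; apply: boxS; exact: leq_maxl.
have gE z : cmod (g z) <= M * 2 ^+ n * expR (sigma * w z).
  apply/ler_addgt0Pr => e /(gP z)[N hN]; rewrite -[g z](subKr (S (box n N) z)).
  apply: le_trans (cmodB_le _ _) _; apply: lerD; last exact: hN.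
  apply: le_trans (SE _ _) _; rewrite [leRHS]mulrAC ler_wpM2l//; exact: sum_quarter.
have eg : entire g.
  have [] // : entireb g.
  apply: (@weierstrass _ _ (fun N => S (box n N))) => [N|z s e e0].
    have -> : S (box n N) = Afun (partial_sum t (box n N)).
      by apply/funext => z; rewrite partial_sumE.
    exact: Aspace_entireb.
  have [B B0 wB] := weight_polydisc z s.
  have [N hN] := half_pow_small (2 * (M * expR (sigma * B) * 2 ^+ n)) e0.
  exists N => k Nk x zx; apply: le_trans (gtail _ N _ (boxS _ _ Nk)) _.
  apply: le_trans (ltW hN).
  rewrite [leLHS](_ : _ = 2 * (M * expR (sigma * w x) * 2 ^+ n) / 2 ^+ N); last first.
    by rewrite /E; ring.
  rewrite ler_wpM2r ?invr_ge0 ?exprn_ge0// ler_wpM2l// ler_wpM2r ?exprn_ge0//.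
  by rewrite ler_wpM2l// ler_expR ler_pM2l// wB.
have gW : (wnorm rho sigma g <= (M * 2 ^+ n)%:E)%E by exact/wnorm_boundP.
have [G GE] := Aspace_intro eg s0 gW.
exists G; rewrite ?GE//.
move=> e e0; have [N hN] := half_pow_small (2 * (M * 2 ^+ n)) e0.
exists N => J NJ; apply/wnorm_boundP => z.
apply: (@le_trans _ _ (cmod (S J z - g z))).
  by rewrite -GE /S -partial_sumE.
apply: le_trans (gtail J N z NJ) _.
apply: le_trans (ler_wpM2r (expR_ge0 _) (ltW hN)).
by rewrite /E [leRHS](_ : _ = 2 * (M * expR (sigma * w z) * (2 ^+ n / 2 ^+ N)))//; ring.
Qed.

Lemma cvg_partial_sum (t : mi -> A) (g : A) (sigma : R) : 0 < sigma ->
  (forall e : R, 0 < e -> exists N, forall J, (box n N `<=` J)%fset ->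
      (wnorm rho sigma (Afun (partial_sum t J) - Afun g)%R <= e%:E)%E) ->
  partial_sum t @ totally --> g.
Proof.
move=> s0 tg; have PF : ProperFilter (@totally mi) by exact: totally_filter.
have FF : Filter (@totally mi) by exact: filter_filter.
apply: (@cvg_wnorm R n rho _ _ FF _ _ sigma s0) => e /tg[N hN].
by exists (box n N) => // J; exact: hN.
Qed.

End summable_series.

(** * From the coefficients to the operator *)

Section derivative_bounds.
Context (R : realType) (n : nat) (rho1 rho2 rhoh1 : R -> R) (r1 r2 : R).
Local Notation C := (Cplx R).
Local Notation V := ('rV[C]_n).
Local Notation A1 := (@Aspace R n rho1).
Local Notation A2 := (@Aspace R n rho2).
Local Notation mi := (multi_index n).
Local Notation w1 z := (weight rho1 (eucl z)).
Local Notation w2 z := (weight rho2 (eucl z)).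
Local Notation phi := (phi_inv rhoh1).
Hypothesis n_gt0 : (1 <= n)%N.
Hypothesis r1_gt0 : 0 < r1.
Hypotheses (po1 : proximate_order rho1 r1) (po2 : proximate_order rho2 r2).
Hypothesis rho12 : (fun r => r `^ rho1 r) =O_+oo (fun r => r `^ rho2 r).
Hypothesis no1 : normalization rho1 r1 rhoh1.

Lemma weight_le : exists2 K, 0 < K & forall r, 0 <= r ->
  weight rho1 r <= K * (weight rho2 r + 1).
Proof.
move/eqO_exP: rho12 => [k k0 [T [_ hT]]].
have [B B0 wB] := weight_bounded po1 T.
exists (k + B) => [|r r0]; first by rewrite ltr_wpDr.
have w20 := weight_ge0 rho2 r.
have [rT|Tr] := leP r T.
  apply: le_trans (wB r r0 rT) _; rewrite mulrDl mulrDr mulr1 mulrDr mulr1.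
  by rewrite addrA lerDr !addr_ge0 ?mulr_ge0// ltW.
have := hT r Tr; rewrite /= !ger0_norm ?powR_ge0// => h.
apply: le_trans h _; apply: ler_pM => //; first exact: ltW.
  by rewrite lerDl.
by rewrite lerDl.
Qed.

(** [Gseq q] is [phi q ^ q] up to the geometric factor [k0 ^ q], which is
    absorbed by the arbitrary [lam] of the class of operators. *)
Let k0 : R := (expR 1 * r1) `^ r1^-1.

Let k0_gt0 : 0 < k0.
Proof. by rewrite powR_gt0// mulr_gt0// expR_gt0. Qed.

Lemma GseqE q : Gseq rhoh1 r1 q = phi q%:R ^+ q / k0 ^+ q.
Proof. by rewrite /Gseq (mulrC q%:R) powRrM powR_mulrn// ltW. Qed.

Lemma phi_exp_gt0 q : 0 < phi q%:R ^+ q.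
Proof.
case: q => [|q]; first by rewrite expr0.
by rewrite exprn_gt0//; have [] := phiP no1 (ltr0Sn R q).
Qed.

(** Polydiscs of radius comparable to [phi q], on which the weight is about
    [q], are the right choice for derivatives of order [q]. *)
Lemma good_radius : exists2 B, 0 <= B & forall q : nat, exists2 s, 0 < s &
  s ^+ q = phi q%:R ^+ q / (2 * n%:R) ^+ q /\
  weight rho1 (2 * n%:R * s) <= q%:R + B.
Proof.
have [B B0 hB] := weight_phi po1 no1.
have n0 : 0 < 2 * n%:R :> R by rewrite mulr_gt0// ltr0n.
exists (B + weight rho1 (2 * n%:R)) => [|[|q]]; first by rewrite addr_ge0 ?weight_ge0.
  exists 1 => //; split; first by rewrite !expr0 divr1.
  by rewrite mulr1 add0r lerDr.
have [p0 _] := phiP no1 (ltr0Sn R q).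
exists (phi q.+1%:R / (2 * n%:R)); first by rewrite divr_gt0.
split; first by rewrite expr_div_n.
rewrite mulrC divfK ?gt_eqF//; apply: le_trans (hB _ (ltr0Sn R q)) _.
by rewrite lerD2l lerDl weight_ge0.
Qed.

(** The Cauchy estimate on the polydisc of [good_radius]: there the weight is at
    most [D (D (2 w1 z + 1) + q + B + 1)], so that its exponential costs only the
    [q]-th power of a constant besides [exp (sigma' w1 z)]. *)
Lemma mi_derive_bound (sigma : R) : 0 < sigma ->
  exists2 sigma', 0 < sigma' & exists2 B, 0 < B & exists2 kap, 0 < kap &
  forall (f : A1) (K : R), 0 <= K -> (wnorm rho1 sigma f <= K%:E)%E ->
  forall (al : mi) z, cmod (mi_derive al f z) <=
    K * B * (mi_fact al)%:R * (kap ^+ mi_abs al / phi (mi_abs al)%:R ^+ mi_abs al)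
      * expR (sigma' * w1 z).
Proof.
move=> s0; have [D D1 wD] := weight_subadd po1 r1_gt0.
have [B B0 rad] := good_radius.
have D0 : 0 < D by exact: lt_le_trans D1.
pose sigma' := sigma * D * D * 2.
pose kap := 4 * n%:R * expR 1 * expR (sigma * D).
pose B' := expR (sigma * D * (D + B + 1)).
exists sigma'; first by rewrite !mulr_gt0.
exists B'; first exact: expR_gt0.
exists kap; first by rewrite !mulr_gt0 ?expR_gt0// ltr0n.
move=> f K K0 /wnorm_boundP fK al z; set q := mi_abs al.
have [s sp [sq ws]] := rad q.
have zb x : polydisc z s x -> cmod (f x) <=
    K * (expR (sigma' * w1 z) * (B' * expR (sigma * D) ^+ q)).
  move=> zx; apply: le_trans (fK x) _; rewrite ler_wpM2l// -expRM_natl -!expRD ler_expR.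
  have h1 : w1 x <= D * (weight rho1 (2 * eucl z) + weight rho1 (2 * n%:R * s) + 1).
    apply: wD; rewrite ?eucl_ge0 ?mulr_ge0 ?eucl_ge0 ?(ltW sp)//.
    by apply: eucl_polydisc; rewrite ?(ltW sp).
  have h2 : weight rho1 (2 * eucl z) <= D * (w1 z + w1 z + 1).
    by apply: wD; rewrite ?mulr_ge0 ?eucl_ge0// mulr_natl mulr2n.
  apply: le_trans (ler_wpM2l (ltW s0) h1) _.
  apply: (@le_trans _ _ (sigma * (D * (D * (w1 z + w1 z + 1) + (q%:R + B) + 1)))).
    rewrite ler_wpM2l ?(ltW s0)// ler_wpM2l ?(ltW D0)// lerD2r.
    exact: lerD.
  rewrite [leRHS](_ : _ = sigma * (D * (D * (w1 z + w1 z + 1) + (q%:R + B) + 1)))//.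
  by rewrite /sigma'; ring.
have ef := Aspace_entireb po1 f.
apply: le_trans (cauchy_mi al ef sp zb) _; rewrite -/q.
rewrite [leLHS](_ : _ = K * B' * (mi_fact al)%:R * (kap ^+ q / phi q%:R ^+ q)
      * expR (sigma' * w1 z))//.
have n0 : 0 < 2 * n%:R :> R by rewrite mulr_gt0// ltr0n.
have -> : (2 * expR 1 / s) ^+ q = (2 * expR 1 * (2 * n%:R)) ^+ q / phi q%:R ^+ q.
  by rewrite [LHS]expr_div_n sq invf_div [X in _ = X / _]exprMn mulrA.
rewrite (_ : kap = 2 * expR 1 * (2 * n%:R) * expR (sigma * D)); last by rewrite /kap; ring.
rewrite [in RHS]exprMn; set X := (2 * expR 1 * _) ^+ q; ring.
Qed.

Lemma mi_derive_linear (al : mi) (c : C) (f g : V -> C) : entireb f -> entireb g ->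
  mi_derive al (c *: f + g) = c *: mi_derive al f + mi_derive al g.
Proof.
move=> ef eg; rewrite !mi_deriveE.
have pl i (F G : V -> C) : entireb F -> entireb G ->
    partial i (c *: F + G) = c *: partial i F + partial i G.
  move=> [eF _] [eG _]; apply/funext => x; rewrite /partial.
  have D := is_deriveD (is_deriveZ c (entire_derive x (ebase i) eF))
                       (entire_derive x (ebase i) eG).
  exact: (@derive_val _ _ _ _ _ _ _ D).
have il i k (F G : V -> C) : entireb F -> entireb G ->
    iter k (partial i) (c *: F + G) = c *: iter k (partial i) F + iter k (partial i) G.
  move=> eF eG; elim: k => [|k IH]; first exact: erefl.
  rewrite !iterS IH; apply: pl; exact: entireb_iter.
elim: (enum 'I_n) => [|i r IH]; first exact: erefl.
rewrite [LHS]/= IH; apply: il; exact: entireb_foldd.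
Qed.

Lemma op_series_unique (a : mi -> A2) (f : A1) (g g' : A2) :
  op_series a f g -> op_series a f g' -> g = g'.
Proof.
move=> [t tE tg] [t' t'E tg'].
have tt' : t = t'.
  by apply/funext => al; apply/Afun_inj/funext => z; rewrite tE t'E.
have PF : ProperFilter (@totally mi) by exact: totally_filter.
by apply: (cvg_unique_A PF tg); rewrite tt'.
Qed.

(** The powers [phi q ^ q] in the bounds of the coefficients and of the
    derivatives of [f] cancel, and [lam = k0 / (4 kap)] leaves the factor
    [4 ^- q]; the weight [exp (sigma' w1)] is a weight for [rho2] by
    [weight_le]. *)
Lemma op_series_exists (a : mi -> A2) : op_class rhoh1 r1 a ->
  forall sigma : R, 0 < sigma -> exists2 tau, 0 < tau & exists2 K, 0 <= K &
  forall (f : A1) (M : R), 0 <= M -> (wnorm rho1 sigma f <= M%:E)%E ->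
    exists2 g : A2, op_series a f g & (wnorm rho2 tau g <= (K * M)%:E)%E.
Proof.
move=> aP sigma s0; have [sigma' s0' [B B0 [kap kap0 dB]]] := mi_derive_bound s0.
have [K12 K12_0 w12] := weight_le.
have lam0 : 0 < k0 / (4 * kap) by rewrite divr_gt0// mulr_gt0.
have [tau t0 [L L0 aL]] := aP _ lam0.
pose tau' := tau + sigma' * K12.
have t0' : 0 < tau' by rewrite addr_gt0// mulr_gt0.
pose K := L * B * expR (sigma' * K12).
have K0 : 0 < K by rewrite !mulr_gt0 ?expR_gt0.
exists tau' => //; exists (K * 2 ^+ n); first by rewrite mulr_ge0// ?exprn_ge0// ltW.
move=> f M M0 fM.
have term_bound (al : mi) : (wnorm rho2 tau' (fun z => a al z * mi_derive al f z)%R <=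
    (K * M * 4 ^- mi_abs al)%:E)%E.
  apply/wnorm_boundP => z; have /wnorm_boundP/(_ z) az := aL al.
  have fz := dB f M M0 fM al z; move: az fz; rewrite cmodM GseqE.
  set q := mi_abs al; set fa := (mi_fact al)%:R => az fz.
  have fa0 : fa != 0 :> R.
    by rewrite pnatr_eq0 -lt0n prodn_gt0// => i; rewrite fact_gt0.
  apply: le_trans (ler_pM (cmod_ge0 _) (cmod_ge0 _) az fz) _.
  have p0 := phi_exp_gt0 q; have kq : 0 < k0 ^+ q by rewrite exprn_gt0.
  have kapq : 0 < kap ^+ q by rewrite exprn_gt0.
  rewrite [leLHS](_ : _ = L * B * M * 4 ^- q * (expR (tau * w2 z) * expR (sigma' * w1 z))).
    rewrite (_ : K * M * _ * _ = L * B * M * 4 ^- q *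
      (expR (sigma' * K12) * expR (tau' * w2 z))); last by rewrite /K; ring.
    rewrite ler_wpM2l ?mulr_ge0 ?invr_ge0 ?exprn_ge0 ?(ltW L0) ?(ltW B0)//.
    rewrite -!expRD ler_expR /tau' mulrDl addrCA lerD2l.
    rewrite -mulrA -mulrDr ler_wpM2l ?(ltW s0')// addrC.
    by rewrite -[X in _ + X]mulr1 -mulrDr; apply: w12; exact: eucl_ge0.
  rewrite expr_div_n exprMn; field.
  by rewrite fa0 !gt_eqF// exprn_gt0.
have [ef _] := Aspace_entireb po1 f.
have tA (al : mi) : exists g : A2, Afun g = (fun z => a al z * mi_derive al f z).
  apply: Aspace_intro t0' (term_bound al); apply: entireM.
    by have [] := Aspace_entireb po2 (a al).
  by have [] := entireb_mi al (Aspace_entireb po1 f).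
pose t al := projT1 (cid (tA al)).
have tE al : Afun (t al) = (fun z => a al z * mi_derive al f z).
  exact: projT2 (cid (tA al)).
have KM : 0 <= K * M by rewrite mulr_ge0// ltW.
have tB (al : mi) : (wnorm rho2 tau' (t al) <= (K * M * 4 ^- mi_abs al)%:E)%E.
  by rewrite tE.
have [g gB gt] := summable_Aspace po2 t0' KM tB.
exists g; last by rewrite mulrAC.
exists t; first by move=> al z; rewrite tE.
exact: cvg_partial_sum t0' gt.
Qed.

Lemma op_series_ex (a : mi -> A2) : op_class rhoh1 r1 a ->
  forall f : A1, exists g : A2, op_series a f g.
Proof.
move=> aP f; have [_ [sigma s0 [M M0 fM]]] := Aspace_bound f.
have [tau _ [K _ H]] := op_series_exists aP s0.
by have [g gP _] := H f M M0 fM; exists g.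
Qed.

Lemma op_series_eval (a : mi -> A2) (f : A1) (g : A2) z : op_series a f g ->
  forall e : R, 0 < e -> \forall J \near @totally mi,
    cmod (g z - \sum_(al <- (J : {fset mi})) a al z * mi_derive al f z) <= e.
Proof.
move=> [t tE tg] e e0; have PF : ProperFilter (@totally mi) by exact: totally_filter.
have FF : Filter (@totally mi) by exact: filter_filter.
have /cplx_cvgP/(_ _ e0) := @cvg_eval _ _ _ _ _ FF _ _ z tg.
apply: filterS => J; rewrite partial_sumE.
by under eq_bigr do rewrite tE.
Qed.

(** Linearity is checked on the values, at finite partial sums. *)
Lemma op_series_linear (a : mi -> A2) (c : C) (f f' : A1) (g g' h : A2) :
  op_series a f g -> op_series a f' g' -> op_series a (c *: f + f') h ->
  h = c *: g + g'.
Proof.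
move=> fg fg' fh; apply/Afun_inj/funext => z; apply/eqP.
have PF : ProperFilter (@totally mi) by exact: totally_filter.
rewrite -subr_eq0 -cmod_eq0 eq_le cmod_ge0 andbT.
apply/ler_addgt0Pr => e e0; rewrite add0r.
have c1 : 0 < cmod c + 2 by rewrite ltr_wpDl ?cmod_ge0.
have d0 : 0 < e / (cmod c + 2) by rewrite divr_gt0.
have [J [[h1 h2] h3]] := filter_ex (filterI (filterI (op_series_eval z fg d0)
  (op_series_eval z fg' d0)) (op_series_eval z fh d0)).
have eJ : \sum_(al <- J) a al z * mi_derive al (c *: f + f') z =
    c * (\sum_(al <- J) a al z * mi_derive al f z) + \sum_(al <- J) a al z * mi_derive al f' z.
  rewrite mulr_sumr -big_split /=; apply: eq_bigr => al _.
  have -> : mi_derive al (c *: f + f') z = c * mi_derive al f z + mi_derive al f' z.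
    by rewrite (mi_derive_linear _ _ (Aspace_entireb po1 f) (Aspace_entireb po1 f')).
  by ring.
rewrite eJ in h3; move: h1 h2 h3.
set x := \sum_(al <- J) _; set y := \sum_(al <- J) _ => h1 h2 h3.
rewrite [X in cmod X](_ : _ = (h z - (c * x + y)) - (c * (g z - x) + (g' z - y))); last first.
  have -> : Afun (c *: g + g') z = c * g z + g' z by [].
  by ring.
apply: le_trans (cmodB_le _ _) _.
apply: (@le_trans _ _ (e / (cmod c + 2) + (cmod c * (e / (cmod c + 2)) + e / (cmod c + 2)))).
  apply: lerD => //; apply: le_trans (ler_cmodD _ _) _; apply: lerD => //.
  by rewrite cmodM ler_wpM2l ?cmod_ge0.
by rewrite le_eqVlt; apply/orP; left; apply/eqP; field; rewrite gt_eqF.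
Qed.

Theorem op_class_operator (a : mi -> A2) : op_class rhoh1 r1 a ->
  (forall f : A1, exists! g : A2, op_series a f g) /\
  (exists2 P : {linear A1 -> A2}, continuous P & forall f, op_series a f (P f)).
Proof.
move=> aP; split=> [f|].
  have [g fg] := op_series_ex aP f; exists g; split=> // g' fg'.
  exact: op_series_unique fg fg'.
pose P0 f := projT1 (cid (op_series_ex aP f)).
have P0P f : op_series a f (P0 f) by exact: projT2 (cid (op_series_ex aP f)).
have Plin : linear P0.
  by move=> c f f'; exact: op_series_linear (P0P f) (P0P f') (P0P _).
pose PL := GRing.isLinear.Build _ _ _ _ P0 Plin.
pose P : {linear A1 -> A2} := HB.pack P0 PL.
exists P; last exact: P0P.
apply: bounded_continuous => sigma s0.
have [tau t0 [K K0 H]] := op_series_exists aP s0.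
exists tau => //; exists K => // f M M0 fM; have [g fg gM] := H f M M0 fM.
have -> : P f = g by exact: op_series_unique (P0P f) fg.
exact: gM.
Qed.

End derivative_bounds.

(** * Derivatives of linear combinations *)

Section derivatives_of_sums.
Context (R : realType) (n : nat).
Local Notation C := (Cplx R).
Local Notation V := ('rV[C]_n).
Implicit Types (f g : V -> C) (al : multi_index n) (z : V).

Lemma entireb0 : entireb (0 : V -> C).
Proof.
split; first exact: entire_cst.
by move=> z s; exists 0 => x _; rewrite [X in cmod X](_ : _ = 0) ?cmod0.
Qed.

Lemma mi_derive0 al : mi_derive al (0 : V -> C) = 0.
Proof.
have := mi_derive_linear al (-1) entireb0 entireb0.
by rewrite scaler0 addr0 scaleN1r addNr.
Qed.

Lemma mi_deriveZ al (c : C) f z : entireb f ->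
  mi_derive al (c *: f) z = c * mi_derive al f z.
Proof.
move=> ef; have := mi_derive_linear al c ef entireb0.
by rewrite mi_derive0 !addr0 => ->.
Qed.

Lemma mi_deriveD al f g z : entireb f -> entireb g ->
  mi_derive al (f + g) z = mi_derive al f z + mi_derive al g z.
Proof.
move=> ef eg; have := mi_derive_linear al 1 ef eg.
by rewrite !scale1r => ->.
Qed.

Lemma mi_deriveB al f g z : entireb f -> entireb g ->
  mi_derive al (f - g) z = mi_derive al f z - mi_derive al g z.
Proof.
move=> ef eg; have := mi_derive_linear al (-1) eg ef.
by rewrite !scaleN1r ![- _ + _]addrC => ->.
Qed.

Lemma mi_derive_sum (rho : R -> R) (r0 : R) al (I : Type) (r : seq I)
    (F : I -> Aspace n rho) z : proximate_order rho r0 ->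
  mi_derive al (Afun (\sum_(i <- r) F i)) z = \sum_(i <- r) mi_derive al (F i) z.
Proof.
move=> po; elim: r => [|i r IH]; first by rewrite !big_nil mi_derive0.
by rewrite !big_cons mi_deriveD ?IH//; exact: Aspace_entireb po _.
Qed.

End derivatives_of_sums.

(** * Taylor series converge in the weighted space *)

Section taylor_series.
Context (R : realType) (n : nat) (rho1 rhoh1 : R -> R) (r1 : R).
Local Notation C := (Cplx R).
Local Notation V := ('rV[C]_n).
Local Notation A1 := (@Aspace R n rho1).
Local Notation mi := (multi_index n).
Local Notation w1 z := (weight rho1 (eucl z)).
Local Notation phi := (phi_inv rhoh1).
Hypothesis n_gt0 : (1 <= n)%N.
Hypothesis r1_gt0 : 0 < r1.
Hypothesis po1 : proximate_order rho1 r1.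
Hypothesis no1 : normalization rho1 r1 rhoh1.

Lemma mi_fact_gt0 (al : mi) : (0 < mi_fact al)%N.
Proof. by rewrite prodn_gt0// => i; rewrite fact_gt0. Qed.

(** As [|x_i - z_i| <= |x| + |z|], it suffices to estimate [|x| ^ q] and
    [|z| ^ q] by [monomial_weight]. The dependence on [z] is then [exp (sigma w1)], an
    admissible growth for the coefficients of an operator. *)
Lemma mono_wnorm (e : R) : 0 < e -> exists2 sigma, 0 < sigma & exists2 K, 0 < K &
  forall z (al : mi), (wnorm rho1 sigma (@mono R n z al) <=
    (K * (e ^+ mi_abs al * phi (mi_abs al)%:R ^+ mi_abs al) * expR (sigma * w1 z))%:E)%E.
Proof.
move=> e0; have e2 : 0 < e / 2 by rewrite divr_gt0.
have [sigma s0 [K K1 mK]] := monomial_weight po1 r1_gt0 no1 e2.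
have K0 : 0 < K by exact: lt_le_trans K1.
exists sigma => //; exists (2 * K); first by rewrite mulr_gt0.
move=> z al; apply/wnorm_boundP => x; set q := mi_abs al.
have x0 := eucl_ge0 x; have z0 := eucl_ge0 z.
have e1 y : 1 <= expR (sigma * weight rho1 y).
  by rewrite -expR0 ler_expR mulr_ge0 ?weight_ge0// ltW.
pose X := K * (e / 2 * phi q%:R) ^+ q; have X0 : 0 <= X.
  have p0 := phi_exp_gt0 no1 q.
  by rewrite mulr_ge0 ?(ltW K0)// exprMn mulr_ge0 ?(ltW p0)// exprn_ge0 ?(ltW e2).
have h : cmod (mono z al x) <= 2 ^+ q * (eucl x ^+ q + eucl z ^+ q).
  apply: (@le_trans _ _ ((eucl x + eucl z) ^+ q)).
    apply: mono_le => i; apply: le_trans (cmodB_le _ _) _.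
    by apply: lerD; exact: coord_eucl.
  have [xz|zx] := leP (eucl x) (eucl z).
    apply: (@le_trans _ _ ((2 * eucl z) ^+ q)).
      rewrite lerXn2r ?nnegrE ?addr_ge0 ?mulr_ge0//.
      by rewrite mulr_natl mulr2n lerD2r.
    by rewrite exprMn ler_wpM2l ?exprn_ge0// lerDr exprn_ge0.
  apply: (@le_trans _ _ ((2 * eucl x) ^+ q)).
    rewrite lerXn2r ?nnegrE ?addr_ge0 ?mulr_ge0//.
    by rewrite mulr_natl mulr2n lerD2l ltW.
  by rewrite exprMn ler_wpM2l ?exprn_ge0// lerDl exprn_ge0.
apply: le_trans h _.
apply: (@le_trans _ _ (2 ^+ q * (X * (expR (sigma * w1 z) * expR (sigma * w1 x)) +
    X * (expR (sigma * w1 z) * expR (sigma * w1 x))))).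
  rewrite ler_wpM2l ?exprn_ge0//; apply: lerD.
    apply: le_trans (mK q _ x0) _; rewrite ler_wpM2l//.
    by rewrite ler_peMl ?expR_ge0.
  apply: le_trans (mK q _ z0) _; rewrite ler_wpM2l//.
  by rewrite ler_peMr ?expR_ge0.
have E (t a p u v : R) : t != 0 ->
    t * (K * (a / t * p) * (u * v) + K * (a / t * p) * (u * v)) =
    2 * K * (a * p) * u * v by move=> t1; field.
by rewrite /X exprMn expr_div_n E// expf_neq0.
Qed.

Lemma monoA_ex z (al : mi) : exists g : A1, Afun g = mono z al.
Proof.
have [sigma s0 [K K0 mK]] := mono_wnorm ltr01.
exact: Aspace_intro (entire_mono z al) s0 (mK z al).
Qed.

Definition monoA z al : A1 := projT1 (cid (monoA_ex z al)).

Lemma monoAE z al : Afun (monoA z al) = mono z al.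
Proof. exact: projT2 (cid (monoA_ex z al)). Qed.

Definition taylor_term (f : V -> C) z (al : mi) : A1 :=
  (mi_derive al f z / (mi_fact al)%:R) *: monoA z al.

(** The bounds of [mi_derive_bound] and of [mono_wnorm] have reciprocal powers of
    [phi q], and the free constant in the latter is taken to be [1 / (4 kap)]. *)
Lemma taylor_wnorm (f : A1) z : exists2 sigma, 0 < sigma & exists2 K, 0 <= K &
  forall al, (wnorm rho1 sigma (taylor_term f z al) <= (K * 4 ^- mi_abs al)%:E)%E.
Proof.
have [_ [sigma s0 [K K0 fK]]] := Aspace_bound f.
have [sigma' s0' [B B0 [kap kap0 dB]]] := mi_derive_bound n_gt0 r1_gt0 po1 no1 s0.
have e0 : 0 < (4 * kap)^-1 by rewrite invr_gt0 mulr_gt0.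
have [tau t0 [L L0 mL]] := mono_wnorm e0.
exists tau => //; exists (K * B * L * expR (sigma' * w1 z) * expR (tau * w1 z)).
  by rewrite !mulr_ge0 ?expR_ge0// ltW.
move=> al; have := wnormZ_le (mi_derive al f z / (mi_fact al)%:R) (mL z al).
rewrite -monoAE => /le_trans; apply; rewrite lee_fin.
have fz := dB f K K0 fK al z; move: fz; set q := mi_abs al => fz.
have fa0 : 0 < (mi_fact al)%:R :> R by rewrite ltr0n mi_fact_gt0.
have p0 : 0 < phi q%:R ^+ q := phi_exp_gt0 no1 q.
rewrite cmodM cmodV cmod_nat.
have kq : 0 < kap ^+ q by rewrite exprn_gt0.
apply: (@le_trans _ _ (K * B * (kap ^+ q / phi q%:R ^+ q) * expR (sigma' * w1 z) *
  (L * ((4 * kap)^-1 ^+ q * phi q%:R ^+ q) * expR (tau * w1 z)))).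
  apply: ler_wpM2r.
    apply: mulr_ge0; last exact: expR_ge0.
    apply: mulr_ge0; first exact: ltW.
    by apply: mulr_ge0; [apply: exprn_ge0; exact: ltW|exact: ltW].
  rewrite ler_pdivrMr//; apply: le_trans fz _.
  by rewrite le_eqVlt; apply/orP; left; apply/eqP; ring.
rewrite exprVn exprMn le_eqVlt; apply/orP; left; apply/eqP; field.
by rewrite !gt_eqF// exprn_gt0.
Qed.

(** The sum of the Taylor series of [f] at [z] has the same derivatives as [f]
    at [z], by the Cauchy estimates applied to the remainders; hence it is [f]. *)
Theorem taylor_series (f : A1) z :
  partial_sum (taylor_term f z) @ totally --> f.
Proof.
have [sigma s0 [K K0 tK]] := taylor_wnorm f z.
have [S _ tS] := summable_Aspace po1 s0 K0 tK.
have cS := cvg_partial_sum s0 tS.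
suff fS : S = f by rewrite fS in cS.
have eS := Aspace_entireb po1 S; have ef := Aspace_entireb po1 f.
have eSf : entireb (Afun (f - S)) := Aspace_entireb po1 (f - S).
suff fS0 x : Afun (f - S) x = 0.
  by apply/Afun_inj/funext => x; apply/esym/eqP; rewrite -subr_eq0; apply/eqP; exact: fS0.
apply: (flat_eq0 (z := z)) => // be.
apply/eqP; rewrite -cmod_eq0 eq_le cmod_ge0 andbT.
apply/ler_addgt0Pr => e e0; rewrite add0r.
have [B B0 wB] := weight_polydisc po1 z 1.
pose c := (mi_fact be)%:R * (2 * expR 1 / 1) ^+ mi_abs be * expR (sigma * B).
have c0 : 0 < c.
  by rewrite !mulr_gt0 ?expR_gt0 ?exprn_gt0 ?mulr_gt0 ?expR_gt0// ltr0n mi_fact_gt0.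
have ec : 0 < e / c by rewrite divr_gt0.
have [N hN] := tS _ ec.
pose J : {fset mi} := (box n N `|` [fset be])%fset.
have NJ : (box n N `<=` J)%fset by exact: fsubsetUl.
have beJ : be \in J by rewrite !inE eqxx orbT.
have /wnorm_boundP JS := hN J NJ.
have dJ : mi_derive be (partial_sum (taylor_term f z) J) z = mi_derive be f z.
  have -> : partial_sum (taylor_term f z) J = \sum_(al <- J) taylor_term f z al.
    by rewrite /partial_sum big_seq_fsetE.
  rewrite (mi_derive_sum _ _ _ _ po1) (bigD1_seq be beJ (fset_uniq J)) /= big1 ?addr0 => [|al albe].
    rewrite (mi_deriveZ _ _ _ (Aspace_entireb po1 _)) monoAE mi_derive_mono eqxx.
    by rewrite divfK// pnatr_eq0 -lt0n mi_fact_gt0.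
  rewrite (mi_deriveZ _ _ _ (Aspace_entireb po1 _)) monoAE mi_derive_mono.
  by rewrite eq_sym (negPf albe) mulr0.
have fJ : mi_derive be (Afun (f - S)) z =
    mi_derive be (Afun (partial_sum (taylor_term f z) J - S)) z.
  have eJ := Aspace_entireb po1 (partial_sum (taylor_term f z) J).
  have E1 := mi_deriveB be z ef eS; have E2 := mi_deriveB be z eJ eS.
  by rewrite dJ in E2; exact: etrans E1 (esym E2).
rewrite fJ; have ep := Aspace_entireb po1 (partial_sum (taylor_term f z) J - S).
have bnd y : polydisc z 1 y ->
    cmod (Afun (partial_sum (taylor_term f z) J - S) y) <= e / c * expR (sigma * B).
  move=> zy; apply: le_trans (JS y) _; rewrite ler_wpM2l ?(ltW ec)//.
  by rewrite ler_expR ler_pM2l// wB.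
apply: le_trans (cauchy_mi be ep ltr01 bnd) _.
rewrite [leLHS](_ : _ = c * (e / c)); last first.
  by rewrite mulrCA [in RHS]mulrC /c -mulrA.
by rewrite mulrC divfK ?gt_eqF.
Qed.

End taylor_series.

(** * Shifted monomials in terms of monomials *)

Section polynomial_expansion.
Context (R : realType) (n : nat).
Local Notation C := (Cplx R).
Local Notation V := ('rV[C]_n).
Local Notation mi := (multi_index n).

Lemma exprB_expand (x z : C) (a M : nat) : (a <= M)%N ->
  (x - z) ^+ a = \sum_(k < M.+1) ('C(a, k)%:R * (- z) ^+ (a - k)) * x ^+ k.
Proof.
move=> aM; rewrite addrC exprDn.
rewrite (big_ord_widen M.+1 (fun k => ((- z) ^+ (a - k) * x ^+ k) *+ 'C(a, k)))//.
rewrite big_mkcond /=; apply: eq_bigr => k _; case: ifP => [_|/negbT].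
  by rewrite -mulr_natl mulrA.
by rewrite -leqNgt => ak; rewrite bin_small// !mul0r.
Qed.

Definition mono_coef (al : mi) (M : nat) (h : {ffun 'I_n -> 'I_M}) (z : V) : C :=
  \prod_i ('C(al i, h i)%:R * (- z ord0 i) ^+ (al i - h i)).

Lemma mono_expand (al : mi) (M : nat) (z x : V) : (forall i, al i <= M)%N ->
  mono z al x = \sum_(h : {ffun 'I_n -> 'I_M.+1})
    mono_coef al h z * mono 0 ([ffun i => nat_of_ord (h i)] : mi) x.
Proof.
move=> alM; rewrite /mono.
rewrite (eq_bigr (fun i => \sum_(k < M.+1)
  ('C(al i, k)%:R * (- z ord0 i) ^+ (al i - k)) * x ord0 i ^+ k)); last first.
  by move=> i _; exact: exprB_expand.
rewrite (bigA_distr_bigA (fun (i : 'I_n) (k : 'I_M.+1) =>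
  ('C(al i, k)%:R * (- z ord0 i) ^+ (al i - k)) * x ord0 i ^+ k)) /=.
apply: eq_bigr => h _; rewrite big_split /=; congr (_ * _).
by apply: eq_bigr => i _; rewrite ffunE mxE subr0.
Qed.

Lemma entire_mono_coef (al : mi) (M : nat) (h : {ffun 'I_n -> 'I_M}) :
  entire (mono_coef al h).
Proof.
apply: entire_prod => i; apply: entireM; first exact: entire_cst.
apply: entireX; have -> : (fun x : V => - x ord0 i) = (fun x => (-1) * x ord0 i).
  by apply/funext => x; rewrite mulN1r.
by apply: entireM; [exact: entire_cst|exact: entire_coord].
Qed.

End polynomial_expansion.

(** * From the operator to the coefficients *)

Section representation.
Context (R : realType) (n : nat) (rho1 rho2 rhoh1 : R -> R) (r1 r2 : R).
Local Notation C := (Cplx R).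
Local Notation V := ('rV[C]_n).
Local Notation A1 := (@Aspace R n rho1).
Local Notation A2 := (@Aspace R n rho2).
Local Notation mi := (multi_index n).
Local Notation w1 z := (weight rho1 (eucl z)).
Local Notation w2 z := (weight rho2 (eucl z)).
Local Notation phi := (phi_inv rhoh1).
Hypothesis n_gt0 : (1 <= n)%N.
Hypothesis r1_gt0 : 0 < r1.
Hypotheses (po1 : proximate_order rho1 r1) (po2 : proximate_order rho2 r2).
Hypothesis rho12 : (fun r => r `^ rho1 r) =O_+oo (fun r => r `^ rho2 r).
Hypothesis no1 : normalization rho1 r1 rhoh1.
Local Notation monoA z al := (monoA r1_gt0 po1 no1 z al).
Variable F : {linear A1 -> A2}.
Hypothesis cF : continuous F.

(** Expanding [(x - z) ^ al] in powers of [x], [F (monoA z al)] is a combination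
    of finitely many fixed functions with coefficients polynomial in [z]. *)
Lemma entire_diagonal (al : mi) : entire (fun z => Afun (F (monoA z al)) z).
Proof.
pose M := (\max_i al i)%N; have alM i : (al i <= M)%N by exact: (leq_bigmax i).
pose b (h : {ffun 'I_n -> 'I_M.+1}) : mi := [ffun i => nat_of_ord (h i)].
have E z : monoA z al = \sum_(h <- index_enum {ffun 'I_n -> 'I_M.+1})
    mono_coef al h z *: monoA 0 (b h).
  apply/Afun_inj/funext => x; rewrite monoAE Afun_sum (mono_expand z x alM).
  by apply: eq_bigr => h _; rewrite AfunZ monoAE.
have -> : (fun z => Afun (F (monoA z al)) z) = (fun z =>
    \sum_(h <- index_enum {ffun 'I_n -> 'I_M.+1})
      mono_coef al h z * Afun (F (monoA 0 (b h))) z).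
  apply/funext => z; rewrite E linear_sum Afun_sum; apply: eq_bigr => h _.
  by rewrite linearZ AfunZ.
apply: entire_sum => h; apply: entireM; first exact: entire_mono_coef.
by have [] := Aspace_entireb po2 (F (monoA 0 (b h))).
Qed.

(** [F] is bounded from [A_sigma] to some [A_tau], where [sigma] is the one that
    [mono_wnorm] associates with the given [lam]. *)
Lemma diagonal_bound (lam : R) : 0 < lam -> exists2 tau, 0 < tau & exists2 K, 0 < K &
  forall al z, cmod (Afun (F (monoA z al)) z) <=
    K * Gseq rhoh1 r1 (mi_abs al) * lam ^+ mi_abs al * expR (tau * w2 z).
Proof.
move=> lam0; pose k0 : R := (expR 1 * r1) `^ r1^-1.
have k0_gt0 : 0 < k0 by rewrite powR_gt0// mulr_gt0// expR_gt0.
have e0 : 0 < lam / k0 by rewrite divr_gt0.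
have [sigma s0 [K K0 mK]] := mono_wnorm n r1_gt0 po1 no1 e0.
have [tau t0 [L L0 FL]] := continuous_bounded cF s0.
have [K12 K12_0 w12] := weight_le po1 rho12.
exists (tau + sigma * K12); first by rewrite addr_gt0// mulr_gt0.
exists ((L + 1) * K * expR (sigma * K12)).
  by rewrite !mulr_gt0 ?expR_gt0// ltr_wpDl.
move=> al z; rewrite (GseqE _ r1_gt0) -/k0; set q := mi_abs al.
have p0 : 0 < phi q%:R ^+ q := phi_exp_gt0 no1 q.
have mz := mK z al; rewrite -(monoAE r1_gt0 po1 no1) -/q in mz.
pose N := K * ((lam / k0) ^+ q * phi q%:R ^+ q) * expR (sigma * w1 z).
have N0 : 0 < N.
  apply: mulr_gt0; last exact: expR_gt0.
  by apply: mulr_gt0 => //; apply: mulr_gt0 => //; apply: exprn_gt0.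
have /wnorm_boundP/(_ z) Fz := FL _ _ N0 mz.
apply: le_trans Fz _.
apply: (@le_trans _ _ ((L + 1) * N * expR (tau * w2 z))).
  rewrite ler_wpM2r ?expR_ge0// ler_wpM2r ?(ltW N0)//.
  by rewrite lerDl.
rewrite /N expr_div_n.
have -> : (L + 1) * (K * (lam ^+ q / k0 ^+ q * phi q%:R ^+ q) * expR (sigma * w1 z))
    * expR (tau * w2 z) =
  (L + 1) * K * (phi q%:R ^+ q / k0 ^+ q) * lam ^+ q *
    (expR (sigma * w1 z) * expR (tau * w2 z)) by ring.
have -> : (L + 1) * K * expR (sigma * K12) * (phi q%:R ^+ q / k0 ^+ q) * lam ^+ q *
    expR ((tau + sigma * K12) * w2 z) =
  (L + 1) * K * (phi q%:R ^+ q / k0 ^+ q) * lam ^+ q *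
    (expR (sigma * K12) * expR ((tau + sigma * K12) * w2 z)) by ring.
apply: ler_wpM2l.
  apply: mulr_ge0; last by apply: exprn_ge0; exact: ltW.
  apply: mulr_ge0; first by apply: mulr_ge0; [exact: addr_ge0|exact: ltW].
  by apply: divr_ge0; [exact: ltW|apply: exprn_ge0; exact: ltW].
rewrite -!expRD ler_expR mulrDl addrC addrCA lerD2l.
rewrite -mulrA -mulrDr ler_wpM2l ?(ltW s0)// addrC.
by rewrite -[X in _ + X]mulr1 -mulrDr; apply: w12; exact: eucl_ge0.
Qed.

(** The coefficient of order [al] at [z] has to be [1 / al!] times the value at
    [z] of the image of the shifted monomial [x |-> (x - z) ^ al]. *)
Lemma coef_exists : exists2 a : mi -> A2, op_class rhoh1 r1 a &
  forall al z, a al z * (mi_fact al)%:R = Afun (F (monoA z al)) z.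
Proof.
pose c (al : mi) (z : V) : C := (mi_fact al)%:R^-1 * Afun (F (monoA z al)) z.
have f0 (al : mi) : 0 < (mi_fact al)%:R :> R by rewrite ltr0n mi_fact_gt0.
have cB lam : 0 < lam -> exists2 tau, 0 < tau & exists2 K, 0 < K & forall al,
   (wnorm rho2 tau (c al) <= (K * (Gseq rhoh1 r1 (mi_abs al) / (mi_fact al)%:R)
      * lam ^+ mi_abs al)%:E)%E.
  move=> lam0; have [tau t0 [K K0 H]] := diagonal_bound lam0.
  exists tau => //; exists K => // al; apply/wnorm_boundP => z.
  rewrite /c cmodM cmodV cmod_nat mulrC ler_pdivrMr//; apply: le_trans (H al z) _.
  rewrite le_eqVlt; apply/orP; left; apply/eqP; field.
  by rewrite gt_eqF.
have cA al : exists g : A2, Afun g = c al.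
  have [tau t0 [K K0 H]] := cB 1 ltr01; apply: Aspace_intro t0 (H al).
  by apply: entireM; [exact: entire_cst|exact: entire_diagonal].
pose a al := projT1 (cid (cA al)).
have aE al : Afun (a al) = c al by exact: projT2 (cid (cA al)).
exists a => [lam lam0|al z].
  have [tau t0 [K K0 H]] := cB lam lam0.
  by exists tau => //; exists K => // al; rewrite aE.
by rewrite aE /c mulrC mulVKf// pnatr_eq0 -lt0n mi_fact_gt0.
Qed.

(** Testing [F f = P f] on [f = monoA z al] at the point [z], where only the
    derivative of order [al] survives, determines the coefficients. *)
Lemma coef_unique (a : mi -> A2) : (forall f : A1, op_series a f (F f)) ->
  forall al z, a al z * (mi_fact al)%:R = Afun (F (monoA z al)) z.
Proof.
move=> aF al z; apply/eqP; rewrite -subr_eq0 -cmod_eq0 eq_le cmod_ge0 andbT.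
apply/ler_addgt0Pr => e e0; rewrite add0r cmod_dist.
have [A _ hA] := op_series_eval z (aF (monoA z al)) e0.
have := hA ([fset al] `|` A)%fset (fsubsetUr _ _).
rewrite (bigD1_seq al) ?fset_uniq ?inE ?eqxx//= big1 ?addr0 => [|be beal].
  by rewrite monoAE mi_derive_mono eqxx.
by rewrite monoAE mi_derive_mono (negPf beal) mulr0.
Qed.

(** [F] may be applied term by term to the Taylor series of [f] at [z]; the value
    at the same point [z] of the result is the series of [P f] at [z]. *)
Lemma coef_represents (a : mi -> A2) : op_class rhoh1 r1 a ->
  (forall al z, a al z * (mi_fact al)%:R = Afun (F (monoA z al)) z) ->
  forall f : A1, op_series a f (F f).
Proof.
move=> aP aE f.
have [g fg] := op_series_ex n_gt0 r1_gt0 po1 po2 rho12 no1 aP f.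
suff <- : g = F f by [].
apply/Afun_inj/funext => z; apply/eqP.
rewrite -subr_eq0 -cmod_eq0 eq_le cmod_ge0 andbT.
apply/ler_addgt0Pr => e e0; rewrite add0r; have e2 : 0 < e / 2 by rewrite divr_gt0.
have PF : ProperFilter (@totally mi) by exact: totally_filter.
have FF : Filter (@totally mi) by exact: filter_filter.
have fT := @taylor_series R n rho1 rhoh1 r1 n_gt0 r1_gt0 po1 no1 f z.
have FT : (F \o partial_sum (taylor_term r1_gt0 po1 no1 f z)) @ totally --> F f.
  by move=> U /cF nU; exact: (fT _ nU).
have /cplx_cvgP/(_ _ e2) h1 := @cvg_eval _ _ _ _ _ FF _ _ z FT.
have [J [h1J h2J]] := filter_ex (filterI h1 (op_series_eval z fg e2)).
have E : Afun (F (partial_sum (taylor_term r1_gt0 po1 no1 f z) J)) z =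
    \sum_(al <- J) a al z * mi_derive al f z.
  rewrite /partial_sum big_seq_fsetE linear_sum Afun_sum; apply: eq_bigr => al _.
  rewrite linearZ AfunZ -aE mulrC -mulrA; congr (_ * _).
  by rewrite mulrCA mulfV ?mulr1// pnatr_eq0 -lt0n mi_fact_gt0.
rewrite /= E in h1J.
apply: le_trans (cmod_triangle (\sum_(al <- J) a al z * mi_derive al f z) _ _) _.
by rewrite (splitr e); apply: lerD => //; rewrite cmod_dist.
Qed.

End representation.

Theorem theorem4p5 (R : realType) (n : nat) (rho1 rho2 : R -> R) (r1 r2 : R)
    (rhoh1 : R -> R) :
  (1 <= n)%N -> 0 < r1 -> 0 < r2 ->
  proximate_order rho1 r1 -> proximate_order rho2 r2 ->
  (fun r => r `^ rho1 r) =O_+oo (fun r => r `^ rho2 r) ->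
  normalization rho1 r1 rhoh1 ->
  (forall a : multi_index n -> Aspace n rho2, op_class rhoh1 r1 a ->
     (forall f : Aspace n rho1, exists! g : Aspace n rho2, op_series a f g) /\
     (exists2 P : {linear Aspace n rho1 -> Aspace n rho2},
        continuous P & forall f, op_series a f (P f))) /\
  (forall F : {linear Aspace n rho1 -> Aspace n rho2}, continuous F ->
     exists! a : multi_index n -> Aspace n rho2,
       op_class rhoh1 r1 a /\ forall f, op_series a f (F f)).
Proof.
move=> n_gt0 r1_gt0 r2_gt0 po1 po2 rho12 no1; split.
  exact: (op_class_operator n_gt0 r1_gt0 po1 po2 rho12 no1).
move=> F cF; have [a aP aE] := coef_exists r1_gt0 po1 po2 rho12 no1 cF.
exists a; split.
  split=> // f.
  exact: (coef_represents n_gt0 po2 rho12 cF aP aE f).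
move=> b [bP bF]; apply/funext => al; apply/Afun_inj/funext => z.
have bE := coef_unique r1_gt0 po1 no1 bF al z.
apply: (@mulIf _ (mi_fact al)%:R); first by rewrite pnatr_eq0 -lt0n mi_fact_gt0.
by rewrite bE aE.
Qed.
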